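(* Let $\Omega\subset\mathbb R^3$ be a bounded polyhedral domain with a quasi-uniform family of tetrahedral triangulations $\mathcal T_h$, and let $\epsilon\in[0,1]$. Let $A_{\operatorname{div}}$, $A_{\operatorname{curl}}$, $A_{\operatorname{grad}^3}$, $D_{\operatorname{div}}$, $\Pi_h^{\operatorname{div}}$ be as defined in the context, and define the Hiptmair--Xu preconditioner by $$B_{\operatorname{div}}=D_{\operatorname{div}}^{-1}+\Pi_h^{\operatorname{div}}A_{\operatorname{grad}^3}^{-1}(\Pi_h^{\operatorname{div}})^t+\epsilon^{-1}\operatorname{curl}A_{\operatorname{curl}}^{-1}\operatorname{curl}^t\quad\text{if }\epsilon>0,$$ $$B_{\operatorname{div}}=D_{\operatorname{div}}^{-1}+\Pi_h^{\operatorname{div}}A_{\operatorname{grad}^3}^{-1}(\Pi_h^{\operatorname{div}})^t\quad\text{if }\epsilon=0.$$ Assume the discrete regular decomposition property: there is a constant $C_R$, independent of the mesh, such that for every $v_h\in H_h(\operatorname{div})$ there exist $\tilde v_h\in H_h(\operatorname{div})$, $\psi_h\in H_h(\operatorname{grad})^3$ and $w_h\in H_h(\operatorname{curl})$ with $$v_h=\tilde v_h+\Pi_h^{\operatorname{div}}\psi_h+\operatorname{curl}w_h,$$ $$\|h^{-1}\tilde v_h\|_{L^2}^2+\|\psi_h\|_{H^1}^2\le C_R\|\operatorname{div}v_h\|_{L^2}^2,\qquad \|w_h\|_{H(\operatorname{curl})}^2\le C_R\|v_h\|_{H(\operatorname{div})}^2.$$ Then there is a constant $C$, independent of the mesh size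 and of $\epsilon\in[0,1]$, such that, whenever $A_{\operatorname{div}}\ne0$, $$\kappa(B_{\operatorname{div}}A_{\operatorname{div}})\le C.$$
   Context: Finite element spaces on $\mathcal T_h$, all with homogeneous essential boundary conditions on $\partial\Omega$ (conforming in $H_0(\mathsf D;\Omega)$): $H_h(\operatorname{grad})\subset H_0^1(\Omega)$ is the space of continuous piecewise linear functions; $H_h(\operatorname{curl})\subset H_0(\operatorname{curl};\Omega)$ is the lowest-order Nédélec edge element space; $H_h(\operatorname{div})\subset H_0(\operatorname{div};\Omega)$ is the lowest-order Raviart--Thomas face element space. $h\in L^\infty(\Omega)$ is the piecewise constant mesh diameter function. For $\mathsf D\in\{\operatorname{curl},\operatorname{div}\}$, $A_{\mathsf D}$ is the operator (stiffness matrix) on $H_h(\mathsf D)$ of the bilinear form $(\mathsf Du,\mathsf Dv)_{L^2}+\epsilon(u,v)_{L^2}$; $A_{\operatorname{grad}^3}$ is that of $(\operatorname{grad}\psi,\operatorname{grad}\varphi)_{L^2}+\epsilon(\psi,\varphi)_{L^2}$ on vector fields $H_h(\operatorname{grad})^3$. Operators may be identified with matrices in the nodal bases with Euclidean inner products, and $^t$ denotes the adjoint (transpose); $\operatorname{curl}$ is regarded as a map $H_h(\operatorname{curl})\to H_h(\operatorname{div})$. $D_{\operatorname{div}}$ is the diagonal of $A_{\operatorname{div}}$ in the standard face basis of $H_h(\operatorname{div})$ ($D_{\operatorname{div}}^{-1}$ is the nodal Jacobi smoother). $\Pi_h^{\operatorname{div}}$ is the canonical interpolation into $H_h(\operatorname{div})$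 matching the degrees of freedom (face normal fluxes), restricted to $H_h(\operatorname{grad})^3$; it satisfies $\|\Pi_h^{\operatorname{div}}\psi_h\|_{L^2}\lesssim\|\psi_h\|_{L^2}$ for $\psi_h\in H_h(\operatorname{grad})^3$, and $\operatorname{div}\Pi_h^{\operatorname{div}}\psi_h$ is the canonical interpolant of $\operatorname{div}\psi_h$ into piecewise constants. $\|v\|_{H(\mathsf D)}^2=\|v\|_{L^2}^2+\|\mathsf Dv\|_{L^2}^2$. $\kappa(BA)=\lambda_{\max}(BA)/\lambda_{\min}(BA)$, where $\lambda_{\max}$ is the largest eigenvalue and $\lambda_{\min}$ the smallest nonzero eigenvalue of $BA$. Quasi-uniform means shape-regular with all element diameters comparable, with uniform constants; $C$ may depend on $\Omega$, on these constants and on $C_R$. *)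

(* Defs.v *)
From HB Require Import structures.
From mathcomp Require Import all_boot all_order all_algebra.
From mathcomp Require Import all_classical all_reals all_analysis.

Set Implicit Arguments.
Unset Strict Implicit.
Unset Printing Implicit Defensive.

Import Order.TTheory GRing.Theory Num.Theory.
Import numFieldNormedType.Exports.

Local Open Scope classical_set_scope.
Local Open Scope ring_scope.

(** * Euclidean space R^3 *)

Section Space.
Variable R : realType.
Implicit Types (u v x c : 'rV[R]_3) (S : set 'rV[R]_3).

Definition dot u v : R := \sum_k u 0 k * v 0 k.

(* Index arithmetic is that of the ring 'I_3, i.e. modulo 3. *)
Definition cross u v : 'rV[R]_3 :=
  \row_k (u 0 (k + 1) * v 0 (k + 2) - u 0 (k + 2) * v 0 (k + 1)).

(* The norm that the library puts on 'rV_3 is the sup norm. *)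
Definition enorm u : R := Num.sqrt (dot u u).

Definition eball c (r : R) : set 'rV[R]_3 := [set x | enorm (x - c) <= r].

Definition diam S : R :=
  sup [set d | exists x y, [/\ S x, S y & d = enorm (x - y)]].

(* Diameter of the largest inscribed ball. *)
Definition indiam S : R :=
  sup [set d | exists c r, [/\ 0 <= r, eball c r `<=` S & d = 2 * r]].

Definition bdry S : set 'rV[R]_3 := closure S `\` interior S.

Definition hull n (P : 'I_n -> 'rV[R]_3) (s : {set 'I_n}) : set 'rV[R]_3 :=
  [set x | exists c : 'I_n -> R,
     [/\ forall i, i \in s -> 0 <= c i, \sum_(i in s) c i = 1
       & x = \sum_(i in s) c i *: P i]].

Definition affinely_independent n (P : 'I_n -> 'rV[R]_3) (s : {set 'I_n}) :=
  forall c : 'I_n -> R, \sum_(i in s) c i = 0 ->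
    \sum_(i in s) c i *: P i = 0 -> forall i, i \in s -> c i = 0.

(* The library does not infer sigma-finiteness of a bare product measure. *)
Definition leb2 := ((@lebesgue_measure R \x @lebesgue_measure R)%E).

HB.instance Definition _ := Measure.on leb2.

Lemma leb2_sigma_finite : sigma_finite setT leb2.
Proof.
have /sigma_finiteP[F [TF ndF Foo]] := sigma_finiteT (@lebesgue_measure R).
exists (fun n => F n `*` F n).
  rewrite -setXTT TF predeqE => -[x y]; split.
    move=> [/= [n _ Fnx] [k _ Fky]]; exists (maxn n k) => //; split.
    - by move: x Fnx; exact/subsetPset/ndF/leq_maxl.
    - by move: y Fky; exact/subsetPset/ndF/leq_maxr.
  by move=> [n _ []/= ? ?]; split; exists n.
move=> k; have [? ?] := Foo k.
split; first exact: measurableX.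
by rewrite /leb2 product_measure1E// lte_mul_pinfty// ge0_fin_numE.
Qed.

HB.instance Definition _ := Measure_isSigmaFinite.Build _ _ _ leb2
  leb2_sigma_finite.

(* Lebesgue measure on R^3, through the identification of R * R * R with
   'rV[R]_3. *)
Definition leb3 := ((leb2 \x @lebesgue_measure R)%E).

HB.instance Definition _ := Measure.on leb3.

Definition row3 (p : R * R * R) : 'rV[R]_3 :=
  \row_k nth 0 [:: p.1.1; p.1.2; p.2] k.

Definition integral3 S (f : 'rV[R]_3 -> R) : R :=
  (\int[leb3]_(p in row3 @^-1` S) f (row3 p))%R.

Definition ref_triangle : set (R * R) :=
  [set p | [/\ 0 <= p.1, 0 <= p.2 & p.1 + p.2 <= 1]].

(* \int_F v . n dS over the triangle F = q0 q1 q2, oriented by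
   (q1 - q0) x (q2 - q0), in the affine parametrization of F. *)
Definition triangle_flux (v : 'rV[R]_3 -> 'rV[R]_3) (q0 q1 q2 : 'rV[R]_3) : R :=
  (\int[leb2]_(p in ref_triangle)
     dot (v (q0 + p.1 *: (q1 - q0) + p.2 *: (q2 - q0)))
         (cross (q1 - q0) (q2 - q0)))%R.

(* \int_E w . t ds over the segment E from q0 to q1. *)
Definition segment_circulation (w : 'rV[R]_3 -> 'rV[R]_3)
    (q0 q1 : 'rV[R]_3) : R :=
  (\int[@lebesgue_measure R]_(s in `[0%R, 1%R]%classic)
     dot (w (q0 + s *: (q1 - q0))) (q1 - q0))%R.

Definition partial (k : 'I_3) (f : 'rV[R]_3 -> R) x : R :=
  'D_(delta_mx 0 k) f x.

Definition grad (f : 'rV[R]_3 -> R) x : 'rV[R]_3 := \row_k partial k f x.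

Definition div (v : 'rV[R]_3 -> 'rV[R]_3) x : R :=
  \sum_k partial k (fun y => v y 0 k) x.

Definition curl (v : 'rV[R]_3 -> 'rV[R]_3) x : 'rV[R]_3 :=
  \row_k (partial (k + 1) (fun y => v y 0 (k + 2)) x
          - partial (k + 2) (fun y => v y 0 (k + 1)) x).

End Space.

(** * Polyhedral domains and their triangulations *)

(* No Lipschitz condition is imposed: the boundary is a finite union of
   triangles, and slits are allowed. *)
Definition polyhedral_domain (R : realType) (Omega : set 'rV[R]_3) : Prop :=
  [/\ Omega !=set0, open Omega, connected Omega, bounded_set Omega
    & exists (m : nat) (Q : 'I_m -> 'I_3 -> 'rV[R]_3),
        (forall j, affinely_independent (Q j) [set: 'I_3]%SET) /\
        bdry Omega = \bigcup_j hull (Q j) [set: 'I_3]%SET].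

(* A tetrahedron is given by its set of four vertices.  The condition
   tri_boundary says that the mesh faces resolve the boundary; it only matters
   for slits, being automatic if Omega is the interior of its closure. *)
Record triangulation (R : realType) (Omega : set 'rV[R]_3) := Triangulation {
  nvert : nat;
  vertex : 'I_nvert -> 'rV[R]_3;
  tets : {set {set 'I_nvert}};
  tri_card : forall t, t \in tets -> #|t| = 4%N;
  tri_nondegenerate : forall t, t \in tets -> affinely_independent vertex t;
  tri_vertices : forall i, exists2 t, t \in tets & i \in t;
  tri_conforming : forall t t', t \in tets -> t' \in tets ->
    hull vertex t `&` hull vertex t' = hull vertex (t :&: t')%SET;
  tri_cover : \bigcup_(t in [set` tets]) hull vertex t = closure Omega;
  tri_boundary : forall x, bdry Omega x -> exists t f : {set 'I_nvert},
    [/\ t \in tets, f \subset t, #|f| = 3%N, hull vertex f x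
      & hull vertex f `<=` bdry Omega]
}.

(** * Finite element spaces *)

Section FiniteElements.
Variables (R : realType) (Omega : set 'rV[R]_3) (T : triangulation Omega).

Local Notation point := 'rV[R]_3.
Local Notation simplex := {set 'I_(nvert T)}.
Local Notation cell s := (hull (@vertex R Omega T) s).

(* A piecewise polynomial function is given by its polynomial on each
   tetrahedron; differential operators act elementwise, which gives the weak
   derivative of the conforming functions below. *)
Definition sfield := simplex -> point -> R.
Definition vfield := simplex -> point -> point.

Definition bgrad (p : sfield) : vfield := fun t => grad (p t).
Definition bdiv (v : vfield) : sfield := fun t => div (v t).
Definition bcurl (w : vfield) : vfield := fun t => curl (w t).
Definition component (v : vfield) (k : 'I_3) : sfield := fun t x => v t x 0 k.

(* L^2(Omega) inner products; the skeleton of the mesh is Lebesgue-null. *)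
Definition l2s (p q : sfield) : R :=
  \sum_(t in tets T) integral3 (cell t) (fun x => p t x * q t x).
Definition l2v (u v : vfield) : R :=
  \sum_(t in tets T) integral3 (cell t) (fun x => dot (u t x) (v t x)).

Definition form_div (eps : R) (u v : vfield) : R :=
  l2s (bdiv u) (bdiv v) + eps * l2v u v.
Definition form_curl (eps : R) (u v : vfield) : R :=
  l2v (bcurl u) (bcurl v) + eps * l2v u v.
Definition form_grad3 (eps : R) (psi phi : vfield) : R :=
  \sum_k l2v (bgrad (component psi k)) (bgrad (component phi k))
  + eps * l2v psi phi.

Definition sqnorm_L2 (v : vfield) : R := l2v v v.
Definition sqnorm_Hdiv (v : vfield) : R := l2v v v + l2s (bdiv v) (bdiv v).
Definition sqnorm_Hcurl (w : vfield) : R := l2v w w + l2v (bcurl w) (bcurl w).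
Definition sqnorm_H1 (psi : vfield) : R :=
  l2v psi psi + \sum_k l2v (bgrad (component psi k)) (bgrad (component psi k)).

Definition meshsize (t : simplex) : R := diam (cell t).
Definition hinv (v : vfield) : vfield := fun t x => (meshsize t)^-1 *: v t x.

Definition simplices (k : nat) : {set simplex} :=
  [set s : simplex | (#|s| == k) && [exists t in tets T, s \subset t]]%SET.
Definition interior_vertices : {set 'I_(nvert T)} :=
  [set i | ~~ `[< bdry Omega (vertex i) >]]%SET.
Definition interior_edges : {set simplex} :=
  [set e in simplices 2 | ~~ `[< cell e `<=` bdry Omega >]]%SET.
Definition interior_faces : {set simplex} :=
  [set f in simplices 3 | ~~ `[< cell f `<=` bdry Omega >]]%SET.

(* enum lists the vertices in increasing order, which fixes the orientation of
   the edges and faces. *)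
Definition corner (s : simplex) (k : nat) : point :=
  nth 0 [seq vertex i | i <- enum s] k.

Definition face_normal (f : simplex) : point :=
  cross (corner f 1 - corner f 0) (corner f 2 - corner f 0).

Definition in_Hgrad (p : sfield) : Prop :=
  [/\ forall t, t \in tets T ->
        exists (a : R) (b : point), forall x, p t x = a + dot b x,
      forall t t' x, t \in tets T -> t' \in tets T ->
        cell t x -> cell t' x -> p t x = p t' x
    & forall t x, t \in tets T -> cell t x -> bdry Omega x -> p t x = 0].

Definition in_Hgrad3 (psi : vfield) : Prop :=
  forall k, in_Hgrad (component psi k).

(* The tangential trace is single-valued on every face and edge shared by two
   tetrahedra, and vanishes on those contained in the boundary. *)
Definition in_Hcurl (w : vfield) : Prop :=
  [/\ forall t, t \in tets T ->
        exists a b : point, forall x, w t x = a + cross b x,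
      forall t t' (s : simplex) x i j, t \in tets T -> t' \in tets T ->
        s \subset t -> s \subset t' -> cell s x -> i \in s -> j \in s ->
        dot (w t x) (vertex j - vertex i) = dot (w t' x) (vertex j - vertex i)
    & forall t (s : simplex) x i j, t \in tets T -> s \subset t ->
        cell s `<=` bdry Omega -> cell s x -> i \in s -> j \in s ->
        dot (w t x) (vertex j - vertex i) = 0].

Definition in_Hdiv (v : vfield) : Prop :=
  [/\ forall t, t \in tets T ->
        exists (a : point) (b : R), forall x, v t x = a + b *: x,
      forall t t' (f : simplex) x, t \in tets T -> t' \in tets T -> f \in simplices 3 ->
        f \subset t -> f \subset t' -> cell f x ->
        dot (v t x) (face_normal f) = dot (v t' x) (face_normal f)
    & forall t (f : simplex) x, t \in tets T -> f \in simplices 3 -> f \subset t ->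
        cell f `<=` bdry Omega -> cell f x ->
        dot (v t x) (face_normal f) = 0].

(** ** Degrees of freedom and nodal bases *)

(* The degrees of freedom below are evaluated in some tetrahedron containing
   the simplex; for functions with the relevant continuity the choice is
   immaterial. *)
Definition tet_of (s : simplex) : simplex :=
  odflt s [pick t in tets T | s \subset t].

Definition vertex_dof (p : sfield) (i : 'I_(nvert T)) : R :=
  p (tet_of [set i]%SET) (vertex i).
Definition edge_dof (w : vfield) (e : simplex) : R :=
  segment_circulation (w (tet_of e)) (corner e 0) (corner e 1).
Definition face_dof (v : vfield) (f : simplex) : R :=
  triangle_flux (v (tet_of f)) (corner f 0) (corner f 1) (corner f 2).

Definition Hgrad_basis (i : 'I_(nvert T)) : sfield :=
  xget (fun _ _ => 0) [set p : sfield | in_Hgrad p /\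
    forall j, j \in interior_vertices -> vertex_dof p j = (j == i)%:R].
Definition Hcurl_basis (e : simplex) : vfield :=
  xget (fun _ _ => 0) [set w : vfield | in_Hcurl w /\
    forall e', e' \in interior_edges -> edge_dof w e' = (e' == e)%:R].
Definition Hdiv_basis (f : simplex) : vfield :=
  xget (fun _ _ => 0) [set v : vfield | in_Hdiv v /\
    forall f', f' \in interior_faces -> face_dof v f' = (f' == f)%:R].

Definition Hgrad3_basis (ik : 'I_(nvert T) * 'I_3) : vfield :=
  fun t x => Hgrad_basis ik.1 t x *: delta_mx 0 ik.2.

Definition grad3_nodes : {set 'I_(nvert T) * 'I_3} :=
  [set ik : 'I_(nvert T) * 'I_3 | ik.1 \in interior_vertices]%SET.

Definition Pi_div (psi : vfield) : vfield :=
  fun t x => \sum_(f in interior_faces)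
    face_dof psi f *: Hdiv_basis f t x.

(** ** Matrices in the nodal bases *)

Definition stiffness (I : finType) (K : {set I}) (phi : I -> vfield)
    (a : vfield -> vfield -> R) : 'M[R]_#|K| :=
  \matrix_(i, j) a (phi (enum_val j)) (phi (enum_val i)).

Definition A_div (eps : R) : 'M[R]_#|interior_faces| :=
  stiffness _ Hdiv_basis (form_div eps).
Definition A_curl (eps : R) : 'M[R]_#|interior_edges| :=
  stiffness _ Hcurl_basis (form_curl eps).
Definition A_grad3 (eps : R) : 'M[R]_#|grad3_nodes| :=
  stiffness _ Hgrad3_basis (form_grad3 eps).

Definition D_div (eps : R) : 'M[R]_#|interior_faces| :=
  diag_mx (\row_i A_div eps i i).

(* The coordinates of an element of H_h(div) in the nodal basis are its face
   fluxes. *)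
Definition Pi_div_mx : 'M[R]_(#|interior_faces|, #|grad3_nodes|) :=
  \matrix_(i, j) face_dof (Pi_div (Hgrad3_basis (enum_val j))) (enum_val i).
Definition curl_mx : 'M[R]_(#|interior_faces|, #|interior_edges|) :=
  \matrix_(i, j) face_dof (bcurl (Hcurl_basis (enum_val j))) (enum_val i).

Definition B_div (eps : R) : 'M[R]_#|interior_faces| :=
  invmx (D_div eps)
  + Pi_div_mx *m invmx (A_grad3 eps) *m Pi_div_mx^T
  + (if 0 < eps
     then eps^-1 *: (curl_mx *m invmx (A_curl eps) *m curl_mx^T) else 0).

Definition discrete_regular_decomposition (CR : R) : Prop :=
  forall v, in_Hdiv v -> exists vt psi w : vfield,
    [/\ [/\ in_Hdiv vt, in_Hgrad3 psi & in_Hcurl w],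
        forall t x, t \in tets T ->
          v t x = vt t x + Pi_div psi t x + bcurl w t x,
        sqnorm_L2 (hinv vt) + sqnorm_H1 psi <= CR * l2s (bdiv v) (bdiv v)
      & sqnorm_Hcurl w <= CR * sqnorm_Hdiv v].

End FiniteElements.

Definition quasi_uniform (R : realType) (Omega : set 'rV[R]_3) (sigma tau : R)
    (I : Type) (Th : I -> triangulation Omega) : Prop :=
  forall i,
    (forall t, t \in tets (Th i) ->
       meshsize t <= sigma * indiam (hull (@vertex _ _ (Th i)) t)) /\
    (forall t t', t \in tets (Th i) -> t' \in tets (Th i) ->
       meshsize t <= tau * meshsize t').

(** * Condition number *)

Definition lambda_max (R : realType) n (M : 'M[R]_n) : R :=
  sup [set a | eigenvalue M a].
Definition lambda_min (R : realType) n (M : 'M[R]_n) : R :=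
  inf [set a | eigenvalue M a /\ a != 0].
Definition kappa (R : realType) n (M : 'M[R]_n) : R :=
  lambda_max M / lambda_min M.

(* Main.v *)
Require Import Defs.
From HB Require Import structures.
From mathcomp Require Import all_boot all_order all_algebra.
From mathcomp Require Import all_classical all_reals all_analysis.
From mathcomp Require Import measurable_realfun ring lra.

Import Order.TTheory GRing.Theory Num.Theory.
Import numFieldNormedType.Exports.
Local Open Scope classical_set_scope.
Local Open Scope ring_scope.

(** Auxiliary-space argument.  An eigenvalue [a != 0] of [B A] satisfies
[(B A y, A y) = a (A y, y)] for some [y] with [(A y, y) > 0], so it is enough to
bound [(B A y, A y)] above and below by multiples of [(A y, y)].  Each summand of
[B] has the form [P C^-1 P^t]: the upper bound follows from the stability
[(A P z, P z) <= M (C z, z)] of each [P], the lower bound from Young's inequality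
and the discrete regular decomposition, which writes [y] as a sum of [P z] with
[sum (C z, z) <= c (A y, y)].

Stability of the smoother only uses that at most four face functions are supported
on a tetrahedron; that of [curl] uses [div curl = 0].  For the interpolation into
the face elements, a Raviart-Thomas field on a tetrahedron is
[- sum_p (v . grad lambda_p)(x - p)], the trace being taken on the face opposite to
[p], and [|grad lambda_p|] is at most a constant over the diameter of the
tetrahedron; since [sum_p grad lambda_p = 0], the divergence of the interpolant is
controlled by the gradient.  All inverse estimates reduce to
[p(vertex)^2 |t| <= K int_t p^2] for affine [p], proved by comparing a cube contained
in the image of the inscribed ball under a homothety of ratio 1/4 with a cube
containing [t]. *)

Set Implicit Arguments.
Unset Strict Implicit.
Unset Printing Implicit Defensive.

(** * Quadratic forms and preconditioners *)

Section QuadraticForms.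
Context {R : realFieldType}.

(** Uniformity in [eps] comes from reading the third block as P C^-1 P^t with [C = eps *: A_curl]:
    its stability constant is then 1, and the bound on w_h in the full H(div) norm, multiplied by
    [eps <= 1], becomes a bound by the energy. For [eps = 0] discrete curls lie in the kernel of
    [A_div], so the missing block costs nothing. The lower bound uses Young's inequality with one
    weight for all three spaces; with the total constant of the decomposition plus 1 as weight, half
    of the energy absorbs the auxiliary norms. The diagonal of [A_div] also has a mass part, which
    is compared with h^-2 through a bound on all mesh sizes, available because the domain is
    bounded. The nodal bases are specified only by their degrees of freedom, through a choice
    operator; much of the work identifies them on the mesh with explicit fields in barycentric
    coordinates and checks that these conform. The inverses in [B_div] mean something only for
    invertible blocks; the delicate one is [A_grad3] at [eps = 0]. *)

Definition qform n (A : 'M[R]_n) (x y : 'rV[R]_n) : R := (x *m A *m y^T) 0 0.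

Definition psd n (A : 'M[R]_n) : Prop :=
  A^T = A /\ forall x, 0 <= qform A x x.

Lemma qformE n (A : 'M[R]_n) x y :
  qform A x y = \sum_i \sum_j x 0 i * y 0 j * A i j.
Proof.
rewrite /qform mxE exchange_big; apply: eq_bigr => j _.
by rewrite !mxE mulr_suml; apply: eq_bigr => i _; rewrite mulrAC.
Qed.

Lemma qformDr n (A : 'M[R]_n) x y z :
  qform A x (y + z) = qform A x y + qform A x z.
Proof. by rewrite /qform linearD /= mulmxDr mxE. Qed.

Lemma qformDl n (A : 'M[R]_n) x y z :
  qform A (x + y) z = qform A x z + qform A y z.
Proof. by rewrite /qform !mulmxDl mxE. Qed.

Lemma qformZr n (A : 'M[R]_n) a x y : qform A x (a *: y) = a * qform A x y.
Proof. by rewrite /qform linearZ /= -scalemxAr mxE. Qed.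

Lemma qformZl n (A : 'M[R]_n) a x y : qform A (a *: x) y = a * qform A x y.
Proof. by rewrite /qform -!scalemxAl mxE. Qed.

Lemma qform_sym n (A : 'M[R]_n) x y : A^T = A -> qform A x y = qform A y x.
Proof.
move=> As; rewrite /qform.
have -> : x *m A *m y^T = (y *m A *m x^T)^T by rewrite !trmx_mul trmxK As mulmxA.
by rewrite mxE.
Qed.

Lemma qformDm n (A B : 'M[R]_n) x y : qform (A + B) x y = qform A x y + qform B x y.
Proof. by rewrite /qform mulmxDr mulmxDl mxE. Qed.

Lemma qformZm n (A : 'M[R]_n) a x y : qform (a *: A) x y = a * qform A x y.
Proof. by rewrite /qform -scalemxAr -scalemxAl mxE. Qed.

Lemma psdZ n (A : 'M[R]_n) a : 0 <= a -> psd A -> psd (a *: A).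
Proof.
move=> a0 [As Ap]; split; first by rewrite linearZ /= As.
by move=> x; rewrite qformZm mulr_ge0.
Qed.

Lemma psd_young n (A : 'M[R]_n) x y (th : R) : psd A -> 0 < th ->
  2 * qform A x y <= th * qform A x x + th^-1 * qform A y y.
Proof.
move=> [As Ap] th0; have := Ap (th *: x - y).
rewrite -scaleN1r !qformDl !qformDr !qformZl !qformZr (@qform_sym _ A y x)// => h.
have {h} h : 0 <= th * th * qform A x x - 2 * th * qform A x y + qform A y y by nra.
rewrite -(ler_pM2l th0) mulrDr [X in _ <= _ + X]mulrA divff ?gt_eqF// mul1r; lra.
Qed.

Lemma psd_cauchy_schwarz n (A : 'M[R]_n) x y : psd A ->
  qform A x y ^+ 2 <= qform A x x * qform A y y.
Proof.
move=> Ap; have [As A0] := Ap.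
have [x0|x0] := eqVneq (qform A x x) 0.
  suff -> : qform A x y = 0 by rewrite x0 mul0r expr0n.
  apply/eqP; rewrite -sqrf_eq0 eq_le sqr_ge0 andbT.
  (* For a null vector [x] the quadratic in [a] degenerates to an affine function, which can stay
     nonnegative only if its slope vanishes. *)
  have h (a : R) : 0 <= 2 * a * qform A x y + qform A y y.
    have := A0 (a *: x + y).
    by rewrite !qformDl !qformDr !qformZl !qformZr (@qform_sym _ A y x)// x0; lra.
  rewrite leNgt; apply/negP => q0.
  (* This [a] would give the affine function the value -1. *)
  have := h (- (qform A y y + 1) / (2 * qform A x y ^+ 2) * qform A x y).
  have q1 : qform A x y != 0 by rewrite -sqrf_eq0 gt_eqF.
  suff -> : 2 * (- (qform A y y + 1) / (2 * qform A x y ^+ 2) * qform A x y) *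
    qform A x y = - (qform A y y + 1) by lra.
  by field.
have xp : 0 < qform A x x by rewrite lt_def x0 A0.
have := A0 (y - (qform A x y / qform A x x) *: x).
rewrite -scaleNr !qformDl !qformDr !qformZl !qformZr (@qform_sym _ A y x)// => h.
rewrite mulrC -ler_pdivrMr// -subr_ge0; move: h; congr (_ <= _).
by field.
Qed.

(** Cauchy-Schwarz against the coordinate vectors. Needed because [A_div] may be only
    semidefinite. *)
Lemma psd_ker n (A : 'M[R]_n) y : psd A -> qform A y y = 0 -> y *m A = 0.
Proof.
move=> Ap y0; apply/rowP => j; rewrite [RHS]mxE.
have := psd_cauchy_schwarz y (delta_mx 0 j) Ap.
rewrite y0 mul0r => h; have /eqP : qform A y (delta_mx 0 j) ^+ 2 = 0.
  by apply/le_anti; rewrite h sqr_ge0.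
by rewrite sqrf_eq0 /qform trmx_delta -colE [in X in X -> _]mxE => /eqP.
Qed.

(** [invmx] returns its argument on a singular matrix, so this criterion has to be applied to
    [A_grad3] and [A_curl] before their inverses can be used. *)
Lemma qform_unit n (A : 'M[R]_n) :
  (forall y, qform A y y = 0 -> y = 0) -> A \in unitmx.
Proof.
move=> h; rewrite -row_free_unit.
by apply: inj_row_free => v vA; apply: h; rewrite /qform vA mul0mx mxE.
Qed.

Section Subspace.
Variables (n m : nat) (A : 'M[R]_n) (C : 'M[R]_m) (P : 'M[R]_(n, m)).
Hypotheses (Ap : psd A) (Cp : psd C) (Cu : C \in unitmx).

(** The correction computed in the auxiliary space: the representative, in the inner product of [C],
    of the functional that sends [s] to [qform A y (s *m P^T)]. *)
Let corr (y : 'rV[R]_n) := y *m A *m P *m invmx C.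

Let corrC y : corr y *m C = y *m A *m P.
Proof. by rewrite /corr mulmxKV. Qed.

Let qform_corr y s : qform A y (s *m P^T) = qform C (corr y) s.
Proof. by rewrite /qform corrC trmx_mul trmxK !mulmxA. Qed.

Let qform_term y :
  qform (P *m invmx C *m P^T) (y *m A) (y *m A) = qform C (corr y) (corr y).
Proof.
rewrite /qform corrC; have [Cs _] := Cp; have [As _] := Ap.
by rewrite /corr !trmx_mul As trmx_inv Cs !mulmxA.
Qed.

(** The left side q equals both [qform C (corr y) (corr y)] and [qform A y (corr y *m P^T)].
    Cauchy-Schwarz for [A] and the hypothesis give q^2 <= (A y, y) M q, and q is cancelled. *)
Lemma subspace_stability M y : 0 <= M ->
  (forall z, qform A (z *m P^T) (z *m P^T) <= M * qform C z z) ->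
  qform (P *m invmx C *m P^T) (y *m A) (y *m A) <= M * qform A y y.
Proof.
move=> M0 h; rewrite qform_term.
have := psd_cauchy_schwarz y (corr y *m P^T) Ap.
rewrite qform_corr => /le_trans/(_ (ler_wpM2l (Ap.2 y) (h (corr y)))) {}h.
have [c0|c0] := eqVneq (qform C (corr y) (corr y)) 0.
  by rewrite c0 mulr_ge0// Ap.2.
have cp : 0 < qform C (corr y) (corr y) by rewrite lt_def c0 Cp.2.
by rewrite -(ler_pM2r cp) -expr2 (le_trans h)// mulrCA mulrA.
Qed.

(** Young's inequality in the inner product of [C], applied to [corr y] and [s]. The free weight
    [th] can be shared by all auxiliary spaces, so that the resulting estimates add up. *)
Lemma subspace_young y s th : 0 < th ->
  2 * qform A y (s *m P^T) <=
  th * qform (P *m invmx C *m P^T) (y *m A) (y *m A) + th^-1 * qform C s s.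
Proof. by move=> th0; rewrite qform_corr qform_term; exact: psd_young. Qed.

End Subspace.
End QuadraticForms.

(** * Spectral bounds and the condition number *)

Section ConditionNumber.
Context {R : realType}.

(* Left eigenvectors [v] of [B *m A] are turned into [y = v *m B], which
   satisfies [y *m A *m B = a *: y]. *)
Lemma eigenvalue_bounds n (A B : 'M[R]_n) c C a : psd A ->
  (forall y, c * qform A y y <= qform B (y *m A) (y *m A) <= C * qform A y y) ->
  eigenvalue (B *m A) a -> a != 0 -> c <= a <= C.
Proof.
move=> Ap h /eigenvalueP[v vBA v0] a0; rewrite mulmxA in vBA.
pose y := v *m B; have yA : y *m A = a *: v by rewrite /y.
have q0 : 0 < qform A y y.
  rewrite lt_def Ap.2 andbT; apply/eqP => /(psd_ker Ap)/eqP.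
  by rewrite yA scaler_eq0 (negbTE a0) (negbTE v0).
have qB : qform B (y *m A) (y *m A) = a * qform A y y.
  have yAB : y *m A *m B = a *: y by rewrite yA -scalemxAl.
  by rewrite /qform yAB trmx_mul Ap.1 -scalemxAl mulmxA mxE.
by have := h y; rewrite qB !ler_pM2r.
Qed.

Lemma kappa_le n (M : 'M[R]_n) c C : 0 < c -> 0 <= C ->
  (forall a, eigenvalue M a -> a != 0 -> c <= a <= C) -> kappa M <= C / c.
Proof.
move=> c0 C0 h; rewrite /kappa.
have Cc : 0 <= C / c by rewrite divr_ge0// ltW.
(* Without nonzero eigenvalues [lambda_min] is the infimum of the empty set, which is 0, and
   division by 0 makes [kappa] equal to 0. *)
have [E0|/set0P E0] := eqVneq [set a | eigenvalue M a /\ a != 0] set0.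
  by rewrite /lambda_min E0 inf0 invr0 mulr0.
have lmin : c <= lambda_min M.
  by apply: lb_le_inf => // a [/h ha /ha/andP[]].
have lmax : lambda_max M <= C.
  apply: ge_sup; first by have [a [? _]] := E0; exists a.
  (* The set of [lambda_max] may contain 0, which is bounded by [0 <= C]. *)
  by move=> a /h; have [->|_ /(_ isT)/andP[]] := eqVneq a 0.
apply: (@le_trans _ _ (C / lambda_min M)).
  by rewrite ler_wpM2r// invr_ge0 (le_trans (ltW c0)).
by rewrite ler_wpM2l// lef_pV2// posrE (lt_le_trans c0).
Qed.

End ConditionNumber.

(** * Vectors and barycentric coordinates *)

Section Vectors.
Context {R : realType}.
Implicit Types u v w x : 'rV[R]_3.

Lemma sum3 (V : nmodType) (F : 'I_3 -> V) : \sum_k F k = F 0 + F 1 + F 2.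
Proof.
rewrite !big_ord_recl big_ord0 addr0 addrA.
by congr (F _ + F _ + F _); apply: val_inj.
Qed.

Lemma dotE u v : dot u v = u 0 0 * v 0 0 + u 0 1 * v 0 1 + u 0 2 * v 0 2.
Proof. exact: sum3. Qed.

Lemma crossE u v :
  ((cross u v 0 0 = u 0 1 * v 0 2 - u 0 2 * v 0 1) *
   (cross u v 0 1 = u 0 2 * v 0 0 - u 0 0 * v 0 2) *
   (cross u v 0 2 = u 0 0 * v 0 1 - u 0 1 * v 0 0))%type.
Proof.
by do !split; rewrite mxE; congr (_ * _ - _ * _); congr (fun_of_matrix _ _ _);
  apply: val_inj.
Qed.

Lemma row3P u v :
  u 0 0 = v 0 0 -> u 0 1 = v 0 1 -> u 0 2 = v 0 2 -> u = v.
Proof.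
move=> h0 h1 h2; apply/rowP => -[[|[|[|//]]] ltk].
- by rewrite (_ : Ordinal ltk = 0)//; exact: val_inj.
- by rewrite (_ : Ordinal ltk = 1)//; exact: val_inj.
- by rewrite (_ : Ordinal ltk = 2)//; exact: val_inj.
Qed.

Lemma dotC u v : dot u v = dot v u.
Proof. by rewrite !dotE; ring. Qed.

Lemma dotDl u v w : dot (u + v) w = dot u w + dot v w.
Proof. by rewrite !dotE !mxE; ring. Qed.

Lemma dotDr u v w : dot u (v + w) = dot u v + dot u w.
Proof. by rewrite !(dotC u) dotDl. Qed.

Lemma dotZl (a : R) u v : dot (a *: u) v = a * dot u v.
Proof. by rewrite !dotE !mxE; ring. Qed.

Lemma dotZr (a : R) u v : dot u (a *: v) = a * dot u v.
Proof. by rewrite !(dotC u) dotZl. Qed.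

Lemma dot0l u : dot 0 u = 0.
Proof. by rewrite !dotE !mxE; ring. Qed.

Lemma dot0r u : dot u 0 = 0.
Proof. by rewrite dotC dot0l. Qed.

Lemma dotNl u v : dot (- u) v = - dot u v.
Proof. by rewrite -scaleN1r dotZl mulN1r. Qed.

Lemma dotNr u v : dot u (- v) = - dot u v.
Proof. by rewrite dotC dotNl dotC. Qed.

Lemma dotBl u v w : dot (u - v) w = dot u w - dot v w.
Proof. by rewrite dotDl dotNl. Qed.

Lemma dotBr u v w : dot u (v - w) = dot u v - dot u w.
Proof. by rewrite dotDr dotNr. Qed.

Lemma dot_suml (I : Type) (r : seq I) (P : pred I) (F : I -> 'rV[R]_3) u :
  dot (\sum_(i <- r | P i) F i) u = \sum_(i <- r | P i) dot (F i) u.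
Proof. exact: (big_morph (fun v => dot v u) (fun v w => dotDl v w u) (dot0l u)). Qed.

Lemma dot_sumr (I : Type) (r : seq I) (P : pred I) (F : I -> 'rV[R]_3) u :
  dot u (\sum_(i <- r | P i) F i) = \sum_(i <- r | P i) dot u (F i).
Proof. by rewrite dotC dot_suml; apply: eq_bigr => i _; rewrite dotC. Qed.

Lemma dot_delta u k : dot u (delta_mx 0 k) = u 0 k.
Proof.
rewrite /dot (bigD1 k)//= mxE !eqxx mulr1 big1 ?addr0// => j /negPf jk.
by rewrite mxE jk andbF mulr0.
Qed.

Lemma dot_ge0 u : 0 <= dot u u.
Proof. by apply: sumr_ge0 => k _; rewrite -expr2 sqr_ge0. Qed.

Lemma dot_gt0 u : u != 0 -> 0 < dot u u.
Proof.
move=> u0; rewrite lt_def dot_ge0 andbT; apply: contra u0.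
rewrite psumr_eq0 => [/allP h|k _]; last by rewrite -expr2 sqr_ge0.
apply/eqP/rowP => k; have := h k; rewrite mem_index_enum => /(_ isT).
by rewrite /= -expr2 sqrf_eq0 mxE => /eqP.
Qed.

Lemma dot_cauchy_schwarz u v : dot u v ^+ 2 <= dot u u * dot v v.
Proof.
rewrite -subr_ge0.
have -> : dot u u * dot v v - dot u v ^+ 2 = dot (cross u v) (cross u v).
  by rewrite !dotE !crossE; ring.
exact: dot_ge0.
Qed.

Lemma dot_ext u v : (forall w, dot u w = dot v w) -> u = v.
Proof. by move=> h; apply/rowP => k; rewrite -!dot_delta. Qed.

Lemma crossC u v : cross u v = - cross v u.
Proof. by apply: row3P; rewrite !(crossE, mxE); ring. Qed.

Lemma dot_cross_cross u v x w :
  dot (cross u v) (cross x w) = dot u x * dot v w - dot u w * dot v x.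
Proof. by rewrite !dotE !crossE; ring. Qed.

Lemma dot_cross_rot u v w : dot (cross u v) w = dot u (cross v w).
Proof. by rewrite !dotE !crossE; ring. Qed.

Lemma cross_cross u v x : cross (cross u v) x = dot u x *: v - dot v x *: u.
Proof. by apply: row3P; rewrite !(crossE, mxE) !dotE ?crossE; ring. Qed.

(** Cramer's rule without division: [x] is expanded in the basis reciprocal to [u], [v], [w]. *)
Lemma dot_cross_id u v w x :
  dot (cross u v) w *: x =
  dot x w *: cross u v + dot x u *: cross v w + dot x v *: cross w u.
Proof. by apply: row3P; rewrite !(crossE, mxE) !dotE ?crossE; ring. Qed.

Lemma crossDr u v w : cross u (v + w) = cross u v + cross u w.
Proof. by apply: row3P; rewrite !(crossE, mxE); ring. Qed.

Lemma crossZr (a : R) u v : cross u (a *: v) = a *: cross u v.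
Proof. by apply: row3P; rewrite !(crossE, mxE); ring. Qed.

Lemma dot_crossl u v : dot (cross u v) v = 0.
Proof. by rewrite dotE !crossE; ring. Qed.

End Vectors.

Section Barycentric.
Context {R : realType} {n : nat}.
Variables (P : 'I_n -> 'rV[R]_3) (s : {set 'I_n}).

(* The barycentric coordinate of [x] at [P i] is
   [ab.1 i + dot (ab.2 i) x], so that [ab.2 i] is its gradient. *)
Definition is_bary (ab : ('I_n -> R) * ('I_n -> 'rV[R]_3)) : Prop :=
  [/\ {in s &, forall i j, ab.1 i + dot (ab.2 i) (P j) = (i == j)%:R},
      \sum_(i in s) ab.1 i = 1, \sum_(i in s) ab.2 i = 0,
      \sum_(i in s) ab.1 i *: P i = 0
    & forall u, \sum_(i in s) dot (ab.2 i) u *: P i = u].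

Definition bary : ('I_n -> R) * ('I_n -> 'rV[R]_3) :=
  xget (fun=> 0, fun=> 0) is_bary.

Definition bgr : 'I_n -> 'rV[R]_3 := bary.2.
Definition bcoord i x : R := bary.1 i + dot (bgr i) x.

Hypotheses (s4 : #|s| = 4%N) (sind : affinely_independent P s).

(** The matrix [M] with rows (1, P i) has free rows by affine independence and is square because
    [#|s| = 4]. The first row of its inverse [B] holds the constant terms, the other three the
    gradients. [M *m B = 1] gives the Kronecker property, [B *m M = 1] the four summation
    identities. Since [#|s|] equals 4 only propositionally, left and right inverses are obtained
    separately and then identified. *)
Lemma is_bary_exists : exists ab, is_bary ab.
Proof.
have [x0 x0s] : exists x, x \in s by apply/card_gt0P; rewrite s4.
pose rk := enum_rank_in x0s.
pose Q : 'M[R]_(#|s|, 3) := \matrix_(i, k) P (enum_val i) 0 k.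
pose M : 'M[R]_(#|s|, 1 + 3) := row_mx (const_mx 1) Q.
have Mfree : row_free M.
  apply: inj_row_free => v; rewrite mul_mx_row -[0](@row_mx0 _ 1 1 3).
  move=> /eq_row_mx[v1 vQ].
  pose c i := v 0 (rk i).
  have cE k : c (enum_val k) = v 0 k by rewrite /c /rk enum_valK_in.
  apply/rowP => k; rewrite mxE -cE; apply: (sind (c := c)) (enum_valP k).
    rewrite big_enum_val; move/matrixP : v1 => /(_ 0 0); rewrite !mxE => h.
    by rewrite -[RHS]h; apply: eq_bigr => i _; rewrite mxE mulr1 cE.
  rewrite big_enum_val -[RHS]vQ; apply/rowP => l.
  by rewrite summxE !mxE; apply: eq_bigr => i _; rewrite !mxE cE.
have Mfull : row_full M by rewrite /row_full (eqP Mfree) s4.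
have /row_freeP[B MB] := Mfree; have /row_fullP[B' BM] := Mfull.
have {BM} BM : B *m M = 1%:M.
  by rewrite -[B in B *m M]mul1mx -BM -(mulmxA B') MB mulmx1.
have {}BM l l' : \sum_k B l k * M k l' = (l == l')%:R.
  by move/matrixP : BM => /(_ l l'); rewrite !mxE.
have {}MB k k' : \sum_l M k l * B l k' = (k == k')%:R.
  by move/matrixP : MB => /(_ k k'); rewrite !mxE.
have Ml k : M k (lshift 3 0) = 1 by rewrite row_mxEl mxE.
have Mr k l : M k (rshift 1 l) = P (enum_val k) 0 l by rewrite row_mxEr mxE.
pose al i := B (lshift 3 0) (rk i).
pose be i : 'rV_3 := \row_k B (rshift 1 k) (rk i).
have alE k : al (enum_val k) = B (lshift 3 0) k by rewrite /al /rk enum_valK_in.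
have beE k l : be (enum_val k) 0 l = B (rshift 1 l) k.
  by rewrite /be mxE /rk enum_valK_in.
have eqlr (l : 'I_3) (l' : 'I_1) : (rshift 1 l == lshift 3 l') = false.
  exact: eq_rlshift.
exists (al, be); split => /=.
- move=> i j si sj.
  rewrite -(enum_rankK_in x0s si) -(enum_rankK_in x0s sj) -/rk alE.
  rewrite (inj_eq enum_val_inj) eq_sym -MB big_split_ord big_ord1 /= Ml mul1r.
  by congr (_ + _); apply: eq_bigr => k _; rewrite beE Mr mulrC.
- rewrite big_enum_val -[RHS]/((lshift 3 (0 : 'I_1) == lshift 3 0)%:R) -BM.
  by apply: eq_bigr => k _; rewrite alE Ml mulr1.
- rewrite big_enum_val; apply/rowP => l; rewrite summxE mxE.
  rewrite -[RHS]/(false%:R) -(eqlr l 0) -BM.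
  by apply: eq_bigr => k _; rewrite beE Ml mulr1.
- rewrite big_enum_val; apply/rowP => l; rewrite summxE mxE.
  rewrite -[RHS]/(false%:R) -(eqlr l 0) eq_sym -BM.
  by apply: eq_bigr => k _; rewrite mxE alE Mr.
- move=> u; rewrite big_enum_val; apply/rowP => l; rewrite summxE.
  transitivity (\sum_m u 0 m * (rshift 1 m == rshift 1 l)%:R).
    under [RHS]eq_bigr do rewrite -BM mulr_sumr.
    rewrite exchange_big; apply: eq_bigr => k _; rewrite mxE mulr_suml.
    by apply: eq_bigr => m _; rewrite beE Mr; ring.
  rewrite (bigD1 l)//= eqxx mulr1 big1 ?addr0// => m ml.
  by rewrite (inj_eq (@rshift_inj _ _)) (negPf ml) mulr0.
Qed.

Lemma baryP : is_bary bary.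
Proof. by have [ab ?] := is_bary_exists; exact: (xgetPex _ (ex_intro _ ab _)). Qed.

Lemma lam_vertex i j : i \in s -> j \in s -> bcoord i (P j) = (i == j)%:R.
Proof. by have [h _ _ _ _] := baryP; exact: h. Qed.

Lemma sum_bgr : \sum_(i in s) bgr i = 0.
Proof. by have [_ _ h _ _] := baryP. Qed.

Lemma sum_dot_bgr u : \sum_(i in s) dot (bgr i) u *: P i = u.
Proof. by have [_ _ _ _ h] := baryP. Qed.

Lemma sum_bary_pt : \sum_(i in s) bary.1 i *: P i = 0.
Proof. by have [_ _ _ h _] := baryP. Qed.

Lemma sum_bary1 : \sum_(i in s) bary.1 i = 1.
Proof. by have [_ h _ _ _] := baryP. Qed.

Lemma sum_dot_bgr_dual u : \sum_(i in s) dot u (P i) *: bgr i = u.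
Proof.
apply: dot_ext => w; rewrite -[in RHS](sum_dot_bgr w) dot_suml dot_sumr.
by apply: eq_bigr => i _; rewrite dotZl dotZr mulrC.
Qed.

Lemma sum_lam x : \sum_(i in s) bcoord i x = 1.
Proof. by rewrite big_split /= sum_bary1 -dot_suml sum_bgr dot0l addr0. Qed.

Lemma sum_lam_pt x : \sum_(i in s) bcoord i x *: P i = x.
Proof.
under eq_bigr do rewrite scalerDl.
by rewrite big_split /= sum_bary_pt add0r sum_dot_bgr.
Qed.

Lemma dot_bgrB i x y : dot (bgr i) (x - y) = bcoord i x - bcoord i y.
Proof. by rewrite dotBr /bcoord; ring. Qed.

Lemma lam_comb (r : {set 'I_n}) (c : 'I_n -> R) i :
  r \subset s -> i \in s -> \sum_(j in r) c j = 1 ->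
  bcoord i (\sum_(j in r) c j *: P j) = if i \in r then c i else 0.
Proof.
move=> rs si c1; rewrite /bcoord dot_sumr -[bary.1 i]mulr1 -c1 mulr_sumr -big_split /=.
transitivity (\sum_(j in r) (i == j)%:R * c j).
  apply: eq_bigr => j rj; rewrite -(lam_vertex si (fintype.subsetP rs _ rj)) /bcoord dotZr; ring.
case: ifPn => ir.
  rewrite (bigD1 i)//= eqxx mul1r big1 ?addr0// => j /andP[_ ji].
  by rewrite eq_sym (negPf ji) mul0r.
apply: big1 => j jr; case: eqP => [ij|_]; last by rewrite mul0r.
by rewrite -ij (negPf ir) in jr.
Qed.

Lemma hull_lam (r : {set 'I_n}) i x : r \subset s -> i \in s -> hull P r x ->
  (0 <= bcoord i x) /\ (i \notin r -> bcoord i x = 0).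
Proof.
move=> rs si [c [c0 c1 ->]]; rewrite lam_comb//.
by case: ifPn => ir; split => //; exact: c0.
Qed.

Lemma hullP x : hull P s x <-> forall i, i \in s -> 0 <= bcoord i x.
Proof.
split=> [h i si|h]; first by have [] := hull_lam (subxx s) si h.
by exists (bcoord^~ x); split => //; rewrite ?sum_lam ?sum_lam_pt.
Qed.

Lemma hull_vertex (r : {set 'I_n}) i : i \in r -> hull P r (P i).
Proof.
move=> ir; exists (fun j => (j == i)%:R); split => [j _||]; first exact: ler0n.
- by rewrite (bigD1 i)//= eqxx big1 ?addr0// => j /andP[_ /negPf ->].
- rewrite (bigD1 i)//= eqxx scale1r big1 ?addr0// => j /andP[_ /negPf ->].
  by rewrite scale0r.
Qed.

Lemma vertex_hull (r : {set 'I_n}) i : r \subset s -> i \in s -> hull P r (P i) -> i \in r.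
Proof.
move=> rs si h; apply: contraT => ir; have [_ /(_ ir)] := hull_lam rs si h.
by rewrite lam_vertex// eqxx => /eqP; rewrite oner_eq0.
Qed.

Lemma hull_segment (r : {set 'I_n}) x y (a : R) : 0 <= a <= 1 -> hull P r x -> hull P r y ->
  hull P r (x + a *: (y - x)).
Proof.
move=> /andP[a0 a1] [c [c0 c1 ->]] [d [d0 d1 ->]].
exists (fun i => c i + a * (d i - c i)); split.
- by move=> i ir; have := c0 _ ir; have := d0 _ ir; nra.
- by rewrite big_split /= -mulr_sumr sumrB c1 d1 subrr mulr0 addr0.
- rewrite -sumrB scaler_sumr -big_split; apply: eq_bigr => i _ /=.
  by rewrite -scalerBl scalerA -scalerDl.
Qed.

Lemma hull_subset (r r' : {set 'I_n}) : r \subset r' -> hull P r `<=` hull P r'.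
Proof.
move=> rr' x [c [c0 c1 ->]]; exists (fun i => if i \in r then c i else 0); split.
- by move=> i _; case: ifPn => // /c0.
- rewrite -big_mkcondr /= -c1; apply: eq_bigl => i.
  by rewrite andb_idl//; exact: (fintype.subsetP rr').
- under [RHS]eq_bigr do rewrite (fun_if (fun z => z *: _)) scale0r.
  rewrite -big_mkcondr /=; apply: eq_bigl => i.
  by rewrite andb_idl//; exact: (fintype.subsetP rr').
Qed.

(** The edges [e1] and [e2] of the face are orthogonal to [bgr p], whose product with [e3] is -1, so
    Cramer's rule for [bgr p] in terms of [e1], [e2], [e3] keeps a single term. The normal is
    nonzero because its product with the cross product of [bgr i1] and [bgr i2] is 1. *)
Lemma cross_bgr p i0 i1 i2 :
  p \in s -> i0 \in s -> i1 \in s -> i2 \in s ->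
  uniq [:: p; i0; i1; i2] ->
  exists2 nu, nu != 0 & cross (P i1 - P i0) (P i2 - P i0) = nu *: bgr p.
Proof.
move=> sp s0 s1 s2 /=; rewrite !inE !negb_or => /andP[/and3P[p0 p1 p2]].
move=> /andP[/andP[n01 n02]] /andP[n12 _].
have db i j k : i \in s -> j \in s -> k \in s ->
    dot (bgr i) (P j - P k) = (i == j)%:R - (i == k)%:R.
  by move=> si sj sk; rewrite dot_bgrB !lam_vertex.
set e1 := P i1 - P i0; set e2 := P i2 - P i0; pose e3 := P i0 - P p.
have N0 : cross e1 e2 != 0.
  apply/eqP => N0; have := dot_cross_cross (bgr i1) (bgr i2) e1 e2.
  rewrite N0 dot0r !db// !eqxx !(eq_sym _ i0) (negPf n01) (negPf n02) (negPf n12).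
  rewrite !subr0 mul0r subr0 mulr1.
  by move/eqP; rewrite eq_sym oner_eq0.
have := dot_cross_id e1 e2 e3 (bgr p).
rewrite !db// (negPf p0) (negPf p1) (negPf p2) eqxx subrr !scale0r !addr0 sub0r.
rewrite scaleN1r => h; exists (- dot (cross e1 e2) e3); last first.
  by rewrite scaleNr h opprK.
by apply: contra N0; rewrite oppr_eq0 => /eqP d0; rewrite -oppr_eq0 -h d0 scale0r.
Qed.

End Barycentric.

(** * Integrals *)

Section BoundedMeasurable.
Context d (T : measurableType d) {R : realType}.
Variable mu : {measure set T -> \bar R}.
Implicit Types (D : set T) (f g : T -> R).

(** Unlike integrability, this is stable under products, and it implies integrability on sets of
    finite measure. *)
Definition bmeas D f : Prop :=
  measurable_fun D f /\ exists M, forall x, D x -> `|f x| <= M.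

Lemma bmeas_cst D (c : R) : bmeas D (cst c).
Proof. by split; [exact: measurable_cst|exists `|c|]. Qed.

Lemma bmeasD D f g : bmeas D f -> bmeas D g -> bmeas D (fun x => f x + g x).
Proof.
move=> [mf [M hf]] [mg [N hg]]; split; first exact: measurable_funD.
by exists (M + N) => x Dx; rewrite (le_trans (ler_normD _ _))// lerD ?hf ?hg.
Qed.

Lemma bmeasM D f g : bmeas D f -> bmeas D g -> bmeas D (fun x => f x * g x).
Proof.
move=> [mf [M hf]] [mg [N hg]]; split; first exact: measurable_funM.
by exists (M * N) => x Dx; rewrite normrM ler_pM ?hf ?hg.
Qed.

Lemma bmeasZ D (c : R) f : bmeas D f -> bmeas D (fun x => c * f x).
Proof. by move=> /(bmeasM (bmeas_cst D c)). Qed.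

Lemma bmeas_sum D (I : Type) (r : seq I) (P : pred I) (F : I -> T -> R) :
  (forall i, P i -> bmeas D (F i)) -> bmeas D (fun x => \sum_(i <- r | P i) F i x).
Proof.
move=> h; elim: r => [|i r IH].
  have -> : (fun x => \sum_(i <- [::] | P i) F i x) = cst 0.
    by apply/funext => x; rewrite big_nil.
  exact: (bmeas_cst D 0).
have -> : (fun x => \sum_(j <- i :: r | P j) F j x) =
    (fun x => if P i then F i x + \sum_(j <- r | P j) F j x
              else \sum_(j <- r | P j) F j x).
  by apply/funext => x; rewrite big_cons.
by case: (boolP (P i)) => // Pi; apply: bmeasD => //; exact: h.
Qed.

Variables (D : set T) (mD : measurable D) (Dfin : (mu D < +oo)%E).

Lemma bmeas_integrable f : bmeas D f -> mu.-integrable D (EFin \o f).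
Proof.
move=> [mf [M hM]]; apply: measurable_bounded_integrable => //.
by exists M; split; [exact: num_real|move=> y My x Dx; exact: le_trans (hM _ Dx) (ltW My)].
Qed.

Lemma bmeas_RintegralD f g : bmeas D f -> bmeas D g ->
  (\int[mu]_(x in D) (f x + g x) =
   \int[mu]_(x in D) f x + \int[mu]_(x in D) g x)%R.
Proof. by move=> hf hg; apply: RintegralD => //; exact: bmeas_integrable. Qed.

Lemma bmeas_RintegralZ (c : R) f : bmeas D f ->
  (\int[mu]_(x in D) (c * f x) = c * \int[mu]_(x in D) f x)%R.
Proof. by move=> hf; apply: RintegralZl => //; exact: bmeas_integrable. Qed.

Lemma bmeas_Rintegral_sum (I : Type) (r : seq I) (P : pred I) (F : I -> T -> R) :
  (forall i, P i -> bmeas D (F i)) ->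
  (\int[mu]_(x in D) (\sum_(i <- r | P i) F i x) =
   \sum_(i <- r | P i) \int[mu]_(x in D) F i x)%R.
Proof.
move=> h; elim: r => [|i r IH].
  under eq_Rintegral => x _ do rewrite big_nil.
  by rewrite Rintegral_cst// mul0r big_nil.
under eq_Rintegral => x _ do rewrite big_cons.
rewrite big_cons; case: ifPn => // Pi.
by rewrite bmeas_RintegralD ?IH//; [exact: h|exact: bmeas_sum].
Qed.

Lemma bmeas_le_Rintegral f g : bmeas D f -> bmeas D g ->
  (forall x, D x -> f x <= g x) ->
  (\int[mu]_(x in D) f x <= \int[mu]_(x in D) g x)%R.
Proof.
move=> hf hg fg; apply: le_Rintegral => //; try exact: bmeas_integrable.
Qed.

End BoundedMeasurable.

Lemma measurable_ge0 d (T : measurableType d) (R : realType) (f : T -> R) :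
  measurable_fun setT f -> measurable [set x | 0 <= f x].
Proof.
move=> mf; rewrite (_ : [set _ | _] = setT `&` f @^-1` `[0, +oo[%classic).
  exact: mf.
by rewrite setTI; apply/seteqP; split => x /=; rewrite in_itv/= andbT.
Qed.

(** * The reference triangle and face fluxes *)

Section Triangle.
Context {R : realType}.
Local Notation leb2 := (@leb2 R).

Lemma lebesgue_measure_cc (a b : R) : a <= b ->
  @lebesgue_measure R `[a, b]%classic = (b - a)%:E.
Proof.
rewrite le_eqVlt lebesgue_measure_itv/= lte_fin => /predU1P[->|->//].
by rewrite ltxx subrr.
Qed.

Lemma leb2_box (a b a' b' : R) : a <= b -> a' <= b' ->
  leb2 (`[a, b]%classic `*` `[a', b']%classic) = ((b - a) * (b' - a'))%:E.
Proof.
move=> ab ab'; rewrite /leb2 product_measure1E// EFinM.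
by congr (_ * _)%E; exact: lebesgue_measure_cc.
Qed.

Lemma measurable_ref_triangle : measurable (@ref_triangle R).
Proof.
rewrite (_ : @ref_triangle R = [set p | 0 <= p.1] `&` [set p | 0 <= p.2] `&`
  [set p | 0 <= 1 - (p.1 + p.2)]).
  apply: measurableI; first apply: measurableI; apply: measurable_ge0.
  - exact: measurable_fst.
  - exact: measurable_snd.
  - by apply: measurable_funB => //; apply: measurable_funD.
apply/seteqP; split => p /=; first by move=> [? ? ?]; rewrite subr_ge0.
by move=> [[? ?]]; rewrite subr_ge0; split.
Qed.

Lemma ref_triangle_fin : (leb2 (@ref_triangle R) < +oo)%E.
Proof.
apply: (@le_lt_trans _ _ (leb2 (`[0%R, 1%R]%classic `*` `[0%R, 1%R]%classic))).
  apply: le_measure; rewrite ?inE.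
  - exact: measurable_ref_triangle.
  - exact: measurableX.
  - move=> p [p1 p2 p12]; split; rewrite /= in_itv/=.
      by rewrite p1 (le_trans _ p12)// lerDl.
    by rewrite p2 (le_trans _ p12)// lerDr.
by rewrite leb2_box// ltry.
Qed.

Lemma ref_triangle_gt0 : (0 < leb2 (@ref_triangle R))%E.
Proof.
apply: (@lt_le_trans _ _ (leb2 (`[0%R, 2^-1]%classic `*` `[0%R, 2^-1]%classic))).
  by rewrite leb2_box ?invr_ge0// subr0 lte_fin mulr_gt0.
apply: le_measure; rewrite ?inE.
- exact: measurableX.
- exact: measurable_ref_triangle.
- move=> p [] /=; rewrite !in_itv/= => /andP[p1 p1'] /andP[p2 p2'].
  by split => //; lra.
Qed.

(* The flux only sees the values at the corners, with weights that need not
   be known (each is 1/6). *)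
Lemma triangle_flux_weights : exists w : nat -> R,
  [/\ forall k, 0 <= w k, 0 < w 0 + w 1 + w 2
    & forall (v : 'rV[R]_3 -> 'rV[R]_3) (q0 q1 q2 : 'rV[R]_3),
      (forall a b, v (q0 + a *: (q1 - q0) + b *: (q2 - q0)) =
        v q0 + a *: (v q1 - v q0) + b *: (v q2 - v q0)) ->
      triangle_flux v q0 q1 q2 =
        w 0 * dot (v q0) (cross (q1 - q0) (q2 - q0)) +
        w 1 * dot (v q1) (cross (q1 - q0) (q2 - q0)) +
        w 2 * dot (v q2) (cross (q1 - q0) (q2 - q0))].
Proof.
have mT := measurable_ref_triangle; have fT := ref_triangle_fin.
have b1 : bmeas (@ref_triangle R) fst.
  split; first exact: measurable_funTS.
  by exists 1 => -[p1 p2] [/= ? ? ?]; rewrite ger0_norm//; lra.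
have b2 : bmeas (@ref_triangle R) snd.
  split; first exact: measurable_funTS.
  by exists 1 => -[p1 p2] [/= ? ? ?]; rewrite ger0_norm//; lra.
have bc (c : R) : bmeas (@ref_triangle R) (fun=> c) by exact: bmeas_cst.
pose A0 := (\int[leb2]_(p in @ref_triangle R) 1)%R.
pose A1 := (\int[leb2]_(p in @ref_triangle R) p.1)%R.
pose A2 := (\int[leb2]_(p in @ref_triangle R) p.2)%R.
have lin c0 c1 c2 : (\int[leb2]_(p in @ref_triangle R)
    (c0 * 1 + c1 * p.1 + c2 * p.2))%R = c0 * A0 + c1 * A1 + c2 * A2.
  have z0 := bmeasZ c0 (bc 1); have z1 := bmeasZ c1 b1; have z2 := bmeasZ c2 b2.
  rewrite (bmeas_RintegralD (mu := leb2) mT fT (bmeasD z0 z1) z2).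
  rewrite (bmeas_RintegralD (mu := leb2) mT fT z0 z1).
  rewrite (bmeas_RintegralZ (mu := leb2) mT fT c0 (bc 1)).
  rewrite (bmeas_RintegralZ (mu := leb2) mT fT c1 b1).
  by rewrite (bmeas_RintegralZ (mu := leb2) mT fT c2 b2).
(* The integrals of the three barycentric coordinates of the reference triangle. *)
exists (nth 0 [:: A0 - A1 - A2; A1; A2]); split => /=.
- case=> [|[|[|k]]] /=.
  + have -> : A0 - A1 - A2 = 1 * A0 + (-1) * A1 + (-1) * A2 by ring.
    rewrite -lin.
    by apply: Rintegral_ge0 => p [? ? ?]; lra.
  + by apply: Rintegral_ge0 => p [? ? ?].
  + by apply: Rintegral_ge0 => p [? ? ?].
  + by rewrite nth_nil.
- have -> : A0 - A1 - A2 + A1 + A2 = A0 by ring.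
  by rewrite /A0 Rintegral_cst// mul1r fine_gt0// ref_triangle_gt0.
- move=> v q0 q1 q2 hv; rewrite /triangle_flux.
  set N := cross _ _.
  under eq_Rintegral => p _.
    rewrite hv !(dotDl, dotZl, dotNl) -[dot (v q0) N in X in X + _ + _]mulr1.
    rewrite [X in _ + X + _]mulrC [X in _ + _ + X]mulrC; over.
  rewrite lin; ring.
Qed.

End Triangle.

(** * Affine functions, and cubes in three dimensions *)

Section Affine.
Context {R : realType}.
Implicit Types (p : 'rV[R]_3 -> R) (v : 'rV[R]_3 -> 'rV[R]_3).

Definition affs p : Prop := exists a b, forall x, p x = a + dot b x.
Definition affv v : Prop := forall k, affs (fun x => v x 0 k).

Lemma affs_cst (c : R) : affs (fun=> c).
Proof. by exists c, 0 => x; rewrite dot0l addr0. Qed.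

Lemma affs_coord k : affs (fun x => x 0 k).
Proof. by exists 0, (delta_mx 0 k) => x; rewrite add0r dotC dot_delta. Qed.

Lemma affsD p (q : 'rV[R]_3 -> R) : affs p -> affs q -> affs (fun x => p x + q x).
Proof.
move=> [a [b h]] [c [d k]]; exists (a + c), (b + d) => x.
by rewrite h k dotDl; ring.
Qed.

Lemma affsZ (c : R) p : affs p -> affs (fun x => c * p x).
Proof.
by move=> [a [b h]]; exists (c * a), (c *: b) => x; rewrite h dotZl mulrDr.
Qed.

Lemma affs_ext p (q : 'rV[R]_3 -> R) : (forall x, p x = q x) -> affs p -> affs q.
Proof. by move=> pq [a [b h]]; exists a, b => x; rewrite -pq. Qed.

Lemma affs_sum (I : Type) (r : seq I) (P : pred I) (F : I -> 'rV[R]_3 -> R) :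
  (forall i, P i -> affs (F i)) -> affs (fun x => \sum_(i <- r | P i) F i x).
Proof.
move=> h; elim: r => [|i r IH].
  by apply: affs_ext (affs_cst 0) => x; rewrite big_nil.
case: (boolP (P i)) => Pi.
  by apply: affs_ext (affsD (h _ Pi) IH) => x; rewrite big_cons Pi.
by apply: affs_ext IH => x; rewrite big_cons (negPf Pi).
Qed.

Lemma affv_ext v u : (forall x, v x = u x) -> affv v -> affv u.
Proof. by move=> vu h k; apply: affs_ext (h k) => x; rewrite vu. Qed.

Lemma affv_sum (I : Type) (r : seq I) (P : pred I)
    (F : I -> 'rV[R]_3 -> 'rV[R]_3) :
  (forall i, P i -> affv (F i)) -> affv (fun x => \sum_(i <- r | P i) F i x).
Proof.
move=> h k; apply: (@affs_ext (fun x => \sum_(i <- r | P i) F i x 0 k)).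
  by move=> x; rewrite summxE.
by apply: affs_sum => i /h; exact.
Qed.

Lemma affvZ (c : R) v : affv v -> affv (fun x => c *: v x).
Proof.
by move=> h k; apply: affs_ext (affsZ c (h k)) => x; rewrite mxE.
Qed.

Lemma affvD v u : affv v -> affv u -> affv (fun x => v x + u x).
Proof.
by move=> h h' k; apply: affs_ext (affsD (h k) (h' k)) => x; rewrite mxE.
Qed.

Lemma affv_cst a : affv (fun=> a).
Proof. by move=> k; exact: affs_cst. Qed.

Lemma affv_id : affv id.
Proof. by move=> k; exact: affs_coord. Qed.

Lemma affs_segment p (x y : 'rV[R]_3) (a : R) : affs p ->
  p (x + a *: (y - x)) = p x + a * (p y - p x).
Proof.
by move=> [c [b h]]; rewrite !h dotDr dotZr dotBr; ring.
Qed.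

Lemma affv_triangle v (q0 q1 q2 : 'rV[R]_3) (a b : R) : affv v ->
  v (q0 + a *: (q1 - q0) + b *: (q2 - q0)) =
  v q0 + a *: (v q1 - v q0) + b *: (v q2 - v q0).
Proof.
move=> h; apply/rowP => k; have [c [d hk]] := h k.
by rewrite !mxE !hk !(dotDr, dotZr, dotNr); ring.
Qed.

Lemma affs_bary n (P : 'I_n -> 'rV[R]_3) (s : {set 'I_n}) p x :
  #|s| = 4%N -> affinely_independent P s -> affs p ->
  p x = \sum_(i in s) bcoord P s i x * p (P i).
Proof.
move=> s4 sind [a [b h]]; rewrite h -[in LHS](sum_lam_pt s4 sind x) dot_sumr.
rewrite -[a]mul1r -[in LHS](sum_lam s4 sind x) mulr_suml -big_split /=.
by apply: eq_bigr => i _; rewrite h dotZr mulrDr.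
Qed.

Lemma affv_bary n (P : 'I_n -> 'rV[R]_3) (s : {set 'I_n}) v x :
  #|s| = 4%N -> affinely_independent P s -> affv v ->
  v x = \sum_(i in s) bcoord P s i x *: v (P i).
Proof.
move=> s4 sind h; apply/rowP => k; rewrite summxE (affs_bary x s4 sind (h k)).
by apply: eq_bigr => i _; rewrite mxE.
Qed.

Lemma row3E (p : R * R * R) :
  ((row3 p 0 0 = p.1.1) * (row3 p 0 1 = p.1.2) * (row3 p 0 2 = p.2))%type.
Proof. by do !split; rewrite mxE. Qed.

Lemma measurable_affs p : affs p -> measurable_fun setT (fun q => p (row3 q)).
Proof.
move=> [a [b h]].
rewrite (_ : (fun q => _) =
  (fun q => a + (b 0 0 * q.1.1 + b 0 1 * q.1.2 + b 0 2 * q.2))); last first.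
  by apply/funext => q; rewrite h dotE !row3E.
have m11 : measurable_fun setT (fun q : R * R * R => q.1.1).
  exact: (measurableT_comp measurable_fst measurable_fst).
have m12 : measurable_fun setT (fun q : R * R * R => q.1.2).
  exact: (measurableT_comp measurable_snd measurable_fst).
have m2 : measurable_fun setT (fun q : R * R * R => q.2) by exact: measurable_snd.
apply: measurable_funD => //.
apply: measurable_funD; last exact: measurable_funM.
by apply: measurable_funD; exact: measurable_funM.
Qed.

Definition box3 (a : 'rV[R]_3) (e : R) : set (R * R * R) :=
  (`[a 0 0 - e, a 0 0 + e]%classic `*` `[a 0 1 - e, a 0 1 + e]%classic) `*`
  `[a 0 2 - e, a 0 2 + e]%classic.

Lemma box3P a e (q : R * R * R) : box3 a e q <-> forall k, `|row3 q 0 k - a 0 k| <= e.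
Proof.
rewrite /box3 /= !in_itv /= -!ler_distlC -!row3E !(distrC (a 0 _)).
split=> [[[h0 h1] h2] k|h]; last by rewrite !h.
move: k => [[|[|[|//]]] ltk].
- by rewrite (_ : Ordinal ltk = 0)//; exact: val_inj.
- by rewrite (_ : Ordinal ltk = 1)//; exact: val_inj.
- by rewrite (_ : Ordinal ltk = 2)//; exact: val_inj.
Qed.

Lemma measurable_box3 a e : measurable (box3 a e).
Proof. by apply: measurableX => //; exact: measurableX. Qed.

Lemma leb3_box3 a (e : R) : 0 <= e -> leb3 (box3 a e) = ((2 * e) ^+ 3)%:E.
Proof.
move=> e0; rewrite /leb3 product_measure1E//; last exact: measurableX.
rewrite (_ : (2 * e) ^+ 3 = (2 * e) * (2 * e) * (2 * e)); last by ring.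
rewrite EFinM; congr (_ * _)%E.
  by rewrite /= leb2_box; [congr (_%:E); ring|lra|lra].
by rewrite /= lebesgue_measure_cc; [congr (_%:E); ring|lra].
Qed.

End Affine.

(** * Volume and inverse estimate on a single tetrahedron *)

Section CellIntegral.
Context {R : realType} {n : nat}.
Variables (P : 'I_n -> 'rV[R]_3) (s : {set 'I_n}).
Hypotheses (s4 : #|s| = 4%N) (sind : affinely_independent P s).
Implicit Type p : 'rV[R]_3 -> R.
Local Notation cell := (hull P s).
Local Notation cell3 := (@row3 R @^-1` cell).

Lemma affs_lam i : affs (bcoord P s i).
Proof. by exists ((bary P s).1 i), (bgr P s i). Qed.

Lemma lam_le1 i x : i \in s -> cell x -> bcoord P s i x <= 1.
Proof.
move=> si xs; rewrite -(sum_lam s4 sind x) (bigD1 i)//= lerDl.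
by apply: sumr_ge0 => j /andP[sj _]; exact: (hullP s4 sind x).1.
Qed.

Lemma affs_norm_le p x M : affs p -> cell x ->
  (forall i, i \in s -> `|p (P i)| <= M) -> `|p x| <= M.
Proof.
move=> hp xs hM; rewrite (affs_bary x s4 sind hp).
rewrite (le_trans (ler_norm_sum _ _ _))// -[leRHS]mul1r.
rewrite -(sum_lam s4 sind x) mulr_suml ler_sum// => i si.
have l0 := (hullP s4 sind x).1 xs i si.
by rewrite normrM ger0_norm// ler_wpM2l// hM.
Qed.

Lemma affs_max_vertex p : exists2 i, i \in s &
  forall j, j \in s -> `|p (P j)| <= `|p (P i)|.
Proof.
have [i0 i0s] : exists i0, i0 \in s by apply/card_gt0P; rewrite s4.
case: (Order.TotalTheory.arg_maxP (fun i => `|p (P i)| : R) i0s) => i si h.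
by exists i.
Qed.

Lemma sqr_le_norm (a b : R) : `|a| <= `|b| -> a ^+ 2 <= b ^+ 2.
Proof.
by move=> ab; rewrite -(real_normK (num_real a)) -(real_normK (num_real b))
  ler_pXn2r// nnegrE.
Qed.

Lemma measurable_cell : measurable cell3.
Proof.
rewrite (_ : cell3 = \bigcap_(i in [set` s]) [set q | 0 <= bcoord P s i (row3 q)]).
  apply: fin_bigcap_measurable => [|i _]; first exact: finite_finset.
  apply: (@measurable_ge0 _ _ _ (fun q => bcoord P s i (row3 q))).
  exact: (measurable_affs (affs_lam i)).
apply/seteqP; split => q /=; rewrite (hullP s4 sind) => h i; first exact: h.
by move=> si; exact: h.
Qed.

Lemma bmeas_affs p : affs p -> bmeas cell3 (fun q => p (row3 q)).
Proof.
move=> hp; split; first exact: measurable_funTS (measurable_affs hp).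
have [i si imax] := affs_max_vertex p.
by exists `|p (P i)| => q qs; exact: affs_norm_le.
Qed.

Variables (c : 'rV[R]_3) (h r : R).
Hypotheses (h0 : 0 <= h) (r0 : 0 < r).
Hypothesis hdiam : forall x y, cell x -> cell y -> dot (x - y) (x - y) <= h ^+ 2.
Hypothesis hball : forall x, dot (x - c) (x - c) <= r ^+ 2 -> cell x.

Lemma coord_le_dot (u : 'rV[R]_3) (a : R) k :
  0 <= a -> dot u u <= a ^+ 2 -> `|u 0 k| <= a.
Proof.
move=> a0 ua; rewrite -(ger0_norm a0) -ler_sqr ?nnegrE// !real_normK ?num_real//.
apply: le_trans ua; rewrite /dot (bigD1 k)//= -expr2 lerDl.
by apply: sumr_ge0 => j _; rewrite -expr2 sqr_ge0.
Qed.

Lemma coord_dot_le (u : 'rV[R]_3) (a : R) :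
  (forall k, `|u 0 k| <= a) -> dot u u <= 3 * a ^+ 2.
Proof.
move=> ua; have a0 : 0 <= a by exact: le_trans (ua 0).
have hk k : u 0 k * u 0 k <= a ^+ 2.
  by rewrite -expr2; apply: sqr_le_norm; rewrite (ger0_norm a0).
by rewrite dotE (_ : 3 * a ^+ 2 = a ^+ 2 + a ^+ 2 + a ^+ 2) ?lerD//; ring.
Qed.

Lemma cell_sub_box i : i \in s -> cell3 `<=` box3 (P i) h.
Proof.
move=> si q qs; apply/box3P => k.
have := coord_le_dot k h0 (hdiam qs (hull_vertex P si)).
by rewrite !mxE.
Qed.

Lemma leb3_cell_fin : (leb3 cell3 < +oo)%E.
Proof.
have [i si] : exists i, i \in s by apply/card_gt0P; rewrite s4.
apply: (@le_lt_trans _ _ (leb3 (box3 (P i) h))).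
  apply: le_measure; rewrite ?inE.
  - exact: measurable_cell.
  - exact: measurable_box3.
  - exact: cell_sub_box.
by rewrite leb3_box3// ltry.
Qed.

Definition vol : R := fine (leb3 cell3).

Lemma leb3_cell : leb3 cell3 = vol%:E.
Proof.
rewrite /vol fineK// ge0_fin_numE; first exact: leb3_cell_fin.
exact: measure_ge0.
Qed.

Lemma vol_le : vol <= (2 * h) ^+ 3.
Proof.
have [i si] : exists i, i \in s by apply/card_gt0P; rewrite s4.
rewrite -lee_fin -leb3_cell -(leb3_box3 (P i) h0).
apply: le_measure; rewrite ?inE.
- exact: measurable_cell.
- exact: measurable_box3.
- exact: cell_sub_box.
Qed.

Lemma vol_ge0 : 0 <= vol.
Proof. by rewrite /vol fine_ge0. Qed.

(* The image of the inscribed ball under the homothety of ratio 1/4 centred at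
   [P i] contains a cube of side [r / 4]. *)
Let corner i := P i + 4^-1 *: (c - P i).

Lemma corner_box i q : box3 (corner i) (r / 8) q ->
  exists2 x, cell x & row3 q = P i + 4^-1 *: (x - P i).
Proof.
move=> /box3P hq; exists (P i + 4 *: (row3 q - P i)); last first.
  by rewrite addrAC subrr add0r scalerA mulVf ?pnatr_eq0// scale1r addrC subrK.
apply: hball.
have -> : P i + 4 *: (row3 q - P i) - c = 4 *: (row3 q - corner i).
  by rewrite /corner; apply: row3P; rewrite !mxE; field.
(* The dilation by 4 turns the half-side r/8 into r/2, and 3 (r/2)^2 <= r^2. *)
rewrite dotZl dotZr mulrA.
have := @coord_dot_le (row3 q - corner i) (r / 8).
have {}hq k : `|(row3 q - corner i) 0 k| <= r / 8.
  by have := hq k; rewrite [(_ - _ : 'rV_3) _ _]mxE [(- _ : 'rV_3) _ _]mxE.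
move=> /(_ hq) hh; nra.
Qed.

Lemma corner_box_sub i : i \in s -> box3 (corner i) (r / 8) `<=` cell3.
Proof.
move=> si q /corner_box[x xs] /= ->; apply: hull_segment => //.
  by apply/andP; split; lra.
exact: hull_vertex.
Qed.

Lemma vol_gt0 : 0 < vol.
Proof.
have [i si] : exists i, i \in s by apply/card_gt0P; rewrite s4.
have r8 : 0 <= r / 8 by rewrite divr_ge0// ltW.
rewrite (@lt_le_trans _ _ ((2 * (r / 8)) ^+ 3))//.
  by rewrite exprn_gt0// mulr_gt0// divr_gt0.
rewrite -lee_fin -leb3_cell -(leb3_box3 (corner i) r8).
apply: le_measure; rewrite ?inE.
- exact: measurable_box3.
- exact: measurable_cell.
- exact: corner_box_sub.
Qed.

Local Notation nice f := (bmeas cell3 (fun q => f (row3 q))).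

Lemma integral3Z a (f : 'rV[R]_3 -> R) : nice f ->
  integral3 cell (fun x => a * f x) = a * integral3 cell f.
Proof.
exact: (bmeas_RintegralZ (mu := @leb3 R) measurable_cell leb3_cell_fin).
Qed.

Lemma integral3_sum (I : Type) (l : seq I) (p : pred I)
    (F : I -> 'rV[R]_3 -> R) : (forall i, p i -> nice (F i)) ->
  integral3 cell (fun x => \sum_(i <- l | p i) F i x) =
  \sum_(i <- l | p i) integral3 cell (F i).
Proof.
exact: (bmeas_Rintegral_sum (mu := @leb3 R) measurable_cell leb3_cell_fin).
Qed.

Lemma le_integral3 (f g : 'rV[R]_3 -> R) : nice f -> nice g ->
  (forall x, cell x -> f x <= g x) -> integral3 cell f <= integral3 cell g.
Proof.
move=> nf ng fg.
apply: (bmeas_le_Rintegral (mu := @leb3 R) measurable_cell leb3_cell_fin nf ng).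
by move=> q; exact: fg.
Qed.

Lemma integral3_cst a : integral3 cell (fun=> a) = a * vol.
Proof. by rewrite /integral3 Rintegral_cst//; exact: measurable_cell. Qed.

Lemma integral3_ge0 (f : 'rV[R]_3 -> R) : (forall x, cell x -> 0 <= f x) ->
  0 <= integral3 cell f.
Proof. by move=> f0; apply: Rintegral_ge0 => q; exact: f0. Qed.

Lemma nice_affsM p p' : affs p -> affs p' -> nice (fun x => p x * p' x).
Proof. by move=> hp hp'; apply: bmeasM; exact: bmeas_affs. Qed.

(** Let [j] be the vertex where |p| is largest. At P j + (x - P j)/4 with [x] in the cell, |p| is at
    least 3/4 |p(P j)| - 1/4 |p(x)|, hence at least half of |p(P j)|. So the cube of side r/4
    contributes at least p(P j)^2 / 4 times (r/4)^3, while the volume of the cell is at most (2h)^3;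
    the quotient is the constant. *)
Lemma vertex_le_integral3 p i : affs p -> i \in s ->
  p (P i) ^+ 2 * vol <= 4 * (8 * h / r) ^+ 3 * integral3 cell (fun x => p x * p x).
Proof.
move=> hp si; have [j sj jmax] := affs_max_vertex p.
have r8 : 0 <= r / 8 by rewrite divr_ge0// ltW.
have pij : p (P i) ^+ 2 <= p (P j) ^+ 2 by apply: sqr_le_norm; exact: jmax.
apply: (@le_trans _ _ (p (P j) ^+ 2 * (2 * h) ^+ 3)).
  by rewrite ler_pM ?sqr_ge0 ?vol_ge0 ?vol_le.
suff low : p (P j) ^+ 2 / 4 * (2 * (r / 8)) ^+ 3 <=
    integral3 cell (fun x => p x * p x).
  apply: le_trans (ler_wpM2l _ low).
    rewrite le_eqVlt; apply/orP; left; apply/eqP; field.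
    by rewrite gt_eqF.
  by rewrite mulr_ge0// exprn_ge0// divr_ge0 ?mulr_ge0// ltW.
have mB := measurable_box3 (corner j) (r / 8).
have fB : (leb3 (box3 (corner j) (r / 8)) < +oo)%E by rewrite leb3_box3// ltry.
have npp := nice_affsM hp hp.
rewrite (_ : _ * _ = \int[@leb3 R]_(q in box3 (corner j) (r / 8)) (p (P j) ^+ 2 / 4))%R; last first.
  rewrite Rintegral_cst//; congr (_ * _).
  by rewrite -[LHS]/(fine ((2 * (r / 8)) ^+ 3)%:E) -(leb3_box3 (corner j) r8).
have bpp : bmeas (box3 (corner j) (r / 8)) (fun q => p (row3 q) * p (row3 q)).
  have [_ [M hM]] := npp; split.
    by apply: measurable_funM; exact: measurable_funTS (measurable_affs hp).
  by exists M => q /(corner_box_sub sj); exact: hM.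
apply: (@le_trans _ _
  (\int[@leb3 R]_(q in box3 (corner j) (r / 8)) (p (row3 q) * p (row3 q)))%R).
  apply: bmeas_le_Rintegral => //; first exact: bmeas_cst.
  move=> q /corner_box[x xs ->]; rewrite affs_segment//.
  have : `|p x| <= `|p (P j)| by exact: affs_norm_le.
  rewrite -expr2 => pxj.
  have e4 : p (P j) ^+ 2 / 4 = (p (P j) / 2) ^+ 2 by field.
  rewrite e4; apply: sqr_le_norm.
  rewrite (_ : _ + _ = p (P j) * (3 / 4) + p x / 4); last by field.
  have absM (a b : R) : 0 <= b -> `|a * b| = `|a| * b.
    by move=> b0; rewrite normrM (ger0_norm b0).
  by rewrite (le_trans _ (lerB_normD _ _))// !absM; lra.
rewrite /integral3 /Rintegral fine_le//.
- apply: integrable_fin_num => //.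
  exact: (bmeas_integrable (mu := @leb3 R) mB fB bpp).
- apply: integrable_fin_num; first exact: measurable_cell.
  exact: (bmeas_integrable (mu := @leb3 R) measurable_cell leb3_cell_fin npp).
- apply: ge0_subset_integral => //.
  + exact: measurable_cell.
  + by apply/measurable_EFinP; case: npp.
  + by move=> q _; rewrite lee_fin -expr2 sqr_ge0.
  + exact: corner_box_sub.
Qed.

End CellIntegral.

(** * Differential operators on affine fields *)

Section Derivatives.
Context {R : realType}.
Implicit Types (p : 'rV[R]_3 -> R) (v w : 'rV[R]_3 -> 'rV[R]_3).

Lemma partialE p a b k x : (forall y, p y = a + dot b y) ->
  partial k p x = b 0 k.
Proof.
move=> hp; rewrite /partial /derive; apply: cvg_lim => //.
apply: cvg_near_cst; near=> e.
have e0 : e != 0 by near: e; exact: nbhs_dnbhs_neq.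
rewrite /= !hp dotDr dotZr dot_delta.
rewrite (_ : _ - _ = e * b 0 k); last by ring.
by rewrite -[_ *: _]/(e^-1 * (e * b 0 k)) mulKf.
Unshelve. all: by end_near.
Qed.

Lemma partial_sum (I : finType) (c : I -> R) (F : I -> 'rV[R]_3 -> R) k x :
  (forall i, affs (F i)) ->
  partial k (fun y => \sum_i c i * F i y) x = \sum_i c i * partial k (F i) x.
Proof.
move=> /choice[a /choice[b h]].
rewrite (@partialE _ (\sum_i c i * a i) (\sum_i c i *: b i)).
  rewrite summxE; apply: eq_bigr => i _.
  by rewrite mxE (partialE _ _ (h i)).
move=> y; rewrite dot_suml -big_split /=; apply: eq_bigr => i _.
by rewrite h dotZl mulrDr.
Qed.

Lemma affs_partial p k : affs p -> affs (partial k p).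
Proof.
move=> [a [b h]]; apply: affs_ext (affs_cst (b 0 k)) => x.
by rewrite (partialE _ _ h).
Qed.

Lemma dot_grad p x y z : affs p -> dot (grad p x) (y - z) = p y - p z.
Proof.
move=> [a [b h]]; rewrite !h (_ : grad p x = b) ?dotBr; first by ring.
by apply/rowP => k; rewrite mxE (partialE _ _ h).
Qed.

Lemma div_radial v (a : 'rV[R]_3) (b : R) x :
  (forall y, v y = a + b *: y) -> div v x = 3 * b.
Proof.
move=> h; rewrite /div; under eq_bigr => k _.
  rewrite (@partialE _ (a 0 k) (b *: delta_mx 0 k)); last first.
    by move=> y; rewrite h !mxE dotZl dotC dot_delta.
  rewrite !mxE !eqxx mulr1; over.
by rewrite sumr_const card_ord mulr_natl.
Qed.

Lemma curl_rotation w (a b : 'rV[R]_3) x :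
  (forall y, w y = a + cross b y) -> curl w x = 2 *: b.
Proof.
move=> h; apply/rowP => k; rewrite !mxE.
have e3 (i : 'I_3) : i + 1 + 2 = i /\ i + 2 + 1 = i /\ i + 1 + 1 = i + 2 /\
    i + 2 + 2 = i + 1.
  by case: i => -[|[|[|//]]] ltk; do !split; apply: val_inj.
have [e12 [e21 [e11 e22]]] := e3 k.
rewrite (@partialE _ (a 0 (k + 2))
  (b 0 k *: delta_mx 0 (k + 1) - b 0 (k + 1) *: delta_mx 0 k)); last first.
  by move=> y; rewrite h !mxE e21 e22 dotBl !dotZl !(dotC (delta_mx _ _)) !dot_delta.
rewrite (@partialE _ (a 0 (k + 1))
  (b 0 (k + 2) *: delta_mx 0 k - b 0 k *: delta_mx 0 (k + 2))); last first.
  by move=> y; rewrite h !mxE e12 e11 dotBl !dotZl !(dotC (delta_mx _ _)) !dot_delta.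
rewrite !mxE !eqxx /=.
have n1 : (k + 1 == k) = false by case: k {e12 e21 e11 e22} => -[|[|[|//]]].
have n2 : (k + 2 == k) = false by case: k {e12 e21 e11 e22 n1} => -[|[|[|//]]].
rewrite n1 n2 -[false%:R]/(0 : R); ring.
Qed.

Lemma affs_div v : affv v -> affs (div v).
Proof. by move=> h; apply: affs_sum => k _; exact: affs_partial. Qed.

Lemma affv_grad p : affs p -> affv (grad p).
Proof.
by move=> h k; apply: affs_ext (affs_partial k h) => x; rewrite mxE.
Qed.

Lemma affv_curl w : affv w -> affv (curl w).
Proof.
move=> h k; apply: (@affs_ext _ (fun x =>
    partial (k + 1) (fun y => w y 0 (k + 2)) x +
    -1 * partial (k + 2) (fun y => w y 0 (k + 1)) x)).
  by move=> x; rewrite mxE mulN1r.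
by apply: affsD; [exact: affs_partial|apply: affsZ; exact: affs_partial].
Qed.

End Derivatives.

(** * Estimates on a tetrahedron *)

Section Mesh.
Context {R : realType} {Omega : set 'rV[R]_3}.
Variables (T : triangulation Omega) (sigma : R).
Local Notation V := (@vertex R Omega T).
Local Notation cell t := (hull (@vertex R Omega T) t).
Local Notation simplex := {set 'I_(nvert T)}.

Definition shape_regular := forall t : simplex, t \in tets T ->
  meshsize t <= sigma * indiam (cell t).
Hypothesis shape : shape_regular.

Section Tetrahedron.
Variable t : simplex.
Hypothesis tT : t \in tets T.
Let t4 : #|t| = 4%N := tri_card tT.
Let tind : affinely_independent V t := @tri_nondegenerate _ _ T _ tT.
Local Notation h := (meshsize t).

Lemma dist_meshsize x y : cell t x -> cell t y -> enorm (x - y) <= h.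
Proof.
move=> xs ys; apply: ub_le_sup; last by exists x, y; split.
pose B := \sum_k \sum_(i in t) `|V i 0 k|.
have bd z k : cell t z -> `|z 0 k| <= B.
  move=> zs; apply: (affs_norm_le t4 tind (affs_coord k) zs) => i ti.
  rewrite /B (bigD1 k)//= (bigD1 i)//= -addrA lerDl addr_ge0//.
    by rewrite sumr_ge0.
  by rewrite sumr_ge0// => j _; rewrite sumr_ge0.
exists (Num.sqrt (3 * (B + B) ^+ 2)) => _ [z [u [zs us ->]]].
rewrite ler_wsqrtr// coord_dot_le// => k; rewrite !mxE.
by rewrite (le_trans (ler_normB _ _))// lerD ?bd.
Qed.

Lemma enorm_sqr (u : 'rV[R]_3) : enorm u ^+ 2 = dot u u.
Proof. by rewrite sqr_sqrtr// dot_ge0. Qed.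

Lemma enorm_ge0 (u : 'rV[R]_3) : 0 <= enorm u.
Proof. exact: sqrtr_ge0. Qed.

Lemma tet_vertex : exists i, i \in t.
Proof. by apply/card_gt0P; rewrite t4. Qed.

Lemma meshsize_ge0 : 0 <= h.
Proof.
have [i ti] := tet_vertex; have := hull_vertex V ti => vi.
exact: le_trans (enorm_ge0 _) (dist_meshsize vi vi).
Qed.

Lemma dot_meshsize x y : cell t x -> cell t y -> dot (x - y) (x - y) <= h ^+ 2.
Proof.
move=> xs ys; rewrite -enorm_sqr ler_sqr ?nnegrE ?enorm_ge0 ?meshsize_ge0//.
exact: dist_meshsize.
Qed.

Lemma meshsize_gt0 : 0 < h.
Proof.
rewrite lt_def meshsize_ge0 andbT; apply/eqP => h0.
have /card_gt1P[i [j [ti tj ij]]] : (1 < #|t|)%N by rewrite t4.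
have := dot_meshsize (hull_vertex V ti) (hull_vertex V tj).
rewrite h0 expr0n leNgt dot_gt0// subr_eq0; apply/eqP => vij.
have := lam_vertex t4 tind ti tj; rewrite -vij lam_vertex// eqxx (negPf ij).
by move/eqP; rewrite oner_eq0.
Qed.

(** [indiam] is a supremum that need not be attained, so a ball of diameter more than half of it is
    taken; this is the origin of the factor 4. The default value 0 of [sup] is excluded because it
    would force the mesh size to be nonpositive. *)
Lemma inscribed_ball : exists c r, [/\ 0 < r, h <= 4 * sigma * r &
  forall x, dot (x - c) (x - c) <= r ^+ 2 -> cell t x].
Proof.
have hs := shape tT; have h0 := meshsize_gt0.
have i0 : indiam (cell t) != 0.
  by apply/eqP => i0; move: hs; rewrite i0 mulr0 leNgt h0.
have hsup : has_sup [set d | exists c (r : R),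
    [/\ 0 <= r, eball c r `<=` cell t & d = 2 * r]].
  by apply: contrapT => /sup_out; apply/eqP.
have i1 : 0 <= indiam (cell t).
  have [[d [c [r [r0 hb _]]]] hu] := hsup.
  apply: (@le_trans _ _ (2 * r)); first by rewrite mulr_ge0.
  by apply: ub_le_sup => //; exists c, r.
have ip : 0 < indiam (cell t) by rewrite lt_def i0.
have s0 : 0 < sigma by rewrite -(pmulr_lgt0 _ ip) (lt_le_trans h0).
have i2 : 0 < indiam (cell t) / 2 by rewrite divr_gt0.
have [d [c [r [_ hb dE]]] hr] := sup_adherent i2 hsup.
have {}hr : indiam (cell t) / 4 < r by move: hr; rewrite dE; rewrite -/(indiam _); lra.
have r0 : 0 < r by apply: lt_trans hr; rewrite divr_gt0.
exists c, r; split => //.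
- apply: le_trans hs _; rewrite (mulrC 4) -mulrA ler_pM2l//; lra.
- move=> x xc; apply: hb; rewrite /eball /= -ler_sqr ?nnegrE ?enorm_ge0 ?(ltW r0)//.
  by rewrite enorm_sqr.
Qed.

Lemma sigma_gt0 : 0 < sigma.
Proof.
have [c [r [r0 hr _]]] := inscribed_ball; have := meshsize_gt0; nra.
Qed.

(** The constant 4 (8 h / r)^3 of [vertex_le_integral3] for h / r <= 4 sigma. *)
Definition shapeK : R := 4 * (32 * sigma) ^+ 3.

Local Notation tvol := (vol V t).
Local Notation grd := (bgr V t).

Lemma tvol_gt0 : 0 < tvol.
Proof.
have [c [r [r0 _ hb]]] := inscribed_ball.
exact: (vol_gt0 t4 tind meshsize_ge0 r0 dot_meshsize hb).
Qed.

Lemma vertex_le_int p i : affs p -> i \in t ->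
  p (V i) ^+ 2 * tvol <= shapeK * integral3 (cell t) (fun x => p x * p x).
Proof.
move=> hp ti; have [c [r [r0 hr hb]]] := inscribed_ball.
have := vertex_le_integral3 t4 tind meshsize_ge0 r0 dot_meshsize hb hp ti.
move=> /le_trans; apply; rewrite ler_wpM2r//.
  by apply: integral3_ge0 => x _; rewrite -expr2 sqr_ge0.
rewrite ler_wpM2l// lerXn2r ?nnegrE//.
- by rewrite divr_ge0 ?mulr_ge0 ?meshsize_ge0 ?ltW.
- by rewrite mulr_ge0// ltW// sigma_gt0.
- by rewrite ler_pdivrMr//; lra.
Qed.

(** From the centre of the inscribed ball, a step of length [r] along the gradient raises the
    barycentric coordinate by r |grad|. Both values lie in [0, 1], so r |grad| <= 1, and h <= 4
    sigma r. *)
Lemma bgr_bound i : i \in t -> dot (grd i) (grd i) * h ^+ 2 <= (4 * sigma) ^+ 2.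
Proof.
move=> ti; have [c [r [r0 hr hb]]] := inscribed_ball.
have [->|g0] := eqVneq (grd i) 0; first by rewrite dot0l mul0r sqr_ge0.
have e0 : 0 < enorm (grd i) by rewrite sqrtr_gt0 dot_gt0.
pose x := c + (r / enorm (grd i)) *: grd i.
have xs : cell t x.
  apply: hb; rewrite /x addrAC subrr add0r dotZl dotZr -enorm_sqr.
  rewrite le_eqVlt; apply/orP; left; apply/eqP; field; exact: lt0r_neq0.
have cs : cell t c by apply: hb; rewrite subrr dot0l sqr_ge0.
have : bcoord V t i x - bcoord V t i c <= 1.
  rewrite lerBlDr (le_trans (lam_le1 t4 tind ti xs))// lerDl.
  exact: (hullP t4 tind c).1.
rewrite -dot_bgrB /x addrAC subrr add0r dotZr -enorm_sqr.
have -> : r / enorm (grd i) * enorm (grd i) ^+ 2 = r * enorm (grd i).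
  by field; exact: lt0r_neq0.
move=> re1; rewrite -exprMn lerXn2r ?nnegrE//.
- by rewrite mulr_ge0 ?enorm_ge0 ?meshsize_ge0.
- by rewrite mulr_ge0// ltW// sigma_gt0.
- have := ltW sigma_gt0; have := enorm_ge0 (grd i).
  rewrite -/h => n0 s0; apply: (@le_trans _ _ (enorm (grd i) * (4 * sigma * r))).
    by rewrite ler_wpM2l.
  nra.
Qed.

Lemma int_affs_lin (I : finType) (c : I -> R) (F : I -> 'rV[R]_3 -> R) q :
  (forall i, affs (F i)) -> affs q ->
  integral3 (cell t) (fun x => (\sum_i c i * F i x) * q x) =
  \sum_i c i * integral3 (cell t) (fun x => F i x * q x).
Proof.
move=> hF hq.
rewrite (_ : (fun x => _) = (fun x => \sum_i c i * (F i x * q x))); last first.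
  by apply/funext => x; rewrite mulr_suml; apply: eq_bigr => i _; rewrite mulrA.
have nFq i := nice_affsM t4 tind (hF i) hq.
rewrite (integral3_sum t4 tind meshsize_ge0 dot_meshsize); last first.
  by move=> i _; exact: bmeasZ (nFq i).
apply: eq_bigr => i _.
exact: (integral3Z t4 tind meshsize_ge0 dot_meshsize _ (nFq i)).
Qed.

Lemma int_scale_sqr (c : R) (q : 'rV[R]_3 -> R) : affs q ->
  integral3 (cell t) (fun x => (c * q x) * (c * q x)) =
  c ^+ 2 * integral3 (cell t) (fun x => q x * q x).
Proof.
move=> hq; have := @int_affs_lin 'I_1 (fun=> c ^+ 2) (fun=> q) q (fun=> hq) hq.
rewrite !big_ord1 => <-.
by congr (integral3 _ _); apply/funext => x; rewrite big_ord1; ring.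
Qed.

Lemma int_sum_affsM (I : finType) (F G : I -> 'rV[R]_3 -> R) :
  (forall i, affs (F i)) -> (forall i, affs (G i)) ->
  integral3 (cell t) (fun x => \sum_i F i x * G i x) =
  \sum_i integral3 (cell t) (fun x => F i x * G i x).
Proof.
move=> hF hG.
rewrite (integral3_sum t4 tind meshsize_ge0 dot_meshsize)// => i _.
exact: nice_affsM.
Qed.

Lemma int_sqr_le (I : finType) (p : 'rV[R]_3 -> R) (F : I -> 'rV[R]_3 -> R) M :
  affs p -> (forall i, affs (F i)) ->
  (forall x, cell t x -> p x ^+ 2 <= M * \sum_i F i x ^+ 2) ->
  integral3 (cell t) (fun x => p x * p x) <=
  M * \sum_i integral3 (cell t) (fun x => F i x * F i x).
Proof.
move=> hp hF hM; rewrite -int_sum_affsM//.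
have nF i := nice_affsM t4 tind (hF i) (hF i).
have nS : bmeas (@row3 R @^-1` cell t)
    (fun q => \sum_i F i (row3 q) * F i (row3 q)).
  by apply: bmeas_sum => i _; exact: nF.
rewrite -(integral3Z t4 tind meshsize_ge0 dot_meshsize M nS).
apply: (le_integral3 t4 tind meshsize_ge0 dot_meshsize).
- exact: nice_affsM.
- exact: bmeasZ nS.
- by move=> x xs; rewrite -expr2 (le_trans (hM _ xs)).
Qed.

Lemma int_sqr_le_cst p M : affs p -> (forall x, cell t x -> p x ^+ 2 <= M) ->
  integral3 (cell t) (fun x => p x * p x) <= M * tvol.
Proof.
move=> hp hM; rewrite -(integral3_cst t4 tind).
apply: (le_integral3 t4 tind meshsize_ge0 dot_meshsize).
- exact: nice_affsM.
- exact: bmeas_cst.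
- by move=> x xs; rewrite -expr2 hM.
Qed.

End Tetrahedron.
End Mesh.

(** * Bilinear forms on piecewise affine fields *)

Section Forms.
Context {R : realType} {Omega : set 'rV[R]_3}.
Variable T : triangulation Omega.
Local Notation V := (@vertex R Omega T).
Local Notation cell t := (hull (@vertex R Omega T) t).
Local Notation simplex := {set 'I_(nvert T)}.
Local Notation sfield := (sfield T).
Local Notation vfield := (vfield T).
Implicit Types (u v w : vfield) (p q : sfield) (t : simplex).

Definition pw_affs p := forall t, t \in tets T -> affs (p t).
Definition pw_affv u := forall t, t \in tets T -> affv (u t).
(** Equality of the polynomials at all points, not only on the cell, so that elementwise derivatives
    agree as well; values attached to vertex sets outside [tets T] do not count. *)
Definition mesh_eq u v := forall t x, t \in tets T -> u t x = v t x.

Definition comb (I : finType) (c : I -> R) (F : I -> vfield) : vfield :=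
  fun t x => \sum_i c i *: F i t x.

Lemma pw_affv_comb (I : finType) (c : I -> R) (F : I -> vfield) :
  (forall i, pw_affv (F i)) -> pw_affv (comb c F).
Proof. by move=> h t tT; apply: affv_sum => i _; apply: affvZ; exact: h. Qed.

Lemma mesh_eqE u v : mesh_eq u v -> forall t, t \in tets T -> u t = v t.
Proof. by move=> uv t tT; apply/funext => x; exact: uv. Qed.

(** Linearity is required only for finite combinations of piecewise affine fields, where
    integrability and differentiability are available. *)
Record sform (a : vfield -> vfield -> R) : Prop := Sform {
  sform_sym : forall u v, a u v = a v u;
  sform_ge0 : forall u, pw_affv u -> 0 <= a u u;
  sform_ext : forall u u' v, mesh_eq u u' -> a u v = a u' v;
  sform_comb : forall (I : finType) (c : I -> R) (F : I -> vfield) v,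
    (forall i, pw_affv (F i)) -> pw_affv v ->
    a (comb c F) v = \sum_i c i * a (F i) v }.

(** The elementwise operators: components, divergence, entries of the curl and of the gradients. The
    L^2 pairing of such an operator with itself is an [sform], and all energy forms are built from
    these pairings. *)
Record linop (L : vfield -> sfield) : Prop := Linop {
  linop_affs : forall u, pw_affv u -> pw_affs (L u);
  linop_ext : forall u u' t, u t = u' t -> L u t = L u' t;
  linop_comb : forall (I : finType) (c : I -> R) (F : I -> vfield) t x,
    (forall i, pw_affv (F i)) -> t \in tets T ->
    L (comb c F) t x = \sum_i c i * L (F i) t x }.

Lemma linop_component k : linop (fun u => component u k).
Proof.
split=> [u h t tT|u u' t uu'|I c F t x _ _]; first exact: h.
  by rewrite /component uu'.
by rewrite /component /comb summxE; apply: eq_bigr => i _; rewrite mxE.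
Qed.

Lemma linop_partial L k : linop L -> linop (fun u t => partial k (L u t)).
Proof.
move=> [La Le Lc]; split=> [u h t tT|u u' t uu'|I c F t x hF tT].
- exact/affs_partial/La.
- by rewrite (Le _ _ _ uu').
- rewrite -partial_sum; last by move=> i; exact: La.
  by congr (partial _ _ _); apply/funext => y; exact: Lc.
Qed.

Lemma linop_add L M : linop L -> linop M -> linop (fun u t x => L u t x + M u t x).
Proof.
move=> [La Le Lc] [Ma Me Mc]; split=> [u h t tT|u u' t uu'|I c F t x hF tT].
- by apply: affsD; [exact: La|exact: Ma].
- by rewrite (Le _ _ _ uu') (Me _ _ _ uu').
- rewrite Lc// Mc// -big_split; apply: eq_bigr => i _ /=; ring.
Qed.

Lemma linop_scale L (a : R) : linop L -> linop (fun u t x => a * L u t x).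
Proof.
move=> [La Le Lc]; split=> [u h t tT|u u' t uu'|I c F t x hF tT].
- by apply: affsZ; exact: La.
- by rewrite (Le _ _ _ uu').
- by rewrite Lc// mulr_sumr; apply: eq_bigr => i _; ring.
Qed.

Lemma linop_eq L M : (forall u, L u = M u) -> linop L -> linop M.
Proof. by move=> /funext <-. Qed.

Lemma linop_div : linop (@bdiv _ _ T).
Proof.
have h k := linop_partial k (linop_component k).
apply: linop_eq (linop_add (linop_add (h 0) (h 1)) (h 2)) => u.
by apply/funext => t; apply/funext => x; rewrite /bdiv /div sum3.
Qed.

Lemma linop_curl k : linop (fun u => component (bcurl u) k).
Proof.
have h1 := linop_partial (k + 1) (linop_component (k + 2)).
have h2 := linop_scale (-1) (linop_partial (k + 2) (linop_component (k + 1))).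
apply: linop_eq (linop_add h1 h2) => u.
by apply/funext => t; apply/funext => x; rewrite /component /bcurl mxE mulN1r.
Qed.

Lemma linop_grad k l : linop (fun u => component (bgrad (component u k)) l).
Proof.
apply: linop_eq (linop_partial l (linop_component k)) => u.
by apply/funext => t; apply/funext => x; rewrite /component /bgrad mxE.
Qed.


Lemma l2s_sym p q : l2s p q = l2s q p.
Proof.
by apply: eq_bigr => t _; apply: eq_Rintegral => x _; rewrite mulrC.
Qed.

Lemma l2s_ge0 p : 0 <= l2s p p.
Proof.
apply: sumr_ge0 => t _; apply: Rintegral_ge0 => x _.
by rewrite -expr2 sqr_ge0.
Qed.

Lemma sform_l2s L : linop L -> sform (fun u v => l2s (L u) (L v)).
Proof.
move=> [La Le Lc]; split => [u v|u _|u u' v uu'|I c F v hF hv].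
- exact: l2s_sym.
- exact: l2s_ge0.
- by apply: eq_bigr => t tT; rewrite (Le _ u')//; exact: mesh_eqE tT.
- rewrite /l2s; under [RHS]eq_bigr do rewrite mulr_sumr.
  rewrite exchange_big; apply: eq_bigr => t tT /=.
  rewrite -(int_affs_lin tT); [|by move=> i; exact: La|exact: La].
  by congr (integral3 _ _); apply/funext => x; rewrite Lc.
Qed.

Lemma sformD a b : sform a -> sform b -> sform (fun u v => a u v + b u v).
Proof.
move=> [as_ ap ae ac] [bs bp be bc]; split => [u v|u hu|u u' v uu'|I c F v hF hv].
- by rewrite as_ bs.
- by rewrite addr_ge0 ?ap ?bp.
- by rewrite (ae _ _ _ uu') (be _ _ _ uu').
- by rewrite ac// bc// -big_split; apply: eq_bigr => i _ /=; ring.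
Qed.

Lemma sformZ a (e : R) : 0 <= e -> sform a -> sform (fun u v => e * a u v).
Proof.
move=> e0 [as_ ap ae ac]; split => [u v|u hu|u u' v uu'|I c F v hF hv].
- by rewrite as_.
- by rewrite mulr_ge0 ?ap.
- by rewrite (ae _ _ _ uu').
- by rewrite ac// mulr_sumr; apply: eq_bigr => i _ /=; ring.
Qed.

Lemma sform_sum (I : finType) (a : I -> vfield -> vfield -> R) :
  (forall i, sform (a i)) -> sform (fun u v => \sum_i a i u v).
Proof.
move=> h; split => [u v|u hu|u u' v uu'|J c F v hF hv].
- by apply: eq_bigr => i _; exact: sform_sym.
- by apply: sumr_ge0 => i _; exact: sform_ge0.
- by apply: eq_bigr => i _; exact: sform_ext.
- under eq_bigr do rewrite sform_comb//.
  by rewrite exchange_big; apply: eq_bigr => i _; rewrite mulr_sumr.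
Qed.

Lemma sform_eq a b : (forall u v, pw_affv u -> pw_affv v -> a u v = b u v) ->
  (forall u v, b u v = b v u) ->
  (forall u u' v, mesh_eq u u' -> b u v = b u' v) ->
  sform a -> sform b.
Proof.
move=> ab bs be [as_ ap ae ac]; split => // [u hu|J c F v hF hv].
- by rewrite -ab// ap.
- rewrite -ab ?ac//; last exact: pw_affv_comb.
  by apply: eq_bigr => i _; rewrite ab.
Qed.

Lemma l2vE u v : pw_affv u -> pw_affv v ->
  l2v u v = \sum_k l2s (component u k) (component v k).
Proof.
move=> hu hv; rewrite /l2s exchange_big; apply: eq_bigr => t tT.
by rewrite -(int_sum_affsM tT)// => k; [exact: hu|exact: hv].
Qed.

Lemma l2v_sym u v : l2v u v = l2v v u.
Proof.
by apply: eq_bigr => t _; apply: eq_Rintegral => x _; rewrite dotC.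
Qed.

Lemma l2v_ext u u' v : mesh_eq u u' -> l2v u v = l2v u' v.
Proof. by move=> /mesh_eqE uu'; apply: eq_bigr => t tT; rewrite uu'. Qed.

Lemma l2v_ge0 u : 0 <= l2v u u.
Proof.
by apply: sumr_ge0 => t _; apply: Rintegral_ge0 => x _; exact: dot_ge0.
Qed.

Lemma sform_l2v : sform (@l2v _ _ T).
Proof.
apply: (@sform_eq (fun u v => \sum_k l2s (component u k) (component v k))).
- by move=> u v hu hv; rewrite l2vE.
- exact: l2v_sym.
- exact: l2v_ext.
- by apply: sform_sum => k; exact: sform_l2s (linop_component k).
Qed.

Lemma mesh_eq_curl u v : mesh_eq u v -> mesh_eq (bcurl u) (bcurl v).
Proof. by move=> /mesh_eqE uv t x tT; rewrite /bcurl uv. Qed.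

Lemma pw_affv_curl u : pw_affv u -> pw_affv (bcurl u).
Proof. by move=> h t tT; exact/affv_curl/h. Qed.

Lemma sform_l2v_curl : sform (fun u v => l2v (bcurl u) (bcurl v)).
Proof.
apply: (@sform_eq (fun u v =>
    \sum_k l2s (component (bcurl u) k) (component (bcurl v) k))).
- by move=> u v hu hv; rewrite l2vE//; exact: pw_affv_curl.
- by move=> u v; exact: l2v_sym.
- by move=> u u' v uu'; exact/l2v_ext/mesh_eq_curl.
- by apply: sform_sum => k; exact: sform_l2s (linop_curl k).
Qed.

Lemma pw_affv_grad p : pw_affs p -> pw_affv (bgrad p).
Proof. by move=> h t tT; exact/affv_grad/h. Qed.

Lemma pw_affs_component u k : pw_affv u -> pw_affs (component u k).
Proof. by move=> h t tT; exact: h. Qed.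

Lemma sform_l2v_grad k :
  sform (fun u v => l2v (bgrad (component u k)) (bgrad (component v k))).
Proof.
apply: (@sform_eq (fun u v => \sum_l l2s (component (bgrad (component u k)) l)
                                    (component (bgrad (component v k)) l))).
- by move=> u v hu hv; rewrite l2vE//; exact/pw_affv_grad/pw_affs_component.
- by move=> u v; exact: l2v_sym.
- move=> u u' v /mesh_eqE uu'; apply: l2v_ext => t x tT.
  by rewrite /bgrad /component uu'.
- by apply: sform_sum => l; exact: sform_l2s (linop_grad k l).
Qed.

Variables (eps : R) (eps0 : 0 <= eps).

Lemma sform_div : sform (@form_div _ _ T eps).
Proof.
by apply: sformD; [exact: sform_l2s linop_div|apply: sformZ => //; exact: sform_l2v].
Qed.

Lemma sform_curl : sform (@form_curl _ _ T eps).
Proof.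
by apply: sformD; [exact: sform_l2v_curl|apply: sformZ => //; exact: sform_l2v].
Qed.

Lemma sform_grad3 : sform (@form_grad3 _ _ T eps).
Proof.
apply: sformD; last by apply: sformZ => //; exact: sform_l2v.
by apply: sform_sum => k; exact: sform_l2v_grad.
Qed.

Lemma sform_comb2 a (I J : finType) (c : I -> R) (F : I -> vfield)
    (d : J -> R) (G : J -> vfield) : sform a ->
  (forall i, pw_affv (F i)) -> (forall i, pw_affv (G i)) ->
  a (comb c F) (comb d G) = \sum_i \sum_j c i * d j * a (F i) (G j).
Proof.
move=> h hF hG; rewrite (sform_comb h)//; last exact: pw_affv_comb.
apply: eq_bigr => i _; rewrite (sform_sym h) (sform_comb h)// mulr_sumr.
by apply: eq_bigr => j _; rewrite (sform_sym h) mulrA.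
Qed.

Section Stiffness.
Variables (I : finType) (K : {set I}) (phi : I -> vfield).
Variable (a : vfield -> vfield -> R).
Hypotheses (ha : sform a) (hphi : forall i, i \in K -> pw_affv (phi i)).

Definition nodal_field (y : 'rV[R]_#|K|) : vfield :=
  comb (fun i => y 0 i) (fun i => phi (enum_val i)).

Lemma pw_affv_nodal y : pw_affv (nodal_field y).
Proof. by apply: pw_affv_comb => i; exact/hphi/enum_valP. Qed.

Lemma qform_stiffness y z :
  qform (stiffness K phi a) y z = a (nodal_field y) (nodal_field z).
Proof.
rewrite (sform_comb2 _ _ ha); try by move=> i; exact/hphi/enum_valP.
rewrite qformE; apply: eq_bigr => i _; apply: eq_bigr => j _.
by rewrite mxE (sform_sym ha).
Qed.

Lemma psd_stiffness : psd (stiffness K phi a).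
Proof.
split; first by apply/matrixP => i j; rewrite !mxE (sform_sym ha).
by move=> y; rewrite qform_stiffness (sform_ge0 ha)//; exact: pw_affv_nodal.
Qed.

End Stiffness.
End Forms.

Arguments nodal_field {R Omega T I} K phi y.

(** * Finite element bases *)

Section VertexAndFaceElements.
Context {R : realType} {Omega : set 'rV[R]_3}.
Variable T : triangulation Omega.
Local Notation V := (@vertex R Omega T).
Local Notation cell t := (hull (@vertex R Omega T) t).
Local Notation simplex := {set 'I_(nvert T)}.
Local Notation sfield := (sfield T).
Local Notation vfield := (vfield T).
Local Notation lam := (bcoord V).
Local Notation grd := (bgr V).
Implicit Types (u v w psi : vfield) (p : 'I_(nvert T)) (t f e : simplex).

Let t4 t (tT : t \in tets T) : #|t| = 4%N := tri_card tT.
Let tind t (tT : t \in tets T) : affinely_independent V t :=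
  @tri_nondegenerate _ _ T _ tT.

Lemma tet_ofP f t : t \in tets T -> f \subset t ->
  tet_of f \in tets T /\ f \subset tet_of f.
Proof.
rewrite /tet_of => tT ft; case: pickP => [t' /andP[]//|/(_ t)].
by rewrite tT ft.
Qed.

Lemma cell_conforming t t' x : t \in tets T -> t' \in tets T ->
  cell t x -> cell t' x -> cell (t :&: t') x.
Proof.
by move=> tT tT' xt xt'; rewrite -tri_conforming.
Qed.

Definition hat_grad (i : 'I_(nvert T)) : sfield :=
  fun t x => if i \in t then lam t i x else 0.

(** One convex representation of [x] over [f] gives its barycentric coordinates in every tetrahedron
    containing [f]. That [a] does not depend on [t] is the continuity across [f]. *)
Lemma hat_grad_face i f x : cell f x -> exists a : R,
  forall t, t \in tets T -> f \subset t -> hat_grad i t x = a.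
Proof.
move=> [c [c0 c1 xE]]; exists (if i \in f then c i else 0) => t' tT' ft'.
rewrite /hat_grad xE; case: ifPn => it'.
  exact: (lam_comb (t4 tT') (tind tT')).
by case: ifPn => // /(fintype.subsetP ft'); rewrite (negPf it').
Qed.

(** The boundary face [f] through [x] may belong to another tetrahedron [t']. There [i] is not a
    vertex of [f], since [f] lies in the boundary, so the coordinate of [i] vanishes on [f]; the
    value is carried over to [t] through the common face of [t] and [t']. *)
Lemma hat_grad_bdry i t x : i \in interior_vertices T -> t \in tets T ->
  cell t x -> bdry Omega x -> hat_grad i t x = 0.
Proof.
rewrite inE => /asboolPn ii tT xt xb.
have [t' [f [tT' ft' f3 xf fb]]] := tri_boundary T xb.
have xtt' := cell_conforming tT tT' xt (hull_subset ft' xf).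
have tt't := subsetIl t t'; have tt't' := subsetIr t t'.
have [c hc] := hat_grad_face i xtt'.
rewrite (hc t)// -(hc t')// /hat_grad; case: ifPn => // it'.
have [_ ->//] := hull_lam (t4 tT') (tind tT') ft' it' xf.
by apply: contra_notN ii => fi; apply: fb; exact: hull_vertex.
Qed.

Lemma in_Hgrad_hat i : i \in interior_vertices T -> in_Hgrad (hat_grad i).
Proof.
move=> ii; split.
- move=> t tT; rewrite /hat_grad; case: (boolP (i \in t)) => it; first exact: affs_lam.
  exact: affs_cst.
- move=> t t' x tT tT' xt xt'.
  have xtt' := cell_conforming tT tT' xt xt'.
  have [c hc] := hat_grad_face i xtt'.
  by rewrite (hc t) ?subsetIl// (hc t')// subsetIr.
- by move=> t x; exact: hat_grad_bdry.
Qed.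

Lemma vertex_tet (j : 'I_(nvert T)) :
  tet_of [set j]%SET \in tets T /\ j \in tet_of [set j]%SET.
Proof.
have [t tT jt] := tri_vertices j.
by have := @tet_ofP [set j]%SET t tT; rewrite !finset.sub1set => /(_ jt).
Qed.

Lemma vertex_dof_hat i j : vertex_dof (hat_grad i) j = (j == i)%:R.
Proof.
have [tT jt] := vertex_tet j; rewrite /vertex_dof /hat_grad.
case: ifPn => it; first by rewrite lam_vertex ?t4 1?eq_sym//; exact: tind.
by case: eqP => // ji; rewrite -ji jt in it.
Qed.

Lemma Hgrad_vertex_dof (p : sfield) t i : in_Hgrad p -> t \in tets T -> i \in t ->
  p t (V i) = vertex_dof p i.
Proof.
move=> [_ hc _] tT it; have [tT' jt] := vertex_tet i.
by apply: hc => //; exact: hull_vertex.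
Qed.

Lemma Hgrad_expand (p : sfield) t x : in_Hgrad p -> t \in tets T ->
  p t x = \sum_(i in interior_vertices T) vertex_dof p i * hat_grad i t x.
Proof.
move=> hp tT; have [ha hc hb] := hp.
rewrite (affs_bary x (t4 tT) (tind tT) (ha t tT)).
rewrite [LHS]big_mkcond [RHS]big_mkcond; apply: eq_bigr => i _.
rewrite /hat_grad; case: ifPn => it; last by rewrite mulr0 if_same.
case: ifPn => ii; first by rewrite (Hgrad_vertex_dof hp tT it) mulrC.
rewrite hb ?mulr0//; first exact: hull_vertex.
by move: ii; rewrite inE negbK => /asboolP.
Qed.

(** The explicit hat function shows that the choice in [Hgrad_basis] succeeds, and the expansion in
    degrees of freedom that its result is unique on the mesh. The bases of the face and edge
    elements are identified in the same way. *)
Lemma Hgrad_basisP i : i \in interior_vertices T ->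
  in_Hgrad (Hgrad_basis (T := T) i) /\
  forall t x, t \in tets T -> Hgrad_basis i t x = hat_grad i t x.
Proof.
move=> ii; have [|hb hd] := @xgetPex _ (fun _ _ => 0 : R) [set p : sfield |
    in_Hgrad p /\ forall j, j \in interior_vertices T -> vertex_dof p j = (j == i)%:R].
  exists (hat_grad i); split; first exact: in_Hgrad_hat.
  by move=> j _; exact: vertex_dof_hat.
rewrite -/(Hgrad_basis i) in hb hd; split => // t x tT.
rewrite (Hgrad_expand x hb tT) (bigD1 i)//= hd// eqxx mul1r big1 ?addr0//.
by move=> j /andP[ij /negPf ji]; rewrite hd// ji mul0r.
Qed.

Lemma card_face t p : t \in tets T -> p \in t -> #|t :\ p| = 3%N.
Proof.
by move=> tT pt; have := cardsD1 p t; rewrite pt (t4 tT) add1n => -[<-].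
Qed.

Lemma faceP t f : t \in tets T -> f \in simplices T 3 -> f \subset t ->
  exists2 p, p \in t & f = t :\ p.
Proof.
rewrite inE => tT /andP[/eqP f3 _] ft.
have : #|t :\: f| = 1%N.
  by have := cardsID f t; rewrite (finset.setIidPr ft) f3 (t4 tT) => -[].
move=> /eqP/cards1P[p tfp]; have : p \in t :\: f by rewrite tfp finset.set11.
rewrite finset.inE => /andP[pf pt]; exists p => //; apply/eqP.
rewrite eqEcard; apply/andP; split.
  by apply/fintype.subsetP => i fi; rewrite !finset.inE (fintype.subsetP ft)// andbT;
    apply: contraNneq pf => <-.
by rewrite f3 (card_face tT pt).
Qed.

Lemma face_simplex t p : t \in tets T -> p \in t -> t :\ p \in simplices T 3.
Proof.
move=> tT pt; rewrite finset.inE; apply/andP; split.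
  by rewrite (card_face tT pt).
by apply/existsP; exists t; rewrite tT finset.subsetDl.
Qed.

Lemma enum3 f : #|f| = 3%N ->
  exists i0 i1 i2, [/\ enum f = [:: i0; i1; i2], uniq [:: i0; i1; i2]
                     & f =i [:: i0; i1; i2]].
Proof.
move=> f3; have := enum_uniq f; have := mem_enum f.
move: f3; rewrite cardE; case: (enum f) => [|i0 [|i1 [|i2 [|]]]]//= _ fE u.
by exists i0, i1, i2; split => // i; rewrite -fE.
Qed.

Lemma face_normal_bgr t p : t \in tets T -> p \in t ->
  exists2 nu, nu != 0 & face_normal (t :\ p) = nu *: grd t p.
Proof.
move=> tT pt.
have f3 := card_face tT pt.
have [i0 [i1 [i2 [fE u fi]]]] := enum3 f3.
have it i : i \in [:: i0; i1; i2] -> i \in t /\ i != p.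
  by rewrite -fi !finset.inE => /andP[].
have [s0 p0] := it i0 (mem_head _ _).
have [|s1 p1] := it i1; first by rewrite !inE eqxx orbT.
have [|s2 p2] := it i2; first by rewrite !inE eqxx !orbT.
have [|nu nu0 nuE] := @cross_bgr _ _ V t (t4 tT) (tind tT) p i0 i1 i2 pt s0 s1 s2.
  by rewrite cons_uniq u andbT !inE !negb_or !(eq_sym p) p0 p1 p2.
by exists nu => //; rewrite -nuE /face_normal /corner fE.
Qed.

Lemma bgr_neq0 t p : t \in tets T -> p \in t -> grd t p != 0.
Proof.
move=> tT pt; have [i] : exists i, i \in t :\ p.
  by apply/card_gt0P; rewrite (card_face tT pt).
rewrite !finset.inE => /andP[ip it]; apply/eqP => g0.
have := dot_bgrB V t p (V p) (V i); rewrite g0 dot0l !lam_vertex ?t4//; try exact: tind.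
by rewrite eqxx eq_sym (negPf ip) subr0 => /eqP; rewrite eq_sym oner_eq0.
Qed.

(** The factor between the normal of the face opposite to [p] and the gradient of the coordinate at
    [p]. The projection formula makes it a total function. *)
Definition nu t p : R :=
  dot (face_normal (t :\ p)) (grd t p) / dot (grd t p) (grd t p).

Lemma nuP t p : t \in tets T -> p \in t ->
  nu t p != 0 /\ face_normal (t :\ p) = nu t p *: grd t p.
Proof.
move=> tT pt; have [n n0 nE] := face_normal_bgr tT pt.
have -> // : nu t p = n.
rewrite /nu nE dotZl mulfK// gt_eqF// dot_gt0//; exact: bgr_neq0.
Qed.

Definition flux_weight : nat -> R := projT1 (cid (@triangle_flux_weights R)).
Local Notation w_ := flux_weight.
(* The area 1/2 of the reference triangle. *)
Definition flux_mass : R := w_ 0 + w_ 1 + w_ 2.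

Lemma flux_weight_ge0 k : 0 <= w_ k.
Proof. by rewrite /w_; case: cid => /= w []. Qed.

Lemma flux_mass_gt0 : 0 < flux_mass.
Proof. by rewrite /flux_mass /w_; case: cid => /= w []. Qed.

Lemma face_dofE v f : affv (v (tet_of f)) ->
  face_dof v f =
  \sum_(k < 3) w_ k * dot (v (tet_of f) (corner f k)) (face_normal f).
Proof.
move=> hv; rewrite !big_ord_recl big_ord0 addr0 addrA /face_dof /w_.
case: cid => /= w [_ _ ->] // a b; exact: affv_triangle.
Qed.

Lemma corner_mem f k : f \in simplices T 3 -> (k < 3)%N ->
  exists2 i, i \in f & corner f k = V i.
Proof.
rewrite finset.inE => /andP[/eqP f3 _] k3.
have [i0 [i1 [i2 [fE _ fi]]]] := enum3 f3.
rewrite /corner fE; case: k k3 => [|[|[|//]]] _.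
- by exists i0; rewrite // fi !inE eqxx.
- by exists i1; rewrite // fi !inE eqxx ?orbT.
- by exists i2; rewrite // fi !inE eqxx ?orbT.
Qed.

Lemma Hdiv_affv v : in_Hdiv v -> pw_affv v.
Proof.
move=> [h _ _] t tT; have [a [b hv]] := h t tT.
move=> k; apply: (@affs_ext _ (fun x => a 0 k + b * x 0 k)).
  by move=> x; rewrite hv !mxE.
by apply: affsD; [exact: affs_cst|apply: affsZ; exact: affs_coord].
Qed.

Lemma face_tet f : f \in simplices T 3 ->
  tet_of f \in tets T /\ f \subset tet_of f.
Proof.
by rewrite finset.inE => /andP[_ /existsP[t /andP[tT ft]]]; exact: tet_ofP ft.
Qed.

Lemma dot_bgr_face t p x y : t \in tets T -> p \in t ->
  cell (t :\ p) x -> cell (t :\ p) y -> dot (grd t p) (x - y) = 0.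
Proof.
move=> tT pt xf yf; rewrite dot_bgrB.
have l0 z : cell (t :\ p) z -> lam t p z = 0.
  move=> zf; have [_ ->//] := hull_lam (t4 tT) (tind tT) (finset.subsetDl _ _) pt zf.
  by rewrite !finset.inE eqxx.
by rewrite !l0// subrr.
Qed.

(** The difference [x - y] is tangent to the face, so moving from [x] to [y] changes a
    Raviart-Thomas field only tangentially. *)
Lemma radial_trace t f (a : 'rV[R]_3) (b : R) x y : t \in tets T ->
  f \in simplices T 3 -> f \subset t -> cell f x -> cell f y ->
  dot (a + b *: x) (face_normal f) = dot (a + b *: y) (face_normal f).
Proof.
move=> tT f3 ft; have [p pt ->] := faceP tT f3 ft => xf yf.
have [_ ->] := nuP tT pt; rewrite !dotZr; congr (_ * _); apply/eqP.
rewrite -subr_eq0 -dotBl (_ : _ - _ = b *: (x - y)); last first.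
  by apply: row3P; rewrite !mxE; ring.
by rewrite dotZl dotC dot_bgr_face// mulr0.
Qed.

Lemma Hdiv_face_dof v t f i : in_Hdiv v -> t \in tets T ->
  f \in simplices T 3 -> f \subset t -> i \in f ->
  face_dof v f = flux_mass * dot (v t (V i)) (face_normal f).
Proof.
move=> hv tT f3 ft fi; have [h hn _] := hv; have [tT' ft'] := face_tet f3.
have [a [b hab]] := h _ tT'.
rewrite face_dofE; last exact: Hdiv_affv.
have tr k : (k < 3)%N ->
    dot (v (tet_of f) (corner f k)) (face_normal f) = dot (v t (V i)) (face_normal f).
  move=> k3; have [j jf ->] := corner_mem f3 k3.
  rewrite -(hn _ _ f (V i) tT' tT f3 ft' ft (hull_vertex V fi)) !hab.
  by apply: radial_trace tT' f3 ft' _ _; exact: hull_vertex.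
by rewrite !big_ord_recl big_ord0 addr0 addrA /= !tr// -!mulrDl.
Qed.

(* Normalised to have unit flux through [f]; no more than one term occurs. *)
Definition hat_div f : vfield := fun t x =>
  \sum_(p in t | t :\ p == f) - (flux_mass * nu t p)^-1 *: (x - V p).

(** On the face opposite to [q], the field [x - V p] with [p != q] is tangent, as [V p] lies on that
    face. For [p = q] its product with the gradient at [q] is -1, which the minus sign in [hat_div]
    compensates. *)
Lemma hat_div_trace t f g x : t \in tets T -> g \in simplices T 3 ->
  g \subset t -> cell g x ->
  dot (hat_div f t x) (face_normal g) = (f == g)%:R / flux_mass.
Proof.
move=> tT g3 gt; have [q qt ->] := faceP tT g3 gt => xg.
have [n0 nE] := nuP tT qt; have W0 := lt0r_neq0 flux_mass_gt0.
rewrite /hat_div dot_suml.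
have term p : p \in t -> dot (- (flux_mass * nu t p)^-1 *: (x - V p))
    (face_normal (t :\ q)) = (p == q)%:R / flux_mass.
  move=> pt; case: eqP => [->|/eqP pq].
    rewrite nE dotZl dotZr dotC dot_bgrB lam_vertex ?t4//; last exact: tind.
    have [_ ->] := hull_lam (t4 tT) (tind tT) (finset.subsetDl _ _) qt xg.
      by rewrite eqxx sub0r; field; rewrite n0 W0.
    by rewrite !finset.inE eqxx.
  rewrite nE dotZl dotZr dotC dot_bgr_face ?mulr0 ?mul0r//.
  by apply: hull_vertex; rewrite !finset.inE pq.
have [<-|fq] := eqVneq (t :\ q) f.
  rewrite (bigD1 q) ?qt ?eqxx//= term// eqxx big1 ?addr0//.
  by move=> p /andP[/andP[pt _] /negPf pq]; rewrite term// pq mul0r.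
rewrite mul0r big1// => p /andP[pt /eqP pf]; rewrite term//.
by case: eqP => [pq|_]; rewrite ?mul0r//; move: fq; rewrite -pq pf eqxx.
Qed.

Lemma hat_div_radial f t : exists a b, forall x, hat_div f t x = a + b *: x.
Proof.
exists (\sum_(p in t | t :\ p == f) (flux_mass * nu t p)^-1 *: V p).
exists (\sum_(p in t | t :\ p == f) - (flux_mass * nu t p)^-1) => x.
rewrite scaler_suml -big_split /=; apply: eq_bigr => p _.
by apply/rowP => k; rewrite !mxE; ring.
Qed.

Lemma interior_faceP f : f \in interior_faces T ->
  f \in simplices T 3 /\ ~ (cell f `<=` bdry Omega).
Proof. by rewrite finset.inE => /andP[? /asboolPn]. Qed.

Lemma in_Hdiv_hat f : f \in interior_faces T -> in_Hdiv (hat_div f).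
Proof.
move=> fi; split.
- by move=> t _; exact: hat_div_radial.
- by move=> t t' g x tT tT' g3 gt gt' xg; rewrite !hat_div_trace.
- move=> t g x tT g3 gt gb xg; rewrite hat_div_trace//.
  case: eqP => [fg|_]; last by rewrite mul0r.
  by have [_] := interior_faceP fi; rewrite fg.
Qed.

Lemma face_nonempty f : f \in simplices T 3 -> exists i, i \in f.
Proof. by rewrite finset.inE => /andP[/eqP f3 _]; apply/card_gt0P; rewrite f3. Qed.

Lemma face_dof_hat f g : f \in interior_faces T -> g \in simplices T 3 ->
  face_dof (hat_div f) g = (g == f)%:R.
Proof.
move=> fi g3; have [i ig] := face_nonempty g3; have [tT gt] := face_tet g3.
rewrite (Hdiv_face_dof (in_Hdiv_hat fi) tT g3 gt ig) hat_div_trace//.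
  by rewrite mulrCA mulfV ?lt0r_neq0 ?flux_mass_gt0// mulr1 eq_sym.
exact: hull_vertex.
Qed.

Lemma sum_hat_div (c : simplex -> R) t x :
  \sum_(f in interior_faces T) c f *: hat_div f t x =
  \sum_(p in t | t :\ p \in interior_faces T)
    c (t :\ p) *: (- (flux_mass * nu t p)^-1 *: (x - V p)).
Proof.
under eq_bigr do rewrite /hat_div scaler_sumr.
rewrite (exchange_big_dep (mem t)) /=; last by move=> f p _ /andP[].
rewrite [RHS]big_mkcondr /=; apply: eq_bigr => p pt.
case: ifPn => pi; last first.
  by apply: big_pred0 => f; case: eqP => [<-|_]; rewrite ?(negPf pi) ?andbF.
rewrite (big_pred1 (t :\ p))// => f /=; rewrite pt /= eq_sym.
by case: eqP => [->|_]; rewrite ?pi ?andbF.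
Qed.

(** Vanishing of the coordinate at [q p] means that the gradient at [p] times [q p] is
    [- (bary V t).1 p], so each trace is independent of the point chosen. The formula then follows
    from the summation identities of [is_bary]. *)
Lemma radial_expand t (a : 'rV[R]_3) (b : R) (q : 'I_(nvert T) -> 'rV[R]_3) x :
  t \in tets T -> (forall p, p \in t -> lam t p (q p) = 0) ->
  a + b *: x = \sum_(p in t) - dot (a + b *: q p) (grd t p) *: (x - V p).
Proof.
move=> tT hq; have t4' := t4 tT; have ti' := tind tT.
transitivity (\sum_(p in t) (dot (grd t p) a *: V p - dot (grd t p) a *: x +
    (bary V t).1 p *: (b *: x) - b *: ((bary V t).1 p *: V p))).
  rewrite sumrB !big_split /= sum_dot_bgr// -scaler_suml sum_bary1// -scaler_sumr.
  rewrite sum_bary_pt// sumrN -scaler_suml -dot_suml sum_bgr// dot0l.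
  by rewrite scale0r !subr0 scaler0 scale1r subr0.
apply: eq_bigr => p pt; have := hq p pt; rewrite /bcoord => hp.
rewrite dotDl dotZl (dotC (q p)) (dotC a).
have -> : dot (grd t p) (q p) = - (bary V t).1 p by lra.
by apply/rowP => k; rewrite !mxE; ring.
Qed.

Definition opp_vertex t p : 'I_(nvert T) := odflt p [pick i in t :\ p].

Lemma opp_vertexP t p : t \in tets T -> p \in t -> opp_vertex t p \in t :\ p.
Proof.
move=> tT pt; rewrite /opp_vertex; case: pickP => [i|h] //.
have /card_gt0P[i] : (0 < #|t :\ p|)%N by rewrite (card_face tT pt).
by move=> it; have := h i; rewrite /= it.
Qed.

Lemma lam_opp t p i : t \in tets T -> p \in t -> i \in t :\ p -> lam t p (V i) = 0.
Proof.
move=> tT pt; rewrite !finset.inE => /andP[ip it].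
by rewrite (lam_vertex (t4 tT) (tind tT))// eq_sym (negPf ip).
Qed.

Lemma Hdiv_local v t p i : in_Hdiv v -> t \in tets T -> p \in t -> i \in t :\ p ->
  (if t :\ p \in interior_faces T then face_dof v (t :\ p) else 0) /
    (flux_mass * nu t p) = dot (v t (V i)) (grd t p).
Proof.
move=> hv tT pt ip; have f3 := face_simplex tT pt.
have ft : t :\ p \subset t := finset.subsetDl _ _.
have [n0 nE] := nuP tT pt; have W0 := lt0r_neq0 flux_mass_gt0.
case: ifPn => fi.
  rewrite (Hdiv_face_dof hv tT f3 ft ip) nE dotZr; field; by rewrite n0 W0.
have [_ _ hb] := hv; rewrite mul0r; apply/esym.
have : dot (v t (V i)) (face_normal (t :\ p)) = 0.
  apply: hb => //; last exact: hull_vertex.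
  by move: fi; rewrite finset.inE f3 /= negbK => /asboolP.
by rewrite nE dotZr => /eqP; rewrite mulf_eq0 (negPf n0) => /eqP.
Qed.

Lemma Hdiv_expand v t x : in_Hdiv v -> t \in tets T ->
  v t x = \sum_(f in interior_faces T) face_dof v f *: hat_div f t x.
Proof.
move=> hv tT; have [h _ _] := hv; have [a [b hab]] := h t tT.
rewrite sum_hat_div hab (@radial_expand t a b (fun p => V (opp_vertex t p)) x tT).
  rewrite [RHS]big_mkcondr; apply: eq_bigr => p pt /=.
  rewrite -hab -(Hdiv_local hv tT pt (opp_vertexP tT pt)).
  case: ifPn => _; last by rewrite mul0r oppr0 scale0r.
  by rewrite scalerA mulrN.
by move=> p pt; apply: lam_opp => //; exact: opp_vertexP.
Qed.

Lemma Hdiv_basisP f : f \in interior_faces T ->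
  in_Hdiv (Hdiv_basis (T := T) f) /\ mesh_eq (Hdiv_basis f) (hat_div f).
Proof.
move=> fi; have [|hb hd] := @xgetPex _ (fun _ _ => 0 : 'rV[R]_3) [set v : vfield |
    in_Hdiv v /\ forall g, g \in interior_faces T -> face_dof v g = (g == f)%:R].
  exists (hat_div f); split; first exact: in_Hdiv_hat.
  by move=> g /interior_faceP[g3 _]; exact: face_dof_hat.
rewrite -/(Hdiv_basis f) in hb hd; split => // t x tT.
rewrite (Hdiv_expand x hb tT) (bigD1 f)//= hd// eqxx scale1r big1 ?addr0//.
by move=> g /andP[gi /negPf gf]; rewrite hd// gf scale0r.
Qed.

Lemma in_Hdiv_comb (I : finType) (c : I -> R) (F : I -> vfield) :
  (forall i, in_Hdiv (F i)) -> in_Hdiv (comb c F).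
Proof.
move=> h; split.
- move=> t tT; have ex i : exists a, exists b, forall x, F i t x = a + b *: x.
    by have [ha _ _] := h i; exact: ha.
  have /choice[a /choice[b hab]] := ex.
  exists (\sum_i c i *: a i), (\sum_i c i * b i) => x.
  rewrite /comb scaler_suml -big_split /=; apply: eq_bigr => i _.
  by rewrite hab scalerDr scalerA.
- move=> t t' f x tT tT' f3 ft ft' xf; rewrite !dot_suml; apply: eq_bigr => i _.
  by rewrite !dotZl; congr (_ * _); have [_ hn _] := h i; exact: hn.
- move=> t f x tT f3 ft fb xf; rewrite dot_suml big1// => i _.
  by rewrite dotZl; have [_ _ ->] := h i; rewrite ?mulr0.
Qed.

End VertexAndFaceElements.

(** * Interpolation into the face elements and nodal coordinates *)

Section Interpolation.
Context {R : realType} {Omega : set 'rV[R]_3}.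
Variable T : triangulation Omega.
Local Notation V := (@vertex R Omega T).
Local Notation cell t := (hull (@vertex R Omega T) t).
Local Notation simplex := {set 'I_(nvert T)}.
Local Notation sfield := (sfield T).
Local Notation vfield := (vfield T).
Local Notation lam := (bcoord V).
Local Notation grd := (bgr V).
Local Notation w_ := (@flux_weight R).
Implicit Types (u v w psi : vfield) (p : 'I_(nvert T)) (t f e : simplex).

Let t4 t (tT : t \in tets T) : #|t| = 4%N := tri_card tT.
Let tind t (tT : t \in tets T) : affinely_independent V t :=
  @tri_nondegenerate _ _ T _ tT.

Lemma Hgrad3_affv psi : in_Hgrad3 psi -> pw_affv psi.
Proof. by move=> h t tT k; have [ha _ _] := h k; exact: ha. Qed.

Lemma Hgrad3_vertex psi t t' i : in_Hgrad3 psi -> t \in tets T -> t' \in tets T ->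
  i \in t -> i \in t' -> psi t (V i) = psi t' (V i).
Proof.
move=> h tT tT' it it'; apply/rowP => k; have [_ hc _] := h k.
by apply: hc => //; exact: hull_vertex.
Qed.

(** The coefficient that replaces the trace in [radial_expand] for the interpolant: the flux
    weights, divided by their sum, average the products of the values of [psi] at the corners with
    the gradient. *)
Definition face_mean psi t p : R :=
  \sum_(k < 3) w_ k / flux_mass * dot (psi t (corner (t :\ p) k)) (grd t p).

Lemma Pi_div_local psi t x : in_Hgrad3 psi -> t \in tets T ->
  Pi_div psi t x = \sum_(p in t) - face_mean psi t p *: (x - V p).
Proof.
move=> hpsi tT; rewrite /Pi_div.
have -> : \sum_(f in interior_faces T) face_dof psi f *: Hdiv_basis f t x =
    \sum_(f in interior_faces T) face_dof psi f *: hat_div f t x.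
  by apply: eq_bigr => f fi; have [_ ->] := Hdiv_basisP fi.
rewrite sum_hat_div big_mkcondr; apply: eq_bigr => p pt.
have f3 := face_simplex tT pt; have ft : t :\ p \subset t := finset.subsetDl _ _.
have [n0 nE] := nuP tT pt; have W0 := lt0r_neq0 (@flux_mass_gt0 R).
case: ifPn => fi.
  have [tT' ft'] := face_tet f3.
  rewrite face_dofE; last exact: Hgrad3_affv.
  rewrite scalerA mulrN; congr (- _ *: _); rewrite mulr_suml.
  apply: eq_bigr => k _; have [j jf ->] := corner_mem f3 (ltn_ord k).
  rewrite (Hgrad3_vertex hpsi tT' tT (fintype.subsetP ft' _ jf) (fintype.subsetP ft _ jf)).
  by rewrite nE dotZr; field; rewrite n0 W0.
(* A boundary face carries no degree of freedom; its mean vanishes because [psi] is zero at its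
   vertices. *)
rewrite (_ : face_mean psi t p = 0) ?oppr0 ?scale0r//.
apply: big1 => k _; have [j jf ->] := corner_mem f3 (ltn_ord k).
rewrite (_ : psi t (V j) = 0) ?dot0l ?mulr0//; apply/rowP => l.
rewrite mxE; have [_ _ hb] := hpsi l; apply: hb => //.
  exact: (hull_subset ft (hull_vertex V jf)).
move: fi; rewrite finset.inE f3 /= negbK => /asboolP; apply.
exact: hull_vertex.
Qed.

Definition grad3_coord psi : 'rV[R]_#|grad3_nodes T| :=
  \row_j vertex_dof (component psi (enum_val j).2) (enum_val j).1.

Lemma Hgrad3_basis_in ik : ik \in grad3_nodes T -> in_Hgrad3 (Hgrad3_basis (T := T) ik).
Proof.
rewrite finset.inE => /Hgrad_basisP[[ha hc hb] _] k.
have cE t x : component (Hgrad3_basis ik) k t x = Hgrad_basis ik.1 t x * (ik.2 == k)%:R.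
  by rewrite /component /Hgrad3_basis !mxE eqxx /= eq_sym.
split.
- move=> t tT; apply: affs_ext (affsZ (ik.2 == k)%:R (ha t tT)) => x.
  by rewrite cE mulrC.
- by move=> t t' x tT tT' xt xt'; rewrite !cE (hc t t').
- by move=> t x tT xt xb; rewrite cE (hb t) ?mul0r.
Qed.

Lemma Hgrad3_expand psi : in_Hgrad3 psi ->
  mesh_eq psi (nodal_field (grad3_nodes T) (@Hgrad3_basis _ _ T) (grad3_coord psi)).
Proof.
move=> hpsi t x tT; rewrite /nodal_field /comb.
under eq_bigr do rewrite mxE.
rewrite -(big_enum_val (fun ik => vertex_dof (component psi ik.2) ik.1 *:
   Hgrad3_basis ik t x)) /=.
transitivity (\sum_(i in interior_vertices T) \sum_(k : 'I_3)
    (vertex_dof (component psi k) i * hat_grad i t x) *: (delta_mx 0 k : 'rV[R]_3)).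
  apply/rowP => k; rewrite summxE -[LHS]/(component psi k t x).
  rewrite (Hgrad_expand x (hpsi k) tT); apply: eq_bigr => i _.
  rewrite summxE (bigD1 k)//= !mxE !eqxx mulr1 big1 ?addr0// => l /negPf lk.
  by rewrite !mxE eq_sym lk andbF mulr0.
rewrite pair_big_dep; apply: eq_big => [[i k]|[i k] /andP[ii _]] /=.
  by rewrite [RHS]finset.inE andbT.
by rewrite /Hgrad3_basis /= scalerA; have [_ ->] := Hgrad_basisP ii.
Qed.

Lemma face_dof_comb f (I : finType) (c : I -> R) (F : I -> vfield) :
  f \in simplices T 3 -> (forall i, pw_affv (F i)) ->
  face_dof (comb c F) f = \sum_i c i * face_dof (F i) f.
Proof.
move=> f3 hF; have [tT _] := face_tet f3.
rewrite face_dofE; last exact: pw_affv_comb.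
have e i : c i * face_dof (F i) f = \sum_(k < 3)
    c i * (w_ k * dot (F i (tet_of f) (corner f k)) (face_normal f)).
  by rewrite face_dofE ?mulr_sumr//; exact: hF.
under [RHS]eq_bigr do rewrite e.
rewrite exchange_big; apply: eq_bigr => k _.
rewrite dot_suml mulr_sumr; apply: eq_bigr => i _; rewrite dotZl; ring.
Qed.

Lemma face_dof_eq f u v : f \in simplices T 3 -> mesh_eq u v ->
  face_dof u f = face_dof v f.
Proof.
by move=> /face_tet[tT _] /mesh_eqE uv; rewrite /face_dof uv.
Qed.

Lemma face_dof_nodal (y : 'rV[R]_#|interior_faces T|) j :
  face_dof (nodal_field (interior_faces T) (@Hdiv_basis _ _ T) y) (enum_val j) = y 0 j.
Proof.
have [f3 _] := interior_faceP (enum_valP j).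
rewrite face_dof_comb//; last by move=> i; exact/Hdiv_affv/(Hdiv_basisP (enum_valP i)).1.
rewrite (bigD1 j)//= big1 ?addr0 => [|i /negPf ij].
  have [_ e] := Hdiv_basisP (enum_valP j).
  by rewrite (face_dof_eq f3 e) face_dof_hat ?enum_valP// eqxx mulr1.
have [_ e] := Hdiv_basisP (enum_valP i).
rewrite (face_dof_eq f3 e) face_dof_hat ?enum_valP//.
by rewrite (inj_eq enum_val_inj) eq_sym ij mulr0.
Qed.

Lemma Hdiv_nodal_expand v : in_Hdiv v ->
  mesh_eq v (nodal_field (interior_faces T) (@Hdiv_basis _ _ T) (\row_j face_dof v (enum_val j))).
Proof.
move=> hv t x tT; rewrite /nodal_field /comb (Hdiv_expand x hv tT).
under [RHS]eq_bigr do rewrite mxE.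
rewrite -(big_enum_val (fun f => face_dof v f *: Hdiv_basis f t x)) /=.
by apply: eq_bigr => f fi; have [_ ->] := Hdiv_basisP fi.
Qed.

End Interpolation.

(** Ordered pairs of distinct vertices are grouped by their edge, with the orientation fixed by
    [enum]. It turns the double sum in the expansion of an edge element field into a sum of Whitney
    functions. *)
Lemma sum_pairs_edges (V : nmodType) (n : nat) (t : {set 'I_n}) (h : 'I_n -> 'I_n -> V) :
  (forall i, h i i = 0) ->
  \sum_(i in t) \sum_(j in t) h i j =
  \sum_(e : {set 'I_n} | (#|e| == 2%N) && (e \subset t))
    (if enum e is [:: a; b] then h a b + h b a else 0).
Proof.
move=> h0; rewrite pair_big /=.
rewrite (bigID (fun ij => ij.1 == ij.2)) /= big1 ?add0r; last first.
  by move=> [i j] /andP[_ /eqP /= ->].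
rewrite (partition_big (fun ij => [set ij.1; ij.2]%SET)
    (fun e : {set 'I_n} => (#|e| == 2%N) && (e \subset t))) /=; last first.
  move=> [i j] /= /andP[/andP[it jt] ij].
  by rewrite finset.cards2 ij eqxx finset.subUset !finset.sub1set it.
apply: eq_bigr => e /andP[e2 et].
move: e2 (enum_uniq e) (fun i => mem_enum e i); rewrite cardE.
case: (enum e) => [|a [|b []]]//= _; rewrite inE andbT => ab eE.
have ae : a \in e by rewrite -eE inE eqxx.
have be : b \in e by rewrite -eE !inE eqxx orbT.
have e2 : e = [set a; b]%SET by apply/setP => i; rewrite -eE !finset.inE.
have at_ := fintype.subsetP et a ae; have bt := fintype.subsetP et b be.
rewrite (bigD1 (a, b)) /=; last by rewrite at_ bt ab e2 eqxx.
rewrite (bigD1 (b, a)) /=; last first.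
  by rewrite at_ bt eq_sym ab e2 finset.setUC eqxx xpair_eqE negb_and eq_sym ab.
rewrite big1 ?addr0// => -[i j] /= /andP[/andP[/andP[/andP[_ ij] /eqP eij] nab] nba].
have : i \in e by rewrite -eij !finset.inE eqxx.
have : j \in e by rewrite -eij !finset.inE eqxx orbT.
rewrite -!eE !inE => /orP[]/eqP ja /orP[]/eqP ia; move: ij nab nba;
  by rewrite ia ja !xpair_eqE !eqxx.
Qed.

(** * Edge elements and their curls *)

Section Nedelec.
Context {R : realType} {Omega : set 'rV[R]_3}.
Variable T : triangulation Omega.
Local Notation V := (@vertex R Omega T).
Local Notation cell t := (hull (@vertex R Omega T) t).
Local Notation simplex := {set 'I_(nvert T)}.
Local Notation vfield := (vfield T).
Local Notation lam := (bcoord V).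
Local Notation grd := (bgr V).
Implicit Types (u v w psi : vfield) (p : 'I_(nvert T)) (t f e : simplex).

Let t4 t (tT : t \in tets T) : #|t| = 4%N := tri_card tT.
Let tind t (tT : t \in tets T) : affinely_independent V t :=
  @tri_nondegenerate _ _ T _ tT.

Lemma edgeP e : #|e| = 2%N ->
  exists a b, [/\ enum e = [:: a; b], a != b, a \in e & b \in e].
Proof.
move=> e2; have := enum_uniq e; have eE := mem_enum e.
move: e2 eE; rewrite cardE; case: (enum e) => [|a [|b []]]//= _ eE.
rewrite inE andbT => ab; exists a, b.
by rewrite -!eE !inE !eqxx orbT.
Qed.

Definition whitney t (a b : 'I_(nvert T)) (x : 'rV[R]_3) : 'rV[R]_3 :=
  lam t a x *: grd t b - lam t b x *: grd t a.

Definition hat_curl e : vfield := fun t x =>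
  if e \subset t then
    (if enum e is [:: a; b] then whitney t a b x else 0) else 0.

Lemma whitney_rotation t a b : exists c d, forall x,
  whitney t a b x = c + cross d x.
Proof.
exists ((bary V t).1 a *: grd t b - (bary V t).1 b *: grd t a).
exists (cross (grd t a) (grd t b)) => x.
rewrite /whitney /bcoord cross_cross.
by apply: row3P; rewrite !mxE; ring.
Qed.

Lemma hat_curl_rotation e t : exists c d, forall x,
  hat_curl e t x = c + cross d x.
Proof.
have z : exists c d : 'rV[R]_3, forall x : 'rV[R]_3, 0 = c + cross d x :> 'rV[R]_3.
  exists 0, 0 => x; apply: row3P; rewrite !(crossE, mxE); ring.
rewrite /hat_curl; case: (e \subset t) => //; case: (enum e) => [|a [|b []]]//.
exact: whitney_rotation.
Qed.

Lemma rotation_affv (w : 'rV[R]_3 -> 'rV[R]_3) :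
  (exists c d, forall x, w x = c + cross d x) -> affv w.
Proof.
move=> [c [d h]] k; apply: (@affs_ext _ (fun x => c 0 k +
    (d 0 (k + 1) * x 0 (k + 2) + - d 0 (k + 2) * x 0 (k + 1)))).
  by move=> x; rewrite h !mxE mulNr.
apply: affsD; first exact: affs_cst.
by apply: affsD; apply: affsZ; exact: affs_coord.
Qed.

Lemma Hcurl_affv w : in_Hcurl w -> pw_affv w.
Proof. by move=> [h _ _] t tT; exact/rotation_affv/h. Qed.

(* That [g] does not depend on [t] is the tangential continuity. *)
Lemma hat_curl_trace e s x : #|e| = 2%N -> cell s x ->
  exists g : 'I_(nvert T) -> 'I_(nvert T) -> R,
    (~~ (e \subset s) -> forall i j, g i j = 0) /\
    forall t i j, t \in tets T -> s \subset t -> i \in s -> j \in s ->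
      dot (hat_curl e t x) (V j - V i) = g i j.
Proof.
move=> e2 [c [_ c1 xE]]; have [a [b [eE ab ae be]]] := edgeP e2.
pose cc i := if i \in s then c i else 0.
have e_sub (s' : simplex) : (e \subset s') = (a \in s') && (b \in s').
  apply/idP/andP => [es|[sa sb]]; first by rewrite !(fintype.subsetP es).
  apply/fintype.subsetP => i.
  by rewrite -(mem_enum e) eE !inE => /orP[]/eqP ->.
exists (fun i j => if e \subset s then
  cc a * ((b == j)%:R - (b == i)%:R) - cc b * ((a == j)%:R - (a == i)%:R) else 0).
split => [/negPf ->//|t i j tT st si sj].
rewrite /hat_curl; case: ifPn => et; last first.
  rewrite dot0l; case: ifPn => // es; case/negP: et; exact: fintype.subset_trans st.
rewrite eE /whitney; have := et; rewrite e_sub => /andP[ta tb].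
have ti := fintype.subsetP st i si; have tj := fintype.subsetP st j sj.
have lamE k : k \in t -> lam t k x = cc k.
  by move=> tk; rewrite xE (lam_comb (t4 tT) (tind tT)).
rewrite dotBl !dotZl !dot_bgrB !lam_vertex ?t4//; try exact: tind.
rewrite !lamE//; case: ifPn => // es.
have eqs k l : k \notin s -> l \in s -> (k == l) = false.
  by move=> ks ls; apply/negP => /eqP kl; rewrite kl ls in ks.
move: es; rewrite e_sub negb_and => /orP[ks|ks].
  have -> : cc a = 0 by rewrite /cc (negPf ks).
  by rewrite (eqs a j ks sj) (eqs a i ks si) subrr mulr0 mul0r subrr.
have -> : cc b = 0 by rewrite /cc (negPf ks).
by rewrite (eqs b j ks sj) (eqs b i ks si) subrr mulr0 mul0r subrr.
Qed.

Lemma interior_edgeP e : e \in interior_edges T ->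
  [/\ e \in simplices T 2, #|e| = 2%N & ~ (cell e `<=` bdry Omega)].
Proof.
by rewrite finset.inE => /andP[e2 /asboolPn ?]; split => //;
  move: e2; rewrite finset.inE => /andP[/eqP].
Qed.

Lemma in_Hcurl_hat e : e \in interior_edges T -> in_Hcurl (hat_curl e).
Proof.
move=> /interior_edgeP[_ e2 eb]; split.
- by move=> t _; exact: hat_curl_rotation.
- move=> t t' s x i j tT tT' st st' xs si sj.
  have [g [_ hg]] := hat_curl_trace e2 xs.
  by rewrite (hg t)// (hg t').
- move=> t s x i j tT st sb xs si sj.
  have [g [g0 hg]] := hat_curl_trace e2 xs; rewrite (hg t)// g0//.
  by apply: contra_notN eb => es y /(hull_subset es); exact: sb.
Qed.

Lemma edge_tet e : e \in simplices T 2 ->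
  tet_of e \in tets T /\ e \subset tet_of e.
Proof.
by rewrite finset.inE => /andP[_ /existsP[t /andP[tT ft]]]; exact: tet_ofP ft.
Qed.

(** The tangential component is constant along the edge: a rotation about any axis moves a point
    orthogonally to its displacement. The circulation is therefore the value at the first
    endpoint. *)
Lemma edge_dofE w e t a b : in_Hcurl w -> e \in simplices T 2 ->
  enum e = [:: a; b] -> t \in tets T -> e \subset t ->
  edge_dof w e = dot (w t (V a)) (V b - V a).
Proof.
move=> [ha hc _] es eE tT et; have [tT' et'] := edge_tet es.
have ae : a \in e by rewrite -(mem_enum e) eE !inE eqxx.
have be : b \in e by rewrite -(mem_enum e) eE !inE eqxx orbT.
rewrite -(hc _ _ e (V a) a b tT' tT et' et (hull_vertex V ae) ae be).
have [c [d h]] := ha _ tT'.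
rewrite /edge_dof /segment_circulation /corner eE /=.
under eq_Rintegral => s _.
  rewrite h crossDr crossZr addrA dotDl dotZl dot_crossl mulr0 addr0 -h; over.
rewrite Rintegral_cst//= -[RHS]mulr1; congr (_ * _).
by rewrite -[RHS]/(fine (1 : R)%:E) -[in RHS](subr0 1) -lebesgue_measure_cc.
Qed.

Lemma edge_dof_hat e e' : e \in interior_edges T -> e' \in simplices T 2 ->
  edge_dof (hat_curl e) e' = (e' == e)%:R.
Proof.
move=> ei es'; have [es e2 _] := interior_edgeP ei.
have e2' : #|e'| = 2%N by move: es'; rewrite finset.inE => /andP[/eqP].
have [a [b [eE ab ae be]]] := edgeP e2'.
have [tT et] := edge_tet es'.
have ta := fintype.subsetP et a ae; have tb := fintype.subsetP et b be.
rewrite (edge_dofE (in_Hcurl_hat ei) es' eE tT et).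
case: eqP => [<-|ee].
  rewrite /hat_curl et eE /whitney dotBl !dotZl !dot_bgrB !lam_vertex ?t4//; try exact: tind.
  by rewrite !eqxx eq_sym (negPf ab) subr0 mul0r mulr1 subr0.
have [g [g0 hg]] := hat_curl_trace e2 (hull_vertex V ae).
rewrite (hg _ a b tT et ae be) g0//; apply/negP => ee'.
by apply: ee; apply/esym/eqP; rewrite eqEcard ee' e2 e2'.
Qed.

(** Writing w(x) as the sum of the coordinates times w(V i), and each w(V i) as the sum over j of
    [c i j] times the gradient at j, gives a double sum. The matrix [c] is antisymmetric because
    [w t] is a constant plus a rotation, so the terms (i, j) and (j, i) combine into [c i j] times a
    Whitney function. *)
Lemma Hcurl_expand w t x : in_Hcurl w -> t \in tets T ->
  w t x = \sum_(e in interior_edges T) edge_dof w e *: hat_curl e t x.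
Proof.
move=> hw tT; have [ha hc hb] := hw.
pose c i j := dot (w t (V i)) (V j - V i).
have anti i j : i \in t -> j \in t -> c j i = - c i j.
  move=> ti tj; rewrite /c -dotNr opprB; have [d [b h]] := ha t tT.
  apply/eqP; rewrite -subr_eq0 -dotBl !h.
  have -> : d + cross b (V j) - (d + cross b (V i)) = cross b (V j - V i).
    by apply: row3P; rewrite !(crossE, mxE); ring.
  by rewrite -(opprB (V j)) dotNr dot_crossl oppr0.
rewrite (affv_bary x (t4 tT) (tind tT) (Hcurl_affv hw tT)).
transitivity (\sum_(i in t) \sum_(j in t) (c i j * lam t i x) *: grd t j).
  apply: eq_bigr => i ti; under eq_bigr do rewrite mulrC -scalerA.
  rewrite -scaler_sumr; congr (_ *: _); rewrite /c.
  under eq_bigr do rewrite dotBr scalerBl.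
  rewrite sumrB (sum_dot_bgr_dual (t4 tT) (tind tT)) -scaler_sumr.
  by rewrite (sum_bgr (t4 tT) (tind tT)) scaler0 subr0.
rewrite sum_pairs_edges; last first.
  by move=> i; rewrite /c subrr dot0r mul0r scale0r.
rewrite [RHS](bigID (fun e => e \subset t)) /= [X in _ = _ + X]big1 ?addr0; last first.
  by move=> e /andP[_ /negPf et]; rewrite /hat_curl et scaler0.
rewrite [RHS]big_mkcond [LHS]big_mkcond; apply: eq_bigr => e _.
case: ifPn => [/andP[/eqP e2 et]|ne]; last first.
  case: ifPn => // /andP[/interior_edgeP[_ e2 _] et]; move: ne.
  by rewrite e2 et eqxx.
have [a [b [eE ab ae be]]] := edgeP e2; rewrite eE et andbT.
have es : e \in simplices T 2.
  by rewrite finset.inE e2 eqxx /=; apply/existsP; exists t; rewrite tT.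
have ta := fintype.subsetP et a ae; have tb := fintype.subsetP et b be.
rewrite (anti a b)// /hat_curl et eE /whitney.
case: ifPn => ei.
  rewrite (edge_dofE hw es eE tT et) -/(c a b).
  by apply/rowP => k; rewrite !mxE; ring.
rewrite (_ : c a b = 0); first by rewrite oppr0 !mul0r !scale0r addr0.
rewrite /c; apply: (hb t e) => //; last exact: hull_vertex.
by move: ei; rewrite finset.inE es /= negbK => /asboolP.
Qed.

Lemma Hcurl_basisP e : e \in interior_edges T ->
  in_Hcurl (Hcurl_basis (T := T) e) /\ mesh_eq (Hcurl_basis e) (hat_curl e).
Proof.
move=> ei; have [|hb hd] := @xgetPex _ (fun _ _ => 0 : 'rV[R]_3) [set w : vfield |
    in_Hcurl w /\ forall g, g \in interior_edges T -> edge_dof w g = (g == e)%:R].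
  exists (hat_curl e); split; first exact: in_Hcurl_hat.
  by move=> g /interior_edgeP[gs _ _]; exact: edge_dof_hat.
rewrite -/(Hcurl_basis e) in hb hd; split => // t x tT.
rewrite (Hcurl_expand x hb tT) (bigD1 e)//= hd// eqxx scale1r big1 ?addr0//.
by move=> g /andP[gi /negPf gf]; rewrite hd// gf scale0r.
Qed.

Lemma Hcurl_nodal_expand w : in_Hcurl w ->
  mesh_eq w (nodal_field (interior_edges T) (@Hcurl_basis _ _ T)
    (\row_j edge_dof w (enum_val j))).
Proof.
move=> hw t x tT; rewrite /nodal_field /comb (Hcurl_expand x hw tT).
under [RHS]eq_bigr do rewrite mxE.
rewrite -(big_enum_val (fun f => edge_dof w f *: Hcurl_basis f t x)) /=.
by apply: eq_bigr => f fi; have [_ ->] := Hcurl_basisP fi.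
Qed.

Lemma in_Hcurl_comb (I : finType) (c : I -> R) (F : I -> vfield) :
  (forall i, in_Hcurl (F i)) -> in_Hcurl (comb c F).
Proof.
move=> h; split.
- move=> t tT; have ex i : exists a, exists b, forall x, F i t x = a + cross b x.
    by have [ha _ _] := h i; exact: ha.
  have /choice[a /choice[b hab]] := ex.
  exists (\sum_i c i *: a i), (\sum_i c i *: b i) => x.
  have crossl (u v : 'rV[R]_3) : cross u v = - cross v u by exact: crossC.
  rewrite (crossl (\sum_i _)) (_ : cross x _ = \sum_i c i *: cross x (b i)).
    rewrite /comb -sumrN -big_split /=; apply: eq_bigr => i _.
    by rewrite hab scalerDr (crossl x) scalerN opprK.
  elim/big_rec2 : _ => [|i y z _ <-]; first by apply: row3P; rewrite !(crossE, mxE); ring.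
  by rewrite crossDr crossZr.
- move=> t t' s x i j tT tT' st st' xs si sj; rewrite !dot_suml; apply: eq_bigr => k _.
  by rewrite !dotZl; congr (_ * _); have [_ hn _] := h k; exact: (hn t t' s).
- move=> t s x i j tT st sb xs si sj; rewrite dot_suml big1// => k _.
  by rewrite dotZl; have [_ _ hb] := h k; rewrite (hb t s) ?mulr0.
Qed.

(** On each tetrahedron the curl is a constant 2 d, and d times the face normal is a difference of
    tangential components of [w] at two corners of that face. Continuity and boundary values of the
    normal trace thus follow from those of the tangential trace. *)
Lemma curl_Hdiv w : in_Hcurl w ->
  in_Hdiv (bcurl w) /\ forall t x, t \in tets T -> bdiv (bcurl w) t x = 0.
Proof.
move=> hw; have [ha hc hb] := hw.
have cst t : t \in tets T -> exists d : 'rV[R]_3,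
    (forall x, bcurl w t x = 2 *: d) /\
    forall f, f \in simplices T 3 -> f \subset t -> exists i0 i1 i2,
      [/\ i0 \in f, i1 \in f, i2 \in f &
      dot (w t (V i1)) (V i2 - V i0) - dot (w t (V i0)) (V i2 - V i0) =
      dot d (face_normal f)] /\ enum f = [:: i0; i1; i2].
  move=> tT; have [c [d h]] := ha t tT; exists d; split.
    by move=> x; exact: curl_rotation h.
  move=> f; rewrite finset.inE => /andP[/eqP /enum3[i0 [i1 [i2 [fE _ fi]]]] _] ft.
  exists i0, i1, i2; split => //; split; rewrite ?fi ?inE ?eqxx ?orbT//.
  rewrite /face_normal /corner fE /= -dotBl !h -dot_cross_rot.
  congr (dot _ _); rewrite opprD addrACA subrr add0r crossDr.
  by congr (_ + _); apply: row3P; rewrite !(crossE, mxE); ring.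
split; [split|].
- move=> t tT; have [d [hd _]] := cst t tT.
  by exists (2 *: d), 0 => x; rewrite scale0r addr0.
- move=> t t' f x tT tT' f3 ft ft' xf.
  have [d [hd hf]] := cst t tT; have [d' [hd' hf']] := cst t' tT'.
  have [i0 [i1 [i2 [[h0 h1 h2 e] fE]]]] := hf f f3 ft.
  have [j0 [j1 [j2 [[_ _ _ e'] fE']]]] := hf' f f3 ft'.
  move: fE'; rewrite fE => -[E0 E1 E2]; subst j0 j1 j2.
  rewrite hd hd' !dotZl -e -e'; congr (_ * (_ - _));
    by apply: (hc _ _ f) => //; exact: hull_vertex.
- move=> t f x tT f3 ft fb xf; have [d [hd hf]] := cst t tT.
  have [i0 [i1 [i2 [[h0 h1 h2 e] fE]]]] := hf f f3 ft.
  rewrite hd dotZl -e !(hb t f) ?subrr ?mulr0//; exact: hull_vertex.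
- move=> t x tT; have [d [hd _]] := cst t tT.
  by rewrite /bdiv (@div_radial _ _ (2 *: d) 0) ?mulr0// => y; rewrite hd scale0r addr0.
Qed.

End Nedelec.

(** * Stability estimates *)

Section Inequalities.
Context {R : realType}.

Lemma sqr_sum_le (I : finType) (S : {set I}) (a : I -> R) :
  (\sum_(i in S) a i) ^+ 2 <= #|S|%:R * \sum_(i in S) a i ^+ 2.
Proof.
rewrite -subr_ge0 -(@pmulr_rge0 _ 2)//.
rewrite (_ : 2 * _ = \sum_(i in S) \sum_(j in S) (a i - a j) ^+ 2).
  by apply: sumr_ge0 => i _; apply: sumr_ge0 => j _; exact: sqr_ge0.
have e i : \sum_(j in S) (a i - a j) ^+ 2 =
    #|S|%:R * a i ^+ 2 - 2 * a i * (\sum_(j in S) a j) + \sum_(j in S) a j ^+ 2.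
  have e2 j : (a i - a j) ^+ 2 = a i ^+ 2 - 2 * a i * a j + a j ^+ 2 by ring.
  under eq_bigr do rewrite e2.
  by rewrite big_split /= sumrB sumr_const -mulr_sumr -[_ *+ #|S|]mulr_natl.
under [RHS]eq_bigr do rewrite e.
rewrite big_split /= sumrB -mulr_sumr -mulr_suml -mulr_sumr sumr_const.
by rewrite -[_ *+ #|S|]mulr_natl; ring.
Qed.

Lemma convex_sqr_le (I : finType) (th a : I -> R) (M : R) :
  (forall i, 0 <= th i) -> \sum_i th i = 1 -> (forall i, a i ^+ 2 <= M) ->
  (\sum_i th i * a i) ^+ 2 <= M.
Proof.
move=> th0 th1 aM; case: (pickP I) => [i0 _|I0]; last first.
  by move/eqP: th1; rewrite big_pred0// eq_sym oner_eq0.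
have M0 : 0 <= M := le_trans (sqr_ge0 _) (aM i0).
rewrite -(sqr_sqrtr M0); apply: sqr_le_norm.
rewrite [leRHS]ger0_norm ?sqrtr_ge0//.
rewrite (le_trans (ler_norm_sum _ _ _))// -[leRHS]mul1r -th1 mulr_suml.
apply: ler_sum => i _; rewrite normrM (ger0_norm (th0 i)) ler_wpM2l//.
by rewrite -(sqrtr_sqr (a i)) ler_wsqrtr.
Qed.

End Inequalities.

Section Estimates.
Context {R : realType} {Omega : set 'rV[R]_3}.
Variables (T : triangulation Omega) (sigma : R).
Local Notation V := (@vertex R Omega T).
Local Notation cell t := (hull (@vertex R Omega T) t).
Local Notation simplex := {set 'I_(nvert T)}.
Local Notation vfield := (vfield T).
Local Notation lam := (bcoord V).
Local Notation grd := (bgr V).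
Local Notation w_ := (@flux_weight R).
Local Notation int t f := (integral3 (cell t) f).
Implicit Types (u v w psi : vfield) (p : 'I_(nvert T)) (t f e : simplex).
Hypothesis shape : shape_regular T sigma.

Let t4 t (tT : t \in tets T) : #|t| = 4%N := tri_card tT.
Let tind t (tT : t \in tets T) : affinely_independent V t :=
  @tri_nondegenerate _ _ T _ tT.
Local Notation G2 := ((4 * sigma) ^+ 2).
Local Notation K := (shapeK sigma).

Lemma shapeK_ge0 t : t \in tets T -> 0 <= K.
Proof.
move=> tT; have := sigma_gt0 shape tT => s0.
by rewrite /shapeK mulr_ge0// exprn_ge0// mulr_ge0// ltW.
Qed.

Lemma hat_div_out f t x : ~~ (f \subset t) -> hat_div f t x = 0.
Proof.
move=> ft; rewrite /hat_div big_pred0// => p; apply/andP => -[_ /eqP fE].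
by move: ft; rewrite -fE finset.subsetDl.
Qed.

Lemma card_faces_in (t : simplex) : t \in tets T ->
  (#|[set j : 'I_#|interior_faces T| | enum_val j \subset t]%SET| <= 4)%N.
Proof.
move=> tT; rewrite -(card_imset _ enum_val_inj) -(t4 tT).
apply: leq_trans (leq_imset_card (fun p => t :\ p) t).
apply: subset_leq_card; apply/fintype.subsetP => f /imsetP[j].
rewrite finset.inE => jt ->; have [f3 _] := interior_faceP (enum_valP j).
by have [p pt ->] := faceP tT f3 jt; apply: imset_f.
Qed.

Local Notation phi := (@Hdiv_basis R Omega T).

Lemma basis_affv (j : 'I_#|interior_faces T|) : pw_affv (phi (enum_val j)).
Proof. exact/Hdiv_affv/(Hdiv_basisP (enum_valP j)).1. Qed.

Lemma basis_out (j : 'I_#|interior_faces T|) t x : t \in tets T ->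
  ~~ (enum_val j \subset t) -> phi (enum_val j) t x = 0.
Proof.
move=> tT jt; have [_ ->] := Hdiv_basisP (enum_valP j) => //.
exact: hat_div_out.
Qed.

(** Stated for a general operator so as to serve both the divergence and the three components. The
    factor 4 is the number of terms in Cauchy-Schwarz on one tetrahedron. *)
Lemma l2s_nodal_le (L : vfield -> sfield T) (y : 'rV[R]_#|interior_faces T|) : linop L ->
  (forall (j : 'I_#|interior_faces T|) t x, t \in tets T -> ~~ (enum_val j \subset t) ->
     L (phi (enum_val j)) t x = 0) ->
  l2s (L (nodal_field (interior_faces T) phi y))
      (L (nodal_field (interior_faces T) phi y)) <=
  4 * \sum_j y 0 j ^+ 2 * l2s (L (phi (enum_val j))) (L (phi (enum_val j))).
Proof.
move=> [La _ Lc] L0.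
under [X in 4 * X]eq_bigr do rewrite mulr_sumr.
rewrite exchange_big mulr_sumr; apply: ler_sum => t tT /=.
have La' j : affs (L (phi (enum_val j)) t) := La _ (@basis_affv j) t tT.
apply: le_trans (int_sqr_le tT (M := 4)
  (F := fun j x => y 0 j * L (phi (enum_val j)) t x) _ _ _) _.
- exact: (La _ (pw_affv_comb (fun j => y 0 j) (@basis_affv)) t tT).
- by move=> j; exact: affsZ.
- move=> x _; rewrite Lc//; last by move=> j; exact: basis_affv.
  pose S := [set j : 'I_#|interior_faces T| | enum_val j \subset t]%SET.
  rewrite (bigID (mem S)) /= [X in _ + X]big1 ?addr0; last first.
    by move=> j; rewrite finset.inE => jt; rewrite L0// mulr0.
  apply: le_trans (sqr_sum_le _ _) _.
  apply: (@le_trans _ _ (4 * \sum_(j in S) (y 0 j * L (phi (enum_val j)) t x) ^+ 2)).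
    by rewrite ler_wpM2r ?sumr_ge0// ?ler_nat ?card_faces_in// => j _; exact: sqr_ge0.
  rewrite ler_wpM2l// [leRHS](bigID (mem S)) /= lerDl sumr_ge0// => j _.
  exact: sqr_ge0.
- by rewrite ler_wpM2l//; apply: ler_sum => j _; rewrite int_scale_sqr.
Qed.

Lemma basis_div_out (j : 'I_#|interior_faces T|) t x : t \in tets T -> ~~ (enum_val j \subset t) ->
  bdiv (phi (enum_val j)) t x = 0.
Proof.
move=> tT jt; rewrite /bdiv (@div_radial _ _ 0 0) ?mulr0// => y.
by rewrite basis_out// scale0r addr0.
Qed.

Lemma smoother_stability eps (y : 'rV[R]_#|interior_faces T|) : 0 <= eps ->
  form_div eps (nodal_field (interior_faces T) phi y)
               (nodal_field (interior_faces T) phi y) <=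
  4 * \sum_j y 0 j ^+ 2 * form_div eps (phi (enum_val j)) (phi (enum_val j)).
Proof.
move=> eps0; rewrite {1}/form_div.
have hy : pw_affv (nodal_field (interior_faces T) phi y).
  by apply: pw_affv_comb => j; exact: basis_affv.
have hd := l2s_nodal_le y (linop_div T) basis_div_out.
have hk k : l2s (component (nodal_field (interior_faces T) phi y) k)
      (component (nodal_field (interior_faces T) phi y) k) <=
    4 * \sum_j y 0 j ^+ 2 *
      l2s (component (phi (enum_val j)) k) (component (phi (enum_val j)) k).
  apply: (l2s_nodal_le y (linop_component T k)) => j t x tT jt.
  by rewrite /component basis_out// mxE.
rewrite l2vE//.
apply: (le_trans (lerD hd (ler_wpM2l eps0 (ler_sum _ (fun k _ => hk k))))).
rewrite le_eqVlt; apply/orP; left; apply/eqP.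
rewrite -mulr_sumr exchange_big /= mulrCA -mulrDr; congr (4 * _).
rewrite mulr_sumr -big_split /=; apply: eq_bigr => j _.
rewrite /form_div l2vE; [|exact: basis_affv|exact: basis_affv].
by rewrite -mulr_sumr; ring.
Qed.

(** The intermediate quantity of the local estimates: it bounds the products with gradients that
    determine the coefficients, and volume times it is bounded by the integral of the squared
    field. *)
Definition vertex_sq u t : R := \sum_(i in t) dot (u t (V i)) (u t (V i)).

Lemma vertex_sq_ge0 u t : 0 <= vertex_sq u t.
Proof. by apply: sumr_ge0 => i _; exact: dot_ge0. Qed.

Lemma vertex_sq_vertex u t i : i \in t ->
  dot (u t (V i)) (u t (V i)) <= vertex_sq u t.
Proof.
move=> it; rewrite /vertex_sq (bigD1 i)//= lerDl.
by apply: sumr_ge0 => j _; exact: dot_ge0.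
Qed.

Lemma vertex_sq_le_int u t : t \in tets T -> pw_affv u ->
  vertex_sq u t * vol V t <= 4 * K * \sum_k int t (fun x => u t x 0 k * u t x 0 k).
Proof.
move=> tT hu; rewrite /vertex_sq mulr_suml.
apply: (@le_trans _ _ (\sum_(i in t) K * \sum_k int t (fun x => u t x 0 k * u t x 0 k))).
  apply: ler_sum => i it; rewrite /dot mulr_suml mulr_sumr; apply: ler_sum => k _.
  rewrite -expr2; exact: (vertex_le_int shape tT (hu t tT k) it).
by rewrite sumr_const (t4 tT) -[leLHS]mulr_natl mulrA.
Qed.

Lemma trace_sqr_le u t p i : i \in t ->
  dot (u t (V i)) (grd t p) ^+ 2 <= vertex_sq u t * dot (grd t p) (grd t p).
Proof.
move=> it; apply: le_trans (dot_cauchy_schwarz _ _) _.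
by rewrite ler_wpM2r ?dot_ge0// vertex_sq_vertex.
Qed.

Lemma flux_weights_sum1 : \sum_(k < 3) w_ k / flux_mass = 1.
Proof.
rewrite -mulr_suml !big_ord_recl big_ord0 addr0 addrA /= mulfV//.
by rewrite gt_eqF// flux_mass_gt0.
Qed.

Lemma mean_sqr_le (a : 'I_3 -> R) M : (forall k, a k ^+ 2 <= M) ->
  (\sum_(k < 3) w_ k / flux_mass * a k) ^+ 2 <= M.
Proof.
move=> h; apply: convex_sqr_le => //; last exact: flux_weights_sum1.
by move=> k; rewrite divr_ge0 ?flux_weight_ge0// ltW// flux_mass_gt0.
Qed.

Lemma corner_mem_tet t p (k : 'I_3) : t \in tets T -> p \in t ->
  exists2 i, i \in t & corner (t :\ p) k = V i.
Proof.
move=> tT pt; have [i ip ->] := corner_mem (face_simplex tT pt) (ltn_ord k).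
by exists i => //; move: ip; rewrite finset.inE => /andP[].
Qed.

Lemma sqr_sum_tet_le t (a : 'I_(nvert T) -> R) M : t \in tets T ->
  (forall p, p \in t -> a p ^+ 2 <= M) -> (\sum_(p in t) a p) ^+ 2 <= 16 * M.
Proof.
move=> tT aM; apply: le_trans (sqr_sum_le _ _) _.
rewrite (t4 tT) (_ : 16 * M = 4 * (\sum_(p in t) M)).
  by rewrite ler_wpM2l//; exact: ler_sum.
by rewrite sumr_const (t4 tT) -[X in _ = 4 * X]mulr_natl; ring.
Qed.

Lemma Pi_affv psi : in_Hgrad3 psi -> pw_affv (Pi_div psi).
Proof.
move=> hpsi t tT; apply: affv_ext (fun x => esym (Pi_div_local x hpsi tT)) _.
apply: affv_sum => p _; apply: affvZ; apply: affvD; first exact: affv_id.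
exact: affv_cst.
Qed.

(** Each of the four terms is a mean of order |grad| times a vector of length at most the mesh size,
    and [bgr_bound] makes the mesh size cancel. The factor 16 is 4 from Cauchy-Schwarz times 4
    terms. *)
Lemma Pi_component_le psi t k x : in_Hgrad3 psi -> t \in tets T -> cell t x ->
  Pi_div psi t x 0 k ^+ 2 <= 16 * (G2 * vertex_sq psi t).
Proof.
move=> hpsi tT xt; rewrite Pi_div_local// summxE; apply: sqr_sum_tet_le => // p pt.
rewrite mxE exprMn sqrrN mulrC [leRHS]mulrC.
have m : face_mean psi t p ^+ 2 <= vertex_sq psi t * dot (grd t p) (grd t p).
  by apply: mean_sqr_le => l; have [i it ->] := corner_mem_tet l tT pt; exact: trace_sqr_le.
have xh : (x - V p) 0 k ^+ 2 <= meshsize t ^+ 2.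
  apply: le_trans (dot_meshsize tT xt (hull_vertex V pt)).
  rewrite [leRHS](bigD1 k)//= -expr2 lerDl sumr_ge0// => l _.
  by rewrite -expr2 sqr_ge0.
apply: le_trans (ler_pM (sqr_ge0 _) (sqr_ge0 _) xh m) _.
rewrite mulrCA ler_wpM2l ?vertex_sq_ge0// mulrC.
exact: bgr_bound.
Qed.

Lemma Pi_L2_le psi : in_Hgrad3 psi ->
  l2v (Pi_div psi) (Pi_div psi) <= 192 * K * G2 * l2v psi psi.
Proof.
move=> hpsi; have hP := Pi_affv hpsi; have hp := Hgrad3_affv hpsi.
rewrite !l2vE// /l2s exchange_big [X in _ <= _ * X]exchange_big mulr_sumr.
apply: ler_sum => t tT /=.
(* The constant 192 is 3 components times 16 from [Pi_component_le] times 4 from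
   [vertex_sq_le_int]. *)
apply: (@le_trans _ _ (\sum_(k < 3) 16 * (G2 * vertex_sq psi t) * vol V t)).
  apply: ler_sum => k _; apply: int_sqr_le_cst => //; first exact: hP.
  by move=> x xt; exact: Pi_component_le.
rewrite sumr_const card_ord -[leLHS]mulr_natl.
have := vertex_sq_le_int tT hp; have g0 : 0 <= 48 * G2 by rewrite mulr_ge0// sqr_ge0.
move=> /(ler_wpM2l g0) h; apply: le_trans (le_trans _ h) _.
  by rewrite le_eqVlt; apply/orP; left; apply/eqP; ring.
by rewrite le_eqVlt; apply/orP; left; apply/eqP; rewrite /component; ring.
Qed.

Lemma sum_face_mean_cst (a : 'rV[R]_3) t : t \in tets T ->
  \sum_(p in t) \sum_(k < 3) w_ k / flux_mass * dot a (grd t p) = 0.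
Proof.
move=> tT; under eq_bigr do rewrite -mulr_suml flux_weights_sum1 mul1r.
by rewrite -dot_sumr sum_bgr ?dot0r// ?t4//; exact: tind.
Qed.

Lemma bdiv_radial_sum (m : 'I_(nvert T) -> R) (v : 'rV[R]_3 -> 'rV[R]_3) t x :
  (forall y, v y = \sum_(p in t) - m p *: (y - V p)) ->
  div v x = - 3 * \sum_(p in t) m p.
Proof.
move=> h; rewrite (@div_radial _ _ (\sum_(p in t) m p *: V p) (\sum_(p in t) - m p)).
  by rewrite sumrN; ring.
move=> y; rewrite h scaler_suml -big_split; apply: eq_bigr => p _ /=.
by apply/rowP => k; rewrite !mxE; ring.
Qed.

(** The divergence is -3 times the sum of the four means, and that sum does not change when the
    constant [psi t (V i0)] is subtracted. What remains are differences of vertex values, at most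
    the gradient times the mesh size. The constant is 9 times 16. *)
Lemma Pi_div_le psi t x : in_Hgrad3 psi -> t \in tets T ->
  bdiv (Pi_div psi) t x ^+ 2 <=
  144 * (G2 * \sum_k dot (grad (component psi k t) x) (grad (component psi k t) x)).
Proof.
move=> hpsi tT; have hp := Hgrad3_affv hpsi tT.
set Ga := \sum_k dot _ _.
have Ga0 : 0 <= Ga by apply: sumr_ge0 => k _; exact: dot_ge0.
rewrite /bdiv (bdiv_radial_sum _ (fun y => Pi_div_local y hpsi tT)).
have [i0 i0t] := tet_vertex tT.
rewrite exprMn (_ : (-3) ^+ 2 = 9 :> R); last by ring.
have -> : 144 * (G2 * Ga) = 9 * (16 * (G2 * Ga)) by ring.
rewrite ler_pM2l//.
have -> : \sum_(p in t) face_mean psi t p = \sum_(p in t) \sum_(k < 3)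
    w_ k / flux_mass * dot (psi t (corner (t :\ p) k) - psi t (V i0)) (grd t p).
  rewrite -[LHS]subr0 -[X in _ - X](sum_face_mean_cst (psi t (V i0)) tT) -sumrB.
  apply: eq_bigr => p _; rewrite -sumrB; apply: eq_bigr => k _.
  by rewrite dotBl mulrBr.
apply: sqr_sum_tet_le => // p pt; apply: mean_sqr_le => k.
have [i it ->] := corner_mem_tet k tT pt.
apply: le_trans (dot_cauchy_schwarz _ _) _.
apply: (@le_trans _ _ (Ga * meshsize t ^+ 2 * dot (grd t p) (grd t p))); last first.
  rewrite -(mulrA Ga) (mulrC _ Ga); apply: ler_wpM2l => //.
  by rewrite mulrC; exact: bgr_bound.
rewrite ler_wpM2r ?dot_ge0// /Ga mulr_suml; apply: ler_sum => l _.
rewrite !mxE -(dot_grad x (V i) (V i0) (hp l)) -expr2.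
apply: le_trans (dot_cauchy_schwarz _ _) _.
rewrite ler_wpM2l ?dot_ge0//.
by apply: dot_meshsize => //; exact: hull_vertex.
Qed.

Lemma Pi_H1_le psi : in_Hgrad3 psi ->
  l2s (bdiv (Pi_div psi)) (bdiv (Pi_div psi)) <=
  144 * G2 * \sum_k l2v (bgrad (component psi k)) (bgrad (component psi k)).
Proof.
move=> hpsi; have hp := Hgrad3_affv hpsi.
rewrite /l2s /l2v exchange_big mulr_sumr; apply: ler_sum => t tT /=.
have grad_cst k x : grad (component psi k t) x = grad (component psi k t) 0.
  have [a [b h]] := hp t tT k.
  by apply/rowP => l; rewrite !mxE !(partialE _ _ h).
have e k : int t (fun x => dot (bgrad (component psi k) t x) (bgrad (component psi k) t x)) =
    dot (grad (component psi k t) 0) (grad (component psi k t) 0) * vol V t.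
  rewrite -(integral3_cst (t4 tT) (tind tT)); congr (integral3 _ _).
  by apply/funext => x; rewrite /bgrad grad_cst.
under [X in _ <= _ * X]eq_bigr do rewrite e.
rewrite -mulr_suml mulrA -[144 * G2 * _]mulrA; apply: int_sqr_le_cst => //.
  by apply: affs_div; exact: (Pi_affv hpsi).
move=> x _; apply: le_trans (Pi_div_le x hpsi tT) _.
by under eq_bigr do rewrite grad_cst.
Qed.

Lemma Pi_stability eps psi : 0 <= eps -> in_Hgrad3 psi ->
  form_div eps (Pi_div psi) (Pi_div psi) <=
  (144 + 192 * K) * G2 * form_grad3 eps psi psi.
Proof.
move=> eps0 hpsi; have h1 := Pi_H1_le hpsi; have h0 := Pi_L2_le hpsi.
(* The sign of [K] is that of [sigma], which is known only once there is a tetrahedron. *)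
have [t0|[t tT]] := set_0Vmem (tets T).
  rewrite /form_div /form_grad3 /l2s /l2v t0 !big_set0 mulr0 addr0.
  by rewrite big1 ?add0r ?mulr0// => k _; rewrite big_set0.
have k0 := shapeK_ge0 tT; have g0 : 0 <= G2 := sqr_ge0 _.
have n0 : 0 <= \sum_k l2v (bgrad (component psi k)) (bgrad (component psi k)).
  by apply: sumr_ge0 => k _; exact: l2v_ge0.
have m0 : 0 <= l2v psi psi := l2v_ge0 _.
rewrite /form_div /form_grad3.
apply: le_trans (lerD h1 (ler_wpM2l eps0 h0)) _.
set N := \sum_k _ in n0 *; set M := l2v psi psi in m0 *.
have a1 : 0 <= K * G2 * N by apply: mulr_ge0 n0; exact: mulr_ge0.
have a2 : 0 <= G2 * (eps * M) by apply: mulr_ge0 g0 _; exact: mulr_ge0.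
rewrite -subr_ge0.
have -> : (144 + 192 * K) * G2 * (N + eps * M) -
    (144 * G2 * N + eps * (192 * K * G2 * M)) =
    192 * (K * G2 * N) + 144 * (G2 * (eps * M)) by ring.
by apply: addr_ge0; apply: mulr_ge0.
Qed.

End Estimates.

(** * Uniform bound on the mesh sizes *)

Lemma bounded_set_coord (R : realType) (A : set 'rV[R]_3) : bounded_set A ->
  exists B : R, forall x k, closure A x -> `|x 0 k| <= B.
Proof.
move=> [M [_ hM]]; exists (M + 1 + 1 + 1) => x k xA.
have [y [Ay xy]] := xA _ (nbhsx_ballx x 1 ltr01).
have yM : `|y| <= M + 1 by apply: hM => //; rewrite ltrDl.
have y0 : ball (0 : 'rV[R]_3) (M + 1 + 1) y.
  by rewrite mx_norm_ball /ball_ /= sub0r normrN (le_lt_trans yM)// ltrDl.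
have yk : `|y 0 k| < M + 1 + 1.
  have [_ /(_ 0 k)] := y0.
  by rewrite /ball /= mxE sub0r normrN.
have xk : `|x 0 k - y 0 k| < 1 by have [_ /(_ 0 k)] := xy.
rewrite -[x 0 k](subrK (y 0 k)) (le_trans (ler_normD _ _))//.
by rewrite addrC lerD// ltW.
Qed.

(** All cells lie in the closure of the domain. The bound serves to absorb the mass part of the
    diagonal of [A_div] into its h^-2 part. *)
Lemma meshsize_bounded (R : realType) (Omega : set 'rV[R]_3) :
  bounded_set Omega -> exists2 H : R, 0 <= H &
  forall (T : triangulation Omega) t, t \in tets T -> meshsize t <= H.
Proof.
move=> /bounded_set_coord[B hB]; exists (Num.sqrt (3 * (B + B) ^+ 2)).
  exact: sqrtr_ge0.
move=> T t tT; have sub x : hull (@vertex _ _ T) t x -> closure Omega x.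
  by move=> xt; rewrite -(tri_cover T); exists t.
apply: ge_sup.
  have [i it] := tet_vertex tT; have vi := hull_vertex (@vertex _ _ T) it.
  by exists (enorm (vertex i - vertex i)), (vertex i), (vertex i).
move=> _ [x [y [xs ys ->]]]; rewrite ler_wsqrtr// coord_dot_le// => k.
rewrite !mxE (le_trans (ler_normB _ _))//.
by rewrite lerD// hB//; exact: sub.
Qed.

(** * The smoother norm against the weighted L^2 norm *)

Section LowerBound.
Context {R : realType} {Omega : set 'rV[R]_3}.
Variables (T : triangulation Omega) (sigma : R).
Local Notation V := (@vertex R Omega T).
Local Notation cell t := (hull (@vertex R Omega T) t).
Local Notation simplex := {set 'I_(nvert T)}.
Local Notation vfield := (vfield T).
Local Notation lam := (bcoord V).
Local Notation grd := (bgr V).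
Local Notation int t f := (integral3 (cell t) f).
Local Notation phi := (@Hdiv_basis R Omega T).
Implicit Types (u v w psi : vfield) (p : 'I_(nvert T)) (t f e : simplex).
Hypothesis shape : shape_regular T sigma.

Let t4 t (tT : t \in tets T) : #|t| = 4%N := tri_card tT.
Let tind t (tT : t \in tets T) : affinely_independent V t :=
  @tri_nondegenerate _ _ T _ tT.
Local Notation G2 := ((4 * sigma) ^+ 2).
Local Notation K := (shapeK sigma).

Definition form_div_tet (eps : R) u t : R :=
  int t (fun x => bdiv u t x * bdiv u t x) +
  eps * \sum_k int t (fun x => u t x 0 k * u t x 0 k).

Lemma form_div_tetE eps u : pw_affv u ->
  form_div eps u u = \sum_(t in tets T) form_div_tet eps u t.
Proof.
move=> hu; rewrite /form_div l2vE// /l2s exchange_big mulr_sumr -big_split.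
by [].
Qed.

Lemma hat_div_single t p x : t \in tets T -> p \in t ->
  hat_div (t :\ p) t x = - (flux_mass * nu t p)^-1 *: (x - V p).
Proof.
move=> tT pt; rewrite /hat_div (big_pred1 p)// => q /=.
apply/andP/eqP => [[qt /eqP e]|->]; last by rewrite pt.
apply/eqP; apply: contraT => qp.
have : p \in t :\ q by rewrite finset.in_setD1 pt eq_sym qp.
by rewrite e finset.in_setD1 eqxx.
Qed.

(** On [t] the basis function times the degree of freedom is - c (x - V p), where c is the product
    of a vertex value of [v] with the gradient at [p], of order 1/h. The squared divergence is 9
    c^2; the three squared components have no factor h^-2 and receive it from 1 <= H^2 h^-2. *)
Lemma smoother_tet_le eps H v t p : 0 <= eps <= 1 -> 0 <= H -> meshsize t <= H ->
  in_Hdiv v -> t \in tets T -> p \in t -> t :\ p \in interior_faces T ->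
  face_dof v (t :\ p) ^+ 2 * form_div_tet eps (phi (t :\ p)) t <=
  (9 + 3 * H ^+ 2) * G2 * (meshsize t ^- 2) * vertex_sq v t * vol V t.
Proof.
move=> /andP[e0 e1] H0 hH hv tT pt fi.
have h0 := meshsize_gt0 tT; have vol0 := tvol_gt0 shape tT.
set m := (flux_mass * nu t p)^-1; set d := face_dof v _.
have ip := opp_vertexP tT pt; have it : opp_vertex t p \in t.
  by move: ip; rewrite finset.inE => /andP[].
have phiE x : phi (t :\ p) t x = - m *: (x - V p).
  by have [_ ->] := Hdiv_basisP fi => //; exact: hat_div_single.
have hphi := Hdiv_affv (Hdiv_basisP fi).1.
pose c := d * m; have cE : c = dot (v t (V (opp_vertex t p))) (grd t p).
  by rewrite -(Hdiv_local hv tT pt ip) fi.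
have c2 : c ^+ 2 <= vertex_sq v t * dot (grd t p) (grd t p).
  by rewrite cE; exact: trace_sqr_le.
have divE x : bdiv (phi (t :\ p)) t x = 3 * - m.
  by apply: (@div_radial _ _ (m *: V p)) => y; rewrite phiE scalerBr !scaleNr opprK addrC.
set N := vertex_sq v t in c2 *; have N0 : 0 <= N := vertex_sq_ge0 _ _.
have g2 : dot (grd t p) (grd t p) <= G2 * meshsize t ^- 2.
  by rewrite ler_pdivlMr ?exprn_gt0// bgr_bound.
have c2' : c ^+ 2 <= N * (G2 * meshsize t ^- 2).
  by apply: le_trans c2 _; rewrite ler_wpM2l.
have c2h : c ^+ 2 * meshsize t ^+ 2 <= N * G2.
  by rewrite -ler_pdivlMr ?exprn_gt0// -mulrA.
have I1 : d ^+ 2 * int t (fun x => bdiv (phi (t :\ p)) t x * bdiv (phi (t :\ p)) t x)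
    <= 9 * c ^+ 2 * vol V t.
  rewrite -int_scale_sqr//; last by apply: affs_div; exact: hphi.
  apply: int_sqr_le_cst => //; first by apply/affsZ/affs_div; exact: hphi.
  by move=> x _; rewrite divE /c le_eqVlt; apply/orP; left; apply/eqP; ring.
have I2 k : d ^+ 2 * int t (fun x => phi (t :\ p) t x 0 k * phi (t :\ p) t x 0 k)
    <= N * G2 * vol V t.
  rewrite -int_scale_sqr//; last exact: hphi.
  apply: int_sqr_le_cst => //; first by apply: affsZ; exact: hphi.
  move=> x xt; apply: le_trans c2h; rewrite phiE mxE.
  rewrite (_ : (d * _) ^+ 2 = c ^+ 2 * ((x - V p) 0 k) ^+ 2); last by rewrite /c; ring.
  rewrite ler_wpM2l ?sqr_ge0//.
  apply: le_trans (dot_meshsize tT xt (hull_vertex V pt)).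
  by rewrite [leRHS](bigD1 k)//= -expr2 lerDl sumr_ge0// => l _; rewrite -expr2 sqr_ge0.
have I3 : d ^+ 2 * \sum_k int t (fun x => phi (t :\ p) t x 0 k * phi (t :\ p) t x 0 k)
    <= 3 * (N * G2 * vol V t).
  rewrite mulr_sumr; apply: (@le_trans _ _ (\sum_(k < 3) N * G2 * vol V t)).
    by apply: ler_sum => k _; exact: I2.
  by rewrite sumr_const card_ord -[leLHS]mulr_natl.
rewrite /form_div_tet mulrDr mulrCA.
have g0 : 0 <= G2 := sqr_ge0 _.
have B0 : 0 <= N * G2 * vol V t by apply: mulr_ge0 (ltW vol0); exact: mulr_ge0.
have I3' : eps * (d ^+ 2 * \sum_k int t (fun x => phi (t :\ p) t x 0 k * phi (t :\ p) t x 0 k))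
    <= 3 * (N * G2 * vol V t).
  apply: le_trans (ler_wpM2l e0 I3) _.
  by rewrite ler_piMl// mulr_ge0.
have hi : 1 <= H ^+ 2 * meshsize t ^- 2.
  by rewrite ler_pdivlMr ?exprn_gt0// mul1r lerXn2r ?nnegrE// ltW.
have I4 : N * G2 * vol V t <= H ^+ 2 * meshsize t ^- 2 * (N * G2 * vol V t).
  by rewrite ler_peMl.
have I5 : 9 * c ^+ 2 * vol V t <= 9 * (N * (G2 * meshsize t ^- 2)) * vol V t.
  by rewrite ler_pM2r// ler_pM2l.
apply: le_trans (lerD (le_trans I1 I5) (le_trans I3' (ler_wpM2l _ I4))) _ => //.
by rewrite le_eqVlt; apply/orP; left; apply/eqP; ring.
Qed.

(** The local estimate is summed over the at most four faces of each tetrahedron, and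
    [vertex_sq_le_int] brings 4 K; hence 16 K. The weight h^-1 in the regular decomposition is
    exactly what this norm requires. *)
Lemma smoother_lower eps H v : 0 <= eps <= 1 -> 0 <= H ->
  (forall t, t \in tets T -> meshsize t <= H) -> in_Hdiv v ->
  \sum_(j < #|interior_faces T|) face_dof v (enum_val j) ^+ 2 *
     form_div eps (phi (enum_val j)) (phi (enum_val j)) <=
  16 * K * G2 * (9 + 3 * H ^+ 2) * sqnorm_L2 (hinv v).
Proof.
move=> he H0 hH hv.
under eq_bigr => j _ do rewrite (form_div_tetE _ (@basis_affv _ _ T j)) mulr_sumr.
rewrite exchange_big /sqnorm_L2 /l2v mulr_sumr; apply: ler_sum => t tT /=.
pose S := [set j : 'I_#|interior_faces T| | enum_val j \subset t]%SET.
have hvt := Hdiv_affv hv tT; have h0 := meshsize_gt0 tT.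
have -> : int t (fun x => dot (hinv v t x) (hinv v t x)) =
    meshsize t ^- 2 * \sum_k int t (fun x => v t x 0 k * v t x 0 k).
  rewrite mulr_sumr -[LHS]/(int t (fun x => \sum_k hinv v t x 0 k * hinv v t x 0 k)).
  rewrite (int_sum_affsM tT); [|move=> k|move=> k]; try exact: affvZ.
  apply: eq_bigr => k _; rewrite -exprVn -int_scale_sqr//.
  by congr (integral3 _ _); apply/funext => x; rewrite /hinv mxE.
set I := \sum_k _.
set B := (9 + 3 * H ^+ 2) * G2 * meshsize t ^- 2.
have B0 : 0 <= B.
  apply: mulr_ge0; last by rewrite invr_ge0 sqr_ge0.
  apply: mulr_ge0; last exact: sqr_ge0.
  by rewrite addr_ge0// mulr_ge0// sqr_ge0.
apply: (@le_trans _ _ (\sum_(j in S) B * vertex_sq v t * vol V t)).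
  rewrite [leLHS](bigID (mem S)) /= [X in _ + X <= _]big1 ?addr0; last first.
    move=> j; rewrite finset.inE => jt; rewrite /form_div_tet.
    rewrite [X in _ * (X + _)](_ : _ = 0); last first.
      rewrite -[RHS](mul0r (vol V t)) -(integral3_cst (t4 tT) (tind tT)).
      congr (integral3 _ _); apply/funext => x.
      by rewrite basis_div_out// mulr0.
    rewrite big1 ?mulr0 ?addr0 ?mulr0// => k _.
    rewrite -[RHS](mul0r (vol V t)) -(integral3_cst (t4 tT) (tind tT)).
    congr (integral3 _ _); apply/funext => x.
    by rewrite basis_out// mxE mulr0.
  apply: ler_sum => j; rewrite finset.inE => jt.
  have [f3 _] := interior_faceP (enum_valP j).
  have [p pt fE] := faceP tT f3 jt; have := enum_valP j; rewrite fE => fi.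
  exact: smoother_tet_le (hH _ tT) _ _ _ _.
rewrite sumr_const -[leLHS]mulr_natl.
have nb : (#|S|%:R : R) <= 4 by rewrite ler_nat card_faces_in.
have vs := vertex_sq_le_int shape tT (Hdiv_affv hv); rewrite -/I in vs.
apply: (@le_trans _ _ (4 * (B * vertex_sq v t * vol V t))).
  apply: ler_wpM2r nb; apply: mulr_ge0 (ltW (tvol_gt0 shape tT)).
  exact: mulr_ge0 (vertex_sq_ge0 _ _).
rewrite -mulrA; have := ler_wpM2l B0 vs.
move=> /(ler_wpM2l (_ : 0 <= 4 :> R)) h; apply: le_trans (h _) _ => //.
by rewrite /B le_eqVlt; apply/orP; left; apply/eqP; ring.
Qed.

End LowerBound.

(** * Invertibility of the blocks *)

Section Invertibility.
Context {R : realType} {Omega : set 'rV[R]_3}.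
Variables (T : triangulation Omega) (sigma : R).
Local Notation V := (@vertex R Omega T).
Local Notation cell t := (hull (@vertex R Omega T) t).
Local Notation simplex := {set 'I_(nvert T)}.
Local Notation sfield := (sfield T).
Local Notation vfield := (vfield T).
Local Notation int t f := (integral3 (cell t) f).
Local Notation phi := (@Hdiv_basis R Omega T).
Implicit Types (u v w psi : vfield) (t f e : simplex).
Hypothesis shape : shape_regular T sigma.

Let t4 t (tT : t \in tets T) : #|t| = 4%N := tri_card tT.
Let tind t (tT : t \in tets T) : affinely_independent V t :=
  @tri_nondegenerate _ _ T _ tT.

Lemma small_step_outside t (x d : 'rV[R]_3) : t \in tets T -> ~ cell t x ->
  \forall s \near 0^'+, ~ cell t (x + s *: d).
Proof.
move=> tT xt; have [i it li] : exists2 i, i \in t & bcoord V t i x < 0.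
  apply: contrapT => h; apply: xt; apply/(hullP (t4 tT) (tind tT)) => i it.
  by rewrite leNgt; apply/negP => li; apply: h; exists i.
set b := dot (bgr V t i) d.
near=> s => /(hullP (t4 tT) (tind tT))/(_ i it).
have -> : bcoord V t i (x + s *: d) = bcoord V t i x + s * b.
  by rewrite /bcoord dotDr dotZr addrA.
rewrite leNgt => /negP; apply.
have s0 : 0 < s by near: s; exact: nbhs_right_gt.
have sb : s < - bcoord V t i x / (`|b| + 1).
  by near: s; apply: nbhs_right_lt; rewrite divr_gt0 ?oppr_gt0// ltr_wpDl.
move: sb; rewrite ltr_pdivlMr ?ltr_wpDl// => sb.
have : s * b <= s * (`|b| + 1).
  by rewrite ler_pM2l// (le_trans (ler_norm b))// lerDl.
lra.
Unshelve. all: by end_near.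
Qed.

(* The vertex with the largest first coordinate among those of the tetrahedra
   carrying a nonzero constant lies in the interior, and moving from it in the
   first coordinate direction enters another tetrahedron with that constant. *)
Lemma Hgrad_locally_constant (p : sfield) : open Omega -> in_Hgrad p ->
  (forall t, t \in tets T -> exists c, forall x, p t x = c) ->
  forall t x, t \in tets T -> p t x = 0.
Proof.
move=> oO [_ pc pb] hc t0 x0 t0T; apply/eqP; apply: contraT => m0.
set m := p t0 x0 in m0.
pose S := [pred i | `[< exists t, [/\ t \in tets T, i \in t & p t (V i) = m] >]].
have [i0 i0t] := tet_vertex t0T.
have Si0 : S i0.
  apply/asboolP; exists t0; split => //; have [c cE] := hc t0 t0T.
  by rewrite /m !cE.
have [i /asboolP[t [tT it pi]] imax] : exists2 i, S i &
    forall j, S j -> V j 0 0 <= V i 0 0.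
  by case: (Order.TotalTheory.arg_maxP (fun i => V i 0 0 : R) Si0) => i Si h; exists i.
have viO : Omega (V i).
  have cl : closure Omega (V i).
    by rewrite -(tri_cover T); exists t => //; exact: hull_vertex.
  apply: contrapT => nO; move/eqP: m0; apply; rewrite -pi.
  apply: pb => //; first exact: hull_vertex.
  by split => // /interior_subset.
pose d : 'rV[R]_3 := delta_mx 0 0.
have nearO : \forall s \near 0^'+, Omega (V i + s *: d).
  have : nbhs (V i) Omega by exact: open_nbhs_nbhs.
  move=> /nbhs_ballP[e /= e0 he]; near=> s; apply: he; split => // k l.
  have s0 : 0 < s by near: s; exact: nbhs_right_gt.
  have se : s < e by near: s; exact: nbhs_right_lt.
  rewrite /ball /= !mxE opprD addNKr normrN normrM ger0_norm ?ltW//.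
  by case: (_ && _); rewrite ?normr1 ?normr0 ?mulr1 ?mulr0.
(* There are finitely many tetrahedra, so after a small enough step only those containing [V i] can
   be met. *)
have nearT : \forall s \near 0^'+, forall t' : simplex,
    t' \in tets T -> ~ cell t' (V i) -> ~ cell t' (V i + s *: d).
  apply: filter_forall => t'.
  have [/andP[tT' /asboolP h]|h] := boolP ((t' \in tets T) && `[< ~ cell t' (V i) >]).
    by have := small_step_outside d tT' h; apply: filterS => s hs _ _.
  apply: nearW => s tT' nt'; case/negP: h.
  by rewrite tT'; apply/asboolP.
have [s [s0 sO sT]] : exists s : R, [/\ 0 < s, Omega (V i + s *: d) &
    forall t' : simplex, t' \in tets T -> ~ cell t' (V i) -> ~ cell t' (V i + s *: d)].
  have nn : \forall s \near 0^'+, [/\ 0 < s, Omega (V i + s *: d) &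
      forall t' : simplex, t' \in tets T -> ~ cell t' (V i) -> ~ cell t' (V i + s *: d)].
    by near=> s; split; near: s; [exact: nbhs_right_gt|exact: nearO|exact: nearT].
  by have [s] := filter_ex nn; exists s.
have : closure Omega (V i + s *: d) by exact: subset_closure.
rewrite -(tri_cover T) => -[t' /= tT' yt'].
have vit' : cell t' (V i) by apply: contrapT => /(sT t' tT').
have vi := hull_vertex V it.
have it' : i \in t'.
  have := cell_conforming tT tT' vi vit'.
  move=> /(vertex_hull (t4 tT) (tind tT) (finset.subsetIl t t') it).
  by rewrite finset.inE => /andP[].
have Sj j : j \in t' -> S j.
  move=> jt'; apply/asboolP; exists t'; split => //; have [c cE] := hc t' tT'.
  by rewrite -pi (pc t t' _ tT tT' vi vit') !cE.
(* The new point is a convex combination of vertices of [t'], all of which compete in the maximum;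
   this contradicts [s > 0]. *)
have : (V i + s *: d) 0 0 <= V i 0 0.
  rewrite [leLHS](affs_bary _ (t4 tT') (tind tT') (affs_coord 0)).
  rewrite -[leRHS]mul1r -(sum_lam (t4 tT') (tind tT') (V i + s *: d)) mulr_suml.
  apply: ler_sum => j jt'; rewrite ler_wpM2l//; last exact/imax/Sj.
  exact: (hullP (t4 tT') (tind tT') _).1.
by rewrite !mxE mulr1 gerDl leNgt s0.
Unshelve. all: by end_near.
Qed.

Lemma in_Hgrad3_comb (I : finType) (c : I -> R) (F : I -> vfield) :
  (forall i, in_Hgrad3 (F i)) -> in_Hgrad3 (comb c F).
Proof.
move=> h k; have cE t x : component (comb c F) k t x =
    \sum_i c i * component (F i) k t x.
  by rewrite /component /comb summxE; apply: eq_bigr => i _; rewrite mxE.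
split.
- move=> t tT; apply: (@affs_ext _ (fun x => \sum_i c i * component (F i) k t x)).
    by move=> x; rewrite cE.
  by apply: affs_sum => i _; apply: affsZ; have [ha _ _] := h i k; exact: ha.
- move=> t t' x tT tT' xt xt'; rewrite !cE; apply: eq_bigr => i _.
  by have [_ hc _] := h i k; rewrite (hc t t').
- move=> t x tT xt xb; rewrite cE big1// => i _.
  by have [_ _ hb] := h i k; rewrite (hb t) ?mulr0.
Qed.

Lemma grad3_nodal_in (y : 'rV[R]_#|grad3_nodes T|) :
  in_Hgrad3 (nodal_field (grad3_nodes T) (@Hgrad3_basis _ _ T) y).
Proof. by apply: in_Hgrad3_comb => j; exact/Hgrad3_basis_in/enum_valP. Qed.

Lemma curl_nodal_in (y : 'rV[R]_#|interior_edges T|) :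
  in_Hcurl (nodal_field (interior_edges T) (@Hcurl_basis _ _ T) y).
Proof. by apply: in_Hcurl_comb => j; exact: (Hcurl_basisP (enum_valP j)).1. Qed.

Lemma div_nodal_in (y : 'rV[R]_#|interior_faces T|) :
  in_Hdiv (nodal_field (interior_faces T) phi y).
Proof. by apply: in_Hdiv_comb => j; exact: (Hdiv_basisP (enum_valP j)).1. Qed.

Lemma grad3_nodal_eq0 (y : 'rV[R]_#|grad3_nodes T|) :
  (forall t x, t \in tets T -> nodal_field (grad3_nodes T) (@Hgrad3_basis _ _ T) y t x = 0) ->
  y = 0.
Proof.
move=> h; apply/rowP => j; rewrite mxE.
have [i [k ikE]] : exists i k, enum_val j = (i, k) by case: (enum_val j) => i k; exists i, k.
have [tT it] := vertex_tet i.
have := h _ (V i) tT => /rowP/(_ k); rewrite mxE summxE (bigD1 j)//= big1 ?addr0.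
  have := enum_valP j; rewrite ikE finset.inE /= => ii.
  have [_ hb] := Hgrad_basisP ii.
  rewrite /Hgrad3_basis /= hb// !mxE !eqxx mulr1 => <-.
  by rewrite -[hat_grad _ _ _]/(vertex_dof (hat_grad i) i) vertex_dof_hat eqxx mulr1.
move=> l lj; have lE := enum_valP l; rewrite finset.inE in lE.
have [_ hb] := Hgrad_basisP lE; rewrite /Hgrad3_basis hb// !mxE.
rewrite -[hat_grad _ _ _]/(vertex_dof (hat_grad (enum_val l).1) i) vertex_dof_hat eqxx /=.
case: eqP => [il|]; last by rewrite mul0r mulr0.
case: eqP => [kl|]; last by rewrite !mulr0.
have : enum_val l = enum_val j by rewrite ikE il kl -surjective_pairing.
by move=> /enum_val_inj/eqP; rewrite (negPf lj).
Qed.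

Lemma curl_nodal_eq0 (y : 'rV[R]_#|interior_edges T|) :
  (forall t x, t \in tets T -> nodal_field (interior_edges T) (@Hcurl_basis _ _ T) y t x = 0) ->
  y = 0.
Proof.
move=> h; apply/rowP => j; rewrite mxE.
have [es e2 _] := interior_edgeP (enum_valP j).
have [a [b [eE _ _ _]]] := edgeP e2; have [tT et] := edge_tet es.
have := h _ (V a) tT => /(congr1 (fun u : 'rV[R]_3 => dot u (V b - V a))); rewrite dot0l dot_suml.
have hl l : dot (y 0 l *: Hcurl_basis (enum_val l) (tet_of (enum_val j)) (V a)) (V b - V a)
    = y 0 l * (j == l)%:R.
  have [_ hb] := Hcurl_basisP (enum_valP l); rewrite dotZl hb//; congr (_ * _).
  rewrite -(edge_dofE (in_Hcurl_hat (enum_valP l)) es eE tT et).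
  by rewrite edge_dof_hat ?enum_valP// (inj_eq enum_val_inj).
under eq_bigr do rewrite hl.
rewrite (bigD1 j)//= eqxx mulr1 big1 ?addr0// => l /negPf lj.
by rewrite eq_sym lj mulr0.
Qed.

(** The inverse estimate at the vertices turns vanishing integrals into vanishing vertex values,
    which determine an affine field. *)
Lemma l2v_eq0 u : pw_affv u -> l2v u u = 0 -> forall t x, t \in tets T -> u t x = 0.
Proof.
move=> hu u0 t x tT.
have int0 s k : s \in tets T -> int s (fun x => u s x 0 k * u s x 0 k) = 0.
  move=> sT; move: u0; rewrite l2vE//.
  have pos l : 0 <= l2s (component u l) (component u l) by exact: l2s_ge0.
  move=> /eqP; rewrite psumr_eq0// => /allP/(_ k); rewrite mem_index_enum => /(_ isT).
  rewrite /= psumr_eq0 => [/allP/(_ s)|r _]; last first.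
    by apply: Rintegral_ge0 => z _; rewrite -expr2 sqr_ge0.
  by rewrite mem_index_enum sT => /(_ isT)/eqP.
rewrite (affv_bary x (t4 tT) (tind tT) (hu t tT)) big1// => i it.
rewrite (_ : u t (V i) = 0) ?scaler0//; apply/rowP => k; rewrite mxE.
have := vertex_le_int shape tT (hu t tT k) it; rewrite int0// mulr0.
rewrite pmulr_lle0 ?(tvol_gt0 shape tT)// => h.
by apply/eqP; rewrite -sqrf_eq0 eq_le h sqr_ge0.
Qed.

Variable eps : R.

Lemma A_grad3_psd : 0 <= eps -> psd (A_grad3 T eps).
Proof.
move=> e0; apply: psd_stiffness; first exact: sform_grad3.
by move=> ik ikn; exact/Hgrad3_affv/Hgrad3_basis_in.
Qed.

Lemma A_curl_psd : 0 <= eps -> psd (A_curl T eps).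
Proof.
move=> e0; apply: psd_stiffness; first exact: sform_curl.
by move=> e en; exact/Hcurl_affv/(Hcurl_basisP en).1.
Qed.

Lemma A_div_psd : 0 <= eps -> psd (A_div T eps).
Proof.
move=> e0; apply: psd_stiffness; first exact: sform_div.
by move=> e en; exact/Hdiv_affv/(Hdiv_basisP en).1.
Qed.

Lemma qform_A_grad3 y z : 0 <= eps -> qform (A_grad3 T eps) y z =
  form_grad3 eps (nodal_field (grad3_nodes T) (@Hgrad3_basis _ _ T) y)
                 (nodal_field (grad3_nodes T) (@Hgrad3_basis _ _ T) z).
Proof.
move=> e0; apply: qform_stiffness; first exact: sform_grad3.
by move=> ik ikn; exact/Hgrad3_affv/Hgrad3_basis_in.
Qed.

Lemma qform_A_curl y z : 0 <= eps -> qform (A_curl T eps) y z =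
  form_curl eps (nodal_field (interior_edges T) (@Hcurl_basis _ _ T) y)
                (nodal_field (interior_edges T) (@Hcurl_basis _ _ T) z).
Proof.
move=> e0; apply: qform_stiffness; first exact: sform_curl.
by move=> e en; exact/Hcurl_affv/(Hcurl_basisP en).1.
Qed.

Lemma qform_A_div y z : 0 <= eps -> qform (A_div T eps) y z =
  form_div eps (nodal_field (interior_faces T) phi y)
               (nodal_field (interior_faces T) phi z).
Proof.
move=> e0; apply: qform_stiffness; first exact: sform_div.
by move=> e en; exact/Hdiv_affv/(Hdiv_basisP en).1.
Qed.

(** No mass term can be relied on when [eps = 0]. A null vector has components that are constant on
    each tetrahedron, and continuity with the boundary condition makes them vanish. *)
Lemma A_grad3_unit : open Omega -> 0 <= eps -> A_grad3 T eps \in unitmx.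
Proof.
move=> oO e0; apply: qform_unit => y; rewrite qform_A_grad3//.
set psi := nodal_field _ _ _ => /eqP.
have hpsi : in_Hgrad3 psi by exact: grad3_nodal_in.
have g0 k : 0 <= l2v (bgrad (component psi k)) (bgrad (component psi k)) by exact: l2v_ge0.
have m0 : 0 <= eps * l2v psi psi by rewrite mulr_ge0// l2v_ge0.
rewrite /form_grad3 paddr_eq0//; last by rewrite sumr_ge0.
move=> /andP[]; rewrite psumr_eq0// => /allP hg _; apply: grad3_nodal_eq0 => t x tT.
apply/rowP => k; rewrite mxE.
have /eqP gk0 := hg k (mem_index_enum k); have hk := Hgrad3_affv hpsi.
apply: (Hgrad_locally_constant (p := component psi k)) => // s sT.
exists (component psi k s 0) => z; apply/eqP; rewrite -subr_eq0.
rewrite -(dot_grad 0 z 0 (hk s sT k)).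
have := @l2v_eq0 _ (pw_affv_grad (pw_affs_component k hk)) gk0 s 0 sT.
by rewrite /bgrad => ->; rewrite dot0l.
Qed.

(** The curl alone has a kernel; definiteness comes from the mass term, which is why [eps] must be
    positive. *)
Lemma A_curl_unit : 0 < eps -> A_curl T eps \in unitmx.
Proof.
move=> e0; apply: qform_unit => y; rewrite qform_A_curl ?ltW//.
set w := nodal_field _ _ _ => /eqP.
have hw : in_Hcurl w by exact: curl_nodal_in.
rewrite /form_curl paddr_eq0 ?l2v_ge0 ?mulr_ge0 ?l2v_ge0// 1?ltW//.
move=> /andP[_]; rewrite mulf_eq0 gt_eqF//= => /eqP w0.
by apply: curl_nodal_eq0; exact: l2v_eq0 (Hcurl_affv hw) w0.
Qed.

(** A basis function has a nonzero constant divergence on a tetrahedron adjacent to its face, so the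
    diagonal is positive even for [eps = 0]. *)
Lemma D_div_gt0 (j : 'I_#|interior_faces T|) : 0 <= eps -> 0 < A_div T eps j j.
Proof.
move=> e0; rewrite mxE; have hphi := @basis_affv _ _ T j.
have [f3 _] := interior_faceP (enum_valP j); have [tT ft] := face_tet f3.
set t := tet_of _ in tT ft; have [p pt fE] := faceP tT f3 ft.
have [n0 _] := nuP tT pt; have W0 := lt0r_neq0 (@flux_mass_gt0 R).
apply: ltr_pwDl; last by rewrite mulr_ge0// l2v_ge0.
rewrite /l2s (bigD1 t)//=; apply: ltr_pwDl; last first.
  by apply: sumr_ge0 => s _; apply: Rintegral_ge0 => z _; rewrite -expr2 sqr_ge0.
set m := (flux_mass * nu t p)^-1.
have divE x : bdiv (phi (enum_val j)) t x = 3 * - m.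
  apply: (@div_radial _ _ (m *: V p)) => y; have [_ ->//] := Hdiv_basisP (enum_valP j).
  by rewrite fE hat_div_single// scalerBr !scaleNr opprK addrC.
rewrite (_ : (fun x => _) = (fun=> (3 * - m) * (3 * - m))); last first.
  by apply/funext => x; rewrite divE.
rewrite (integral3_cst (t4 tT) (tind tT)) mulr_gt0 ?(tvol_gt0 shape tT)//.
rewrite -expr2 lt_def sqr_ge0 sqrf_eq0 andbT mulf_eq0 oppr_eq0 /m invr_eq0.
by rewrite mulf_eq0 (negPf W0) (negPf n0) pnatr_eq0.
Qed.

Lemma qform_D_div y : qform (D_div T eps) y y = \sum_j y 0 j ^+ 2 * A_div T eps j j.
Proof.
rewrite qformE; apply: eq_bigr => i _; rewrite (bigD1 i)//= !mxE eqxx mulr1n.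
rewrite -expr2 big1 ?addr0// => j /negPf ij.
by rewrite !mxE eq_sym ij mulr0n mulr0.
Qed.

Lemma D_div_psd : 0 <= eps -> psd (D_div T eps).
Proof.
move=> e0; split; first exact: tr_diag_mx.
move=> y; rewrite qform_D_div; apply: sumr_ge0 => j _.
by rewrite mulr_ge0 ?sqr_ge0// ltW// D_div_gt0.
Qed.

Lemma D_div_unit : 0 <= eps -> D_div T eps \in unitmx.
Proof.
move=> e0; rewrite unitmxE det_diag unitfE.
by apply/prodf_neq0 => j _; rewrite mxE gt_eqF// D_div_gt0.
Qed.

End Invertibility.

(** * The preconditioner *)

Section Preconditioner.
Context {R : realType} {Omega : set 'rV[R]_3}.
Variables (T : triangulation Omega) (sigma : R).
Local Notation vfield := (vfield T).
Local Notation phi := (@Hdiv_basis R Omega T).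
Local Notation div_field := (nodal_field (interior_faces T) phi).
Local Notation grad3_field := (nodal_field (grad3_nodes T) (@Hgrad3_basis _ _ T)).
Local Notation curl_field := (nodal_field (interior_edges T) (@Hcurl_basis _ _ T)).
Local Notation div_coord v := (\row_j face_dof v (enum_val j)).
Implicit Types (u v w psi : vfield).
Hypotheses (shape : shape_regular T sigma) (Oopen : open Omega).
Local Notation G2 := ((4 * sigma) ^+ 2).
Local Notation K := (shapeK sigma).

Lemma sform_ext2 (a : vfield -> vfield -> R) u v : sform a -> mesh_eq u v ->
  a u u = a v v.
Proof.
by move=> h uv; rewrite (sform_ext h _ uv) (sform_sym h) (sform_ext h _ uv).
Qed.

Lemma Pi_div_nodal psi : Pi_div psi = div_field (div_coord psi).
Proof.
apply/funext => t; apply/funext => x; rewrite /Pi_div /nodal_field /comb.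
under [RHS]eq_bigr do rewrite mxE.
by rewrite -(big_enum_val (fun f => face_dof psi f *: phi f t x)).
Qed.

Lemma Pi_div_mx_coord (z : 'rV[R]_#|grad3_nodes T|) :
  z *m (Pi_div_mx T)^T = div_coord (grad3_field z).
Proof.
apply/rowP => j; have [f3 _] := interior_faceP (enum_valP j); rewrite !mxE.
rewrite face_dof_comb//; last by move=> l; exact/Hgrad3_affv/Hgrad3_basis_in/enum_valP.
by apply: eq_bigr => l _; rewrite !mxE Pi_div_nodal face_dof_nodal mxE.
Qed.

Lemma curl_comb (I : finType) (c : I -> R) (F : I -> vfield) :
  (forall i, pw_affv (F i)) ->
  mesh_eq (bcurl (comb c F)) (comb c (fun i => bcurl (F i))).
Proof.
move=> hF t x tT; apply/rowP => k.
rewrite -[LHS]/(component (bcurl (comb c F)) k t x) (linop_comb (linop_curl T k))//.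
by rewrite /comb summxE; apply: eq_bigr => i _; rewrite mxE.
Qed.

Lemma curl_mx_coord (z : 'rV[R]_#|interior_edges T|) :
  z *m (curl_mx T)^T = div_coord (bcurl (curl_field z)).
Proof.
have hF (l : 'I_#|interior_edges T|) : pw_affv (Hcurl_basis (T := T) (enum_val l)).
  exact/Hcurl_affv/(Hcurl_basisP (enum_valP l)).1.
apply/rowP => j; have [f3 _] := interior_faceP (enum_valP j); rewrite !mxE.
rewrite (face_dof_eq f3 (curl_comb _ hF)) face_dof_comb//.
  by apply: eq_bigr => l _; rewrite !mxE.
by move=> l; exact: pw_affv_curl.
Qed.

Lemma face_dofD u v f : f \in simplices T 3 -> pw_affv u -> pw_affv v ->
  face_dof (fun t x => u t x + v t x) f = face_dof u f + face_dof v f.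
Proof.
move=> f3 hu hv; have [tT _] := face_tet f3.
rewrite !face_dofE; [|exact: hv|exact: hu|by apply: affvD; [exact: hu|exact: hv]].
by rewrite -big_split; apply: eq_bigr => k _ /=; rewrite dotDl mulrDr.
Qed.

Section FixedEps.
Variable eps : R.
Hypothesis eps0 : 0 <= eps.
Local Notation A := (A_div T eps).

Lemma qform_smoother_stability (z : 'rV[R]_#|interior_faces T|) :
  qform A (z *m (1%:M)^T) (z *m (1%:M)^T) <= 4 * qform (D_div T eps) z z.
Proof.
rewrite trmx1 mulmx1 qform_A_div// qform_D_div.
apply: le_trans (smoother_stability _ eps0) _; rewrite ler_wpM2l//.
by apply: ler_sum => j _; rewrite mxE.
Qed.

Lemma qform_Pi_stability (z : 'rV[R]_#|grad3_nodes T|) :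
  qform A (z *m (Pi_div_mx T)^T) (z *m (Pi_div_mx T)^T) <=
  (144 + 192 * K) * G2 * qform (A_grad3 T eps) z z.
Proof.
rewrite Pi_div_mx_coord qform_A_div// qform_A_grad3// -Pi_div_nodal.
by apply: Pi_stability => //; exact: grad3_nodal_in.
Qed.

Lemma qform_curl_mx (z : 'rV[R]_#|interior_edges T|) :
  qform A (z *m (curl_mx T)^T) (z *m (curl_mx T)^T) =
  eps * l2v (bcurl (curl_field z)) (bcurl (curl_field z)).
Proof.
have [hd d0] := curl_Hdiv (curl_nodal_in z).
rewrite curl_mx_coord qform_A_div//.
rewrite -(sform_ext2 (sform_div T eps0) (Hdiv_nodal_expand hd)).
rewrite /form_div (_ : l2s _ _ = 0) ?add0r//.
apply: big1 => t tT; rewrite /integral3 (_ : (fun p => _) = cst 0).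
  by rewrite Rintegral_cst ?mul0r//; apply: measurable_cell;
      [exact: tri_card|exact: tri_nondegenerate].
by apply/funext => p; rewrite d0// mulr0.
Qed.

(** The factor [eps] left in the energy of a curl is matched by the one in [eps *: A_curl], so the
    constant does not depend on [eps]. *)
Lemma qform_curl_stability (z : 'rV[R]_#|interior_edges T|) :
  qform A (z *m (curl_mx T)^T) (z *m (curl_mx T)^T) <=
  1 * qform (eps *: A_curl T eps) z z.
Proof.
rewrite mul1r qform_curl_mx qformZm qform_A_curl// ler_wpM2l//.
by rewrite /form_curl lerDl mulr_ge0// l2v_ge0.
Qed.

Variables (H CR : R).
Hypotheses (eps1 : eps <= 1) (H0 : 0 <= H).
Hypothesis meshH : forall t, t \in tets T -> meshsize t <= H.
Hypothesis decomposition : discrete_regular_decomposition T CR.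
Local Notation C3 := (16 * K * G2 * (9 + 3 * H ^+ 2)).

(** Coordinates of the three parts of the regular decomposition. The energy dominates the squared
    norm of the divergence, which settles the first two parts. For the third, [eps] times the
    squared H(div) norm is at most the energy because [eps <= 1]. *)
Lemma stable_decomposition (y : 'rV[R]_#|interior_faces T|) : 0 <= C3 ->
  exists s1 s2 s3,
  [/\ y = s1 + s2 *m (Pi_div_mx T)^T + s3 *m (curl_mx T)^T,
      qform (D_div T eps) s1 s1 <= C3 * `|CR| * qform A y y,
      qform (A_grad3 T eps) s2 s2 <= `|CR| * qform A y y
    & qform (eps *: A_curl T eps) s3 s3 <= `|CR| * qform A y y].
Proof.
move=> C30; have hv := div_nodal_in y; set v := div_field y in hv.
have [vt [psi [w [[hvt hpsi hw] vE e1 e2]]]] := decomposition hv.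
have Ay : qform A y y = l2s (bdiv v) (bdiv v) + eps * l2v v v by rewrite qform_A_div.
have dv0 : 0 <= l2s (bdiv v) (bdiv v) by exact: l2s_ge0.
have lv0 : 0 <= l2v v v by exact: l2v_ge0.
(* The sign of [CR] is unknown; its absolute value keeps the constants nonnegative. *)
have CRa : CR <= `|CR| := ler_norm CR; have CR0 : 0 <= `|CR| := normr_ge0 CR.
have dA : l2s (bdiv v) (bdiv v) <= qform A y y by rewrite Ay lerDl mulr_ge0.
have e1' : sqnorm_L2 (hinv vt) + sqnorm_H1 psi <= `|CR| * qform A y y.
  apply: le_trans e1 _; apply: (@le_trans _ _ (`|CR| * l2s (bdiv v) (bdiv v))).
    by rewrite ler_wpM2r.
  by rewrite ler_wpM2l.
have n1 : 0 <= sqnorm_L2 (hinv vt) by exact: l2v_ge0.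
have g0 : 0 <= \sum_k l2v (bgrad (component psi k)) (bgrad (component psi k)).
  by apply: sumr_ge0 => k _; exact: l2v_ge0.
have p0 : 0 <= l2v psi psi by exact: l2v_ge0.
have n2 : 0 <= sqnorm_H1 psi by rewrite addr_ge0.
exists (div_coord vt), (grad3_coord psi), (\row_j edge_dof w (enum_val j)); split.
- rewrite Pi_div_mx_coord curl_mx_coord; apply/rowP => j; rewrite !mxE.
  have [f3 _] := interior_faceP (enum_valP j).
  rewrite -[LHS](face_dof_nodal y j) -/v.
  rewrite -(face_dof_eq f3 (Hgrad3_expand hpsi)).
  rewrite -(face_dof_eq f3 (mesh_eq_curl (Hcurl_nodal_expand hw))).
  rewrite (@face_dof_eq _ _ _ _ v (fun t x => vt t x + Pi_div psi t x + bcurl w t x) f3 vE).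
  have [hcw _] := curl_Hdiv hw.
  have hP := Pi_affv hpsi; have hvt' := Hdiv_affv hvt.
  rewrite (face_dofD f3 (u := fun t x => vt t x + Pi_div psi t x)).
  + by rewrite (face_dofD f3 hvt' hP) Pi_div_nodal face_dof_nodal mxE.
  + by move=> t tT; apply: affvD; [exact: hvt'|exact: hP].
  + exact: Hdiv_affv.
- rewrite qform_D_div.
  have he : 0 <= eps <= 1 by rewrite eps0.
  have := smoother_lower shape he H0 meshH hvt.
  have -> : \sum_(j < #|interior_faces T|) face_dof vt (enum_val j) ^+ 2 *
        form_div eps (phi (enum_val j)) (phi (enum_val j)) =
      \sum_j (div_coord vt) 0 j ^+ 2 * A j j.
    by apply: eq_bigr => j _; rewrite !mxE.
  move=> /le_trans; apply; rewrite -(mulrA C3); apply: ler_wpM2l => //.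
  by apply: le_trans e1'; rewrite lerDl.
- rewrite qform_A_grad3//.
  rewrite -(sform_ext2 (sform_grad3 T eps0) (Hgrad3_expand hpsi)).
  apply: (@le_trans _ _ (sqnorm_H1 psi)); last first.
    by apply: le_trans e1'; rewrite lerDr.
  rewrite /form_grad3 /sqnorm_H1 addrC lerD2r.
  by rewrite ler_piMl.
- rewrite qformZm qform_A_curl//.
  rewrite -(sform_ext2 (sform_curl T eps0) (Hcurl_nodal_expand hw)) /form_curl.
  have w0 : 0 <= l2v w w by exact: l2v_ge0.
  have c0 : 0 <= l2v (bcurl w) (bcurl w) by exact: l2v_ge0.
  apply: (@le_trans _ _ (eps * sqnorm_Hcurl w)).
    by rewrite ler_wpM2l// /sqnorm_Hcurl addrC lerD2r ler_piMl.
  apply: (@le_trans _ _ (eps * (`|CR| * sqnorm_Hdiv v))).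
    rewrite ler_wpM2l// (le_trans e2)// ler_wpM2r//.
    by rewrite addr_ge0.
  rewrite mulrCA ler_wpM2l// Ay /sqnorm_Hdiv mulrDr addrC lerD2r.
  by rewrite ler_piMl.
Qed.

(** The upper constant adds 4 for the smoother, 1 for the curl block and the constant of the
    interpolation. For the lower one, twice the energy is at most c (B A y, A y) plus c^-1 times the
    norms of the parts, and the latter is at most the energy. *)
Lemma B_div_bounds (y : 'rV[R]_#|interior_faces T|) : 0 < sigma ->
  (C3 * `|CR| + 2 * `|CR| + 1)^-1 * qform A y y <=
    qform (B_div T eps) (y *m A) (y *m A) <=
  (5 + (144 + 192 * K) * G2) * qform A y y.
Proof.
move=> s0; have K0 : 0 <= K by rewrite /shapeK mulr_ge0// exprn_ge0// mulr_ge0// ltW.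
have G0 : 0 <= G2 := sqr_ge0 _.
have M0 : 0 <= (144 + 192 * K) * G2.
  by apply: mulr_ge0 G0; rewrite addr_ge0// mulr_ge0.
have C30 : 0 <= C3.
  apply: mulr_ge0; last by rewrite addr_ge0// mulr_ge0// sqr_ge0.
  by apply: mulr_ge0 G0; exact: mulr_ge0.
have Ap := A_div_psd T eps0; have A0 := Ap.2 y.
have Dp := D_div_psd shape eps0; have Du := D_div_unit shape eps0.
have Gp := A_grad3_psd T eps0; have Gu := A_grad3_unit shape Oopen eps0.
set qD := qform (invmx (D_div T eps)) (y *m A) (y *m A).
set qG := qform (Pi_div_mx T *m invmx (A_grad3 T eps) *m (Pi_div_mx T)^T)
  (y *m A) (y *m A).
set qC := qform (if 0 < eps
     then eps^-1 *: (curl_mx T *m invmx (A_curl T eps) *m (curl_mx T)^T) else 0)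
  (y *m A) (y *m A).
have qB : qform (B_div T eps) (y *m A) (y *m A) = qD + qG + qC.
  by rewrite /B_div !qformDm.
have D1 : 1%:M *m invmx (D_div T eps) *m (1%:M)^T = invmx (D_div T eps).
  by rewrite mul1mx trmx1 mulmx1.
have upD : qD <= 4 * qform A y y.
  rewrite /qD -D1; apply: subspace_stability => //.
  exact: qform_smoother_stability.
have upG : qG <= (144 + 192 * K) * G2 * qform A y y.
  by apply: subspace_stability => //; exact: qform_Pi_stability.
(* The sum of the three constants of the decomposition; the added 1 makes it positive. *)
pose c := C3 * `|CR| + 2 * `|CR| + 1.
have c0 : 0 < c by rewrite ltr_wpDl// addr_ge0// mulr_ge0.
have [s1 [s2 [s3 [yE h1 h2 h3]]]] := stable_decomposition y C30.
have loD : 2 * qform A y s1 <= c * qD + c^-1 * qform (D_div T eps) s1 s1.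
  have := subspace_young 1%:M Ap Dp Du y s1 c0.
  by rewrite D1 trmx1 mulmx1.
have loG := subspace_young (Pi_div_mx T) Ap Gp Gu y s2 c0.
rewrite -/qG in loG.
have [upC loC] : qC <= qform A y y /\
    2 * qform A y (s3 *m (curl_mx T)^T) <=
    c * qC + c^-1 * qform (eps *: A_curl T eps) s3 s3.
  (* For [eps = 0] the curl part has zero energy, hence lies in the kernel of [A], and every term of
     both claims that involves the curl block is zero. *)
  move: eps0; rewrite le_eqVlt => /predU1P[e0|ep].
    have qC0 : qC = 0 by rewrite /qC -e0 ltxx /qform mulmx0 mul0mx mxE.
    have z0 : qform A (s3 *m (curl_mx T)^T) (s3 *m (curl_mx T)^T) = 0.
      by rewrite qform_curl_mx -e0 mul0r.
    have zy : qform A y (s3 *m (curl_mx T)^T) = 0.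
      by rewrite (qform_sym _ _ Ap.1) /qform (psd_ker Ap z0) mul0mx mxE.
    have q3 : qform (eps *: A_curl T eps) s3 s3 = 0.
      by rewrite qformZm -[X in X * _]e0 mul0r.
    by rewrite qC0 zy q3 !mulr0 addr0.
  have Cu := A_curl_unit shape ep; have Cp := A_curl_psd T eps0.
  have eCp : psd (eps *: A_curl T eps) by exact: psdZ.
  have eCu : eps *: A_curl T eps \in unitmx.
    by rewrite unitmxZ// unitfE gt_eqF.
  (* The factor [eps^-1] is moved into the inverse, so that the block has the form P C^-1 P^t with
     [C = eps *: A_curl]. *)
  have qCE : qC = qform (curl_mx T *m invmx (eps *: A_curl T eps) *m (curl_mx T)^T)
      (y *m A) (y *m A).
    by rewrite /qC ep invmxZ ?unitmxE// -scalemxAr -scalemxAl.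
  rewrite qCE; split; last exact: subspace_young.
  rewrite -[leRHS]mul1r; apply: subspace_stability => //.
  exact: qform_curl_stability.
rewrite qB; apply/andP; split; last first.
  apply: le_trans (lerD (lerD upD upG) upC) _.
  by rewrite le_eqVlt; apply/orP; left; apply/eqP; ring.
rewrite mulrC ler_pdivrMr// mulrC -/c.
have yy : 2 * qform A y y = 2 * qform A y s1 +
    2 * qform A y (s2 *m (Pi_div_mx T)^T) + 2 * qform A y (s3 *m (curl_mx T)^T).
  by rewrite {2}yE !qformDr; ring.
have cA : c^-1 * (qform (D_div T eps) s1 s1 + qform (A_grad3 T eps) s2 s2 +
    qform (eps *: A_curl T eps) s3 s3) <= qform A y y.
  rewrite mulrC ler_pdivrMr//; apply: le_trans (lerD (lerD h1 h2) h3) _.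
  have -> : qform A y y * c = (C3 * `|CR| * qform A y y + `|CR| * qform A y y +
      `|CR| * qform A y y) + qform A y y by rewrite /c; ring.
  by rewrite lerDl.
rewrite !mulrDr; rewrite !mulrDr in cA; lra.
Qed.

End FixedEps.
End Preconditioner.

Unset Implicit Arguments.

Theorem theorem7p3 (R : realType) (Omega : set 'rV[R]_3)
    (hOmega : polyhedral_domain Omega) (sigma tau CR : R) :
  exists C : R,
    forall (I : Type) (Th : I -> triangulation Omega),
      quasi_uniform sigma tau Th ->
      (forall i, discrete_regular_decomposition (Th i) CR) ->
      forall (i : I) (eps : R), 0 <= eps <= 1 ->
        A_div (Th i) eps != 0 ->
        kappa (B_div (Th i) eps *m A_div (Th i) eps) <= C.
Proof.
have [_ Oopen _ Obounded _] := hOmega.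
have [H H0 meshH] := meshsize_bounded Obounded.
pose K := shapeK sigma; pose G2 := (4 * sigma) ^+ 2.
pose c := 16 * K * G2 * (9 + 3 * H ^+ 2) * `|CR| + 2 * `|CR| + 1.
(* The quotient of the two constants of [B_div_bounds]; it depends only on [sigma], [CR] and the
   bound [H] on the mesh sizes, and is fixed before the mesh and [eps]. *)
exists ((5 + (144 + 192 * K) * G2) / c^-1).
move=> I Th qu dec i eps /andP[eps0 eps1] A0.
have shape : shape_regular (Th i) sigma by have [h _] := qu i.
(* A nonzero entry supplies an interior face, hence a tetrahedron, and with it the positivity of
   [sigma] that gives the constants their signs. *)
have [j [k Ajk]] : exists j k, A_div (Th i) eps j k != 0.
  apply: contrapT => h; move/eqP: A0; apply; apply/matrixP => j k; rewrite [RHS]mxE.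
  by apply/eqP; apply: contraT => Ajk; case: h; exists j, k.
have [f3 _] := interior_faceP (enum_valP j); have [tT _] := face_tet f3.
have s0 := sigma_gt0 shape tT.
have K0 : 0 <= K by exact: (shapeK_ge0 shape tT).
have G0 : 0 <= G2 by exact: sqr_ge0.
have C30 : 0 <= 16 * K * G2 * (9 + 3 * H ^+ 2).
  apply: mulr_ge0; last by rewrite addr_ge0// mulr_ge0// sqr_ge0.
  by apply: mulr_ge0 G0; exact: mulr_ge0.
have c0 : 0 < c by rewrite ltr_wpDl// addr_ge0// mulr_ge0.
apply: kappa_le; first by rewrite invr_gt0.
  by rewrite addr_ge0//; apply: mulr_ge0 G0; rewrite addr_ge0// mulr_ge0.
move=> a; apply: eigenvalue_bounds; first exact: A_div_psd.
by move=> y; apply: B_div_bounds => //; exact: meshH.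
Qed.
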